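(* Define $G:[-1,1]\to[0,\frac12]$ by $G(r)=\Sigma_n\big(\frac{\pi-\arccos r}{2}\big)$. For any measurable functions $f,g:\mathbb{S}^n\to[0,\infty)$ and any measurable, non-increasing function $\Omega:(-1,1]\to(0,\infty)$ satisfying $$f(x)g(y)\le\Omega^2(\langle x,y\rangle)\qquad\text{for all }x,y\in\mathbb{S}^n,\ x\ne-y,$$ one has $$\Big(\int_{\mathbb{S}^n}f\,d\sigma_n\Big)^{1/2}\Big(\int_{\mathbb{S}^n}g\,d\sigma_n\Big)^{1/2}\le2\int_{-1}^1\Omega(r)\,dG(r).$$ In particular, if (in addition) $f$ and $g$ satisfy $f(x)g(y)=0$ for all $x,y\in\mathbb{S}^n$ with $\langle x,y\rangle>0$, then $$\Big(\int_{\mathbb{S}^n}f\,d\sigma_n\Big)^{1/2}\Big(\int_{\mathbb{S}^n}g\,d\sigma_n\Big)^{1/2}\le\int_{-1}^1\Omega(r)\,dG(r).$$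
   Context: $\mathbb{S}^n\subset\mathbb{R}^{n+1}$ is the $n$-dimensional unit sphere with its geodesic distance $d(x,y)=\arccos\langle x,y\rangle$, and $\sigma_n$ is the Haar (rotation-invariant) probability measure on $\mathbb{S}^n$. $\Sigma_n(r)=\dfrac{\int_0^r\sin^{n-1}\theta\,d\theta}{\int_0^\pi\sin^{n-1}\theta\,d\theta}$ is the $\sigma_n$-measure of a spherical cap of geodesic radius $r\in[0,\pi]$. $dG$ is the Lebesgue–Stieltjes measure of the continuous non-decreasing function $G$ on $(-1,1]$. Measurable means Borel measurable. *)

(* Defs.v *)
From HB Require Import structures.
From mathcomp Require Import all_boot all_order all_algebra.
From mathcomp Require Import all_classical all_reals all_analysis.

Set Implicit Arguments.
Unset Strict Implicit.
Unset Printing Implicit Defensive.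

Import Order.TTheory GRing.Theory Num.Theory.
Import numFieldNormedType.Exports.

Local Open Scope classical_set_scope.
Local Open Scope ring_scope.

(* R^m with its Borel sigma-algebra.  Borel functions and Borel measures on the
   unit sphere are represented as functions on R^m that are measurable on the
   sphere and as measures on R^m that are carried by the sphere. *)
Definition borelRV (R : realType) (m : nat) :=
  g_sigma_algebraType (@open 'rV[R]_m).

Definition inner (R : realType) (m : nat) (x y : 'rV[R]_m) : R :=
  \sum_(i < m) x 0 i * y 0 i.

(* The n-dimensional unit sphere of R^(n+1). *)
Definition sphere (R : realType) (n : nat) : set (borelRV R n.+1) :=
  [set x | inner x x = 1].
Arguments sphere : clear implicits.

Definition rotation (R : realType) (m : nat) (A : 'M[R]_m) : Prop :=
  A *m A^T = 1%:M /\ \det A = 1.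

(* For 0 < n these conditions determine sigma uniquely. *)
Record is_haar_sphere (R : realType) (n : nat)
    (sigma : probability (borelRV R n.+1) R) : Prop := {
  haar_carried : sigma (sphere R n) = 1%E ;
  haar_invariant : forall (A : 'M[R]_n.+1) (B : set (borelRV R n.+1)),
    rotation A -> measurable B -> sigma [set x | B (x *m A)] = sigma B }.

Definition Sigma (R : realType) (n : nat) (r : R) : R :=
  (\int[@lebesgue_measure R]_(t in `[0%R, r]) (sin t ^+ n.-1)) /
  (\int[@lebesgue_measure R]_(t in `[0%R, pi]) (sin t ^+ n.-1)).

Definition G (R : realType) (n : nat) (r : R) : R :=
  Sigma n ((pi - acos r) / 2).

Definition clamp (R : realType) (a b r : R) : R := Num.max a (Num.min b r).

(* [lebesgue_stieltjes_measure] expects a function on the whole line, so G is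
   extended from [-1, 1] by constants; on ](-1), 1] this does not change dG. *)
Definition Gext (R : realType) (n : nat) (r : R) : R := G n (clamp (-1) 1 r).

Section Gext_cumulative.
Context {R : realType}.
Implicit Types (n : nat) (a b r x y : R).

Lemma clamp_itv a b r : a <= b -> clamp a b r \in `[a, b].
Proof. by move=> ab; rewrite in_itv/= /clamp le_max lexx ge_max ab ge_min lexx. Qed.

Lemma clamp_id a b r : r \in `[a, b] -> clamp a b r = r.
Proof.
rewrite in_itv/= /clamp => /andP[ar rb].
by rewrite (min_idPr rb) (max_idPr ar).
Qed.

Lemma Gext_id n r : r \in `[(-1), 1] -> Gext n r = G n r.
Proof. by move=> rI; rewrite /Gext clamp_id. Qed.

Lemma le_clamp a b : {homo clamp a b : x y / x <= y}.
Proof.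
move=> x y xy; rewrite /clamp ge_max !le_max lexx/=.
by rewrite le_min !ge_min lexx xy !orbT.
Qed.

Lemma continuous_clamp a b : continuous (clamp a b).
Proof.
move=> x; apply: (@continuous_max R R^o (cst a) (fun r => Num.min b r) x).
  exact: cvg_cst.
apply: (@continuous_min R R^o (cst b) id x); first exact: cvg_cst.
exact: cvg_id.
Qed.

Lemma within_clamp a b (h : R -> R) : a <= b ->
  {within `[a, b], continuous h} -> continuous (h \o clamp a b).
Proof.
move=> ab /subspace_continuousP ch x.
have xab : `[a, b]%classic (clamp a b x) by exact: clamp_itv.
apply: (cvg_comp _ _ _ (ch _ xab)) => P /= [e /= e0 eP].
have : \forall y \near x, ball (clamp a b x) e (clamp a b y).
  by apply: (@continuous_clamp a b x); exact: nbhsx_ballx.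
apply: filterS => y /eP; apply; exact: clamp_itv.
Qed.

Lemma continuous_sinX n : continuous (fun t : R => sin t ^+ n).
Proof.
move=> t; apply: (@continuous_comp _ _ _ (@sin R) (fun u : R => u ^+ n)).
  exact: continuous_sin.
exact: exprn_continuous.
Qed.

Lemma integrable_sinX n a b :
  (@lebesgue_measure R).-integrable `[a, b] (EFin \o (fun t : R => sin t ^+ n)).
Proof.
apply: continuous_compact_integrable; first exact: segment_compact.
by apply: continuous_subspaceT; exact: continuous_sinX.
Qed.

Lemma Sigma_continuous n : {within `[0, pi], continuous (@Sigma R n)}.
Proof.
have H := @parameterized_integral_continuous R 0 pi
  (fun t => sin t ^+ n.-1) (pi_ge0 R) (@integrable_sinX n.-1 0 pi).
by move=> x; apply: cvgM; [exact: H | exact: cvg_cst].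
Qed.

Lemma acos_continuous : {within `[(-1), 1], continuous (@acos R)}.
Proof.
have := @segment_can_ge_continuous R 0 pi cos acos (pi_ge0 R).
rewrite cos0 cospi; apply; last exact: cosK.
by apply: continuous_subspaceT; exact: continuous_cos.
Qed.

Lemma le_acos : {in `[(-1), 1] &, {homo @acos R : x y /~ x <= y}}.
Proof.
move=> x y xI yI xy; rewrite leNgt; apply/negP => lxy.
have := xI; have := yI; rewrite !in_itv/= => xI' yI'.
have : cos (acos x) < cos (acos y).
  by rewrite ltr_cos// in_itv/=; apply/andP; split; rewrite ?acos_ge0 ?acos_lepi.
by rewrite !acosK// ltNge xy.
Qed.

Lemma le_Sigma n x y : x \in `[0, pi] -> y \in `[0, pi] -> x <= y ->
  Sigma n x <= Sigma n y.
Proof.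
rewrite !in_itv/= => /andP[x0 xpi] /andP[y0 ypi] xy.
have sin0 (t : R) : 0 <= t <= pi -> 0 <= sin t ^+ n.-1.
  by move=> t0; rewrite exprn_ge0// sin_ge0_pi.
rewrite /Sigma ler_wpM2r//.
  rewrite invr_ge0; apply: Rintegral_ge0 => t /=; rewrite in_itv/=; exact: sin0.
apply: fine_le.
- exact: integrable_fin_num (integrable_sinX _ _ _).
- exact: integrable_fin_num (integrable_sinX _ _ _).
apply: ge0_subset_integral => //=.
- by have /measurable_int := @integrable_sinX n.-1 0 y.
- move=> t /=; rewrite in_itv/= => /andP[t0 ty]; rewrite lee_fin sin0//.
  by rewrite t0 (le_trans ty).
- by apply: subset_itvl; rewrite bnd_simp.
Qed.

Lemma half_acos_itv x : x \in `[(-1), 1] -> (pi - acos x) / 2 \in `[0, pi].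
Proof.
rewrite !in_itv/= => xI; have := acos_ge0 xI; have := acos_lepi xI => h1 h0.
rewrite divr_ge0 ?subr_ge0//= ler_pdivrMr// mulr_natr mulr2n.
by rewrite lerBlDr -addrA lerDl addr_ge0// pi_ge0.
Qed.

Lemma N11 : -1 <= 1 :> R.
Proof. by rewrite lerNl (le_trans _ ler01)// lerN10. Qed.

Lemma Gext_nondecreasing n : nondecreasing (@Gext R n).
Proof.
move=> x y xy; have cI r := clamp_itv r N11.
rewrite /Gext /G; apply: le_Sigma; try exact: half_acos_itv.
by rewrite ler_pM2r ?invr_gt0// lerB// le_acos// le_clamp.
Qed.

Lemma Gext_continuous n : continuous (@Gext R n).
Proof.
have -> : @Gext R n =
    (Sigma n \o clamp 0 pi) \o (fun r => (pi - (@acos R \o clamp (-1) 1) r) / 2).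
  apply/funext => r /=.
  by rewrite /Gext /G [clamp 0 pi _]clamp_id// half_acos_itv// clamp_itv// N11.
move=> x; apply: continuous_comp.
  apply: cvgM; last exact: cvg_cst.
  apply: cvgB; first exact: cvg_cst.
  exact: (within_clamp N11 acos_continuous).
exact: (within_clamp (pi_ge0 R) (@Sigma_continuous n)).
Qed.

HB.instance Definition _ n := isCumulative.Build R _ R (@Gext R n)
  (@Gext_nondecreasing n) (right_continuousW (@Gext_continuous n)).

End Gext_cumulative.

(* Main.v *)
(* Write A and B for the level sets {f > e^a} and {g > e^b}. Since Omega is
   nonincreasing, <x, y> <= rho on A x B, where rho is the right end of the set
   of r with Omega r > e^((a+b)/2); so A and B are at distance at least
   arccos rho, and the isoperimetric inequality for separated sets bounds
   sigma A * sigma B by G(rho)^2. In the coordinates a, b the integrals of f, g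
   and Omega are integrals of e^a sigma{f > e^a}, etc., so these pointwise bounds
   combine through the one-dimensional Prekopa-Leindler inequality. The factor 2
   is only needed when rho = 1, where A and B need not be separated and
   sigma A * sigma B <= 1 <= (2 G(1))^2 is used instead.

   For the isoperimetric inequality one minimizes, over a compact class of
   1-Lipschitz functions u separating sets of prescribed measures, the integral of
   u times the distance to a pole. Polarization in a hyperplane preserves the class
   and does not increase that integral, so a minimizer is monotone in the height
   and the sets may be taken to be opposite caps; log-concavity of Sigma then
   shows that equal radii are best. Polarization uses invariance of sigma under
   reflections, while only rotations are given: it follows from uniqueness of
   an invariant mean, by integrating a cap kernel in both orders. That Sigma is
   the measure of caps is obtained by comparing moments of the height, through
   the recursion given by infinitesimal rotations. *)
Require Import Defs.
From HB Require Import structures.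
From mathcomp Require Import all_boot all_order all_algebra finmap.
From mathcomp Require Import all_classical all_reals all_analysis.
From mathcomp Require Import measurable_realfun.
From mathcomp Require Import zify ring lra.

Set Implicit Arguments.
Unset Strict Implicit.
Unset Printing Implicit Defensive.

Import Order.TTheory GRing.Theory Num.Theory.
Import numFieldNormedType.Exports.

Local Open Scope classical_set_scope.
Local Open Scope ring_scope.

(** Polarization acts on functions, not on sets, and the extremal is found by compactness instead of
    a convergent sequence of polarizations. Functions with values in [0, alpha] form a compact set
    for pointwise convergence; a common Lipschitz bound, which polarization respects, makes that
    convergence uniform on the sphere, so that means pass to the limit. A strict decrease under a
    well-chosen polarization then forces a minimizer to be monotone. This is why invariance of
    [sigma] under reflections is established for Lipschitz functions.

    Caps enter only through the upper bound of their measure by [Sigma]: the sets where the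
    minimizer is 0 or [alpha] are each enclosed in a cap. The same bound for two opposite
    hemispheres gives G(1) >= 1/2, the origin of the factor 2.

    Prekopa-Leindler is used in the form U(a) V(b) <= W(a + b)^2, with the sum in place of the
    midpoint; the factor 4 that this produces is absorbed by the substitution e^(a/2) for the values
    of Omega. *)

(** * Inner product, hyperplane reflections and geodesic distance *)

Section inner_product.
Context {R : realType} {m : nat}.
Implicit Types (x y z v : 'rV[R]_m) (c : R).

Lemma innerE x y : inner x y = (x *m y^T) 0 0.
Proof. by rewrite mxE; apply: eq_bigr => i _; rewrite mxE. Qed.

Lemma innerC x y : inner x y = inner y x.
Proof. by apply: eq_bigr => i _; rewrite mulrC. Qed.

Lemma innerDl x y z : inner (x + y) z = inner x z + inner y z.
Proof. by rewrite /inner -big_split; apply: eq_bigr => i _; rewrite mxE mulrDl. Qed.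

Lemma innerZl c x y : inner (c *: x) y = c * inner x y.
Proof. by rewrite /inner mulr_sumr; apply: eq_bigr => i _; rewrite mxE mulrA. Qed.

Lemma innerNl x y : inner (- x) y = - inner x y.
Proof. by rewrite -scaleN1r innerZl mulN1r. Qed.

Lemma innerBl x y z : inner (x - y) z = inner x z - inner y z.
Proof. by rewrite innerDl innerNl. Qed.

Lemma innerDr x y z : inner x (y + z) = inner x y + inner x z.
Proof. by rewrite innerC innerDl ![inner x _]innerC. Qed.

Lemma innerZr c x y : inner x (c *: y) = c * inner x y.
Proof. by rewrite innerC innerZl innerC. Qed.

Lemma innerNr x y : inner x (- y) = - inner x y.
Proof. by rewrite innerC innerNl innerC. Qed.

Lemma innerBr x y z : inner x (y - z) = inner x y - inner x z.
Proof. by rewrite innerDr innerNr. Qed.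

Lemma inner_ge0 x : 0 <= inner x x.
Proof. by apply: sumr_ge0 => i _; rewrite -expr2 sqr_ge0. Qed.

Lemma inner_eq0 x : (inner x x == 0) = (x == 0).
Proof.
apply/eqP/eqP => [|->]; last first.
  by rewrite /inner big1// => i _; rewrite mxE mul0r.
move=> /eqP; rewrite psumr_eq0; last by move=> i _; rewrite -expr2 sqr_ge0.
move=> /allP H; apply/rowP => i; rewrite mxE.
by have := H i (mem_index_enum _); rewrite /= mulf_eq0 orbb => /eqP.
Qed.

Lemma inner_gt0 x : (0 < inner x x) = (x != 0).
Proof. by rewrite lt_def inner_ge0 andbT inner_eq0. Qed.

Lemma cauchy_schwarz x y : inner x y ^+ 2 <= inner x x * inner y y.
Proof.
have [->|y0] := eqVneq y 0.
  have -> : inner x 0 = 0 by rewrite -(scale0r 0) innerZr mul0r.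
  by rewrite expr0n mulr_ge0// inner_ge0.
have yy : 0 < inner y y by rewrite inner_gt0.
(* The squared norm of this vector is [inner y y] times the difference of the two sides. *)
have := inner_ge0 (inner y y *: x - inner x y *: y).
rewrite innerBl !innerBr !innerZl !innerZr [inner y x]innerC.
move=> H; rewrite -subr_ge0 -(pmulr_rge0 _ yy); move: H.
by congr (_ <= _); ring.
Qed.

Lemma inner_le1 x y : inner x x = 1 -> inner y y = 1 -> -1 <= inner x y <= 1.
Proof.
move=> x1 y1; rewrite -ler_norml -(@ler_pXn2r _ 2)// ?nnegrE//.
by rewrite expr1n real_normK ?num_real// (le_trans (cauchy_schwarz x y))// x1 y1 mulr1.
Qed.

Lemma inner_mulmxl x y (A : 'M[R]_m) : inner (x *m A) y = inner x (y *m A^T).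
Proof. by rewrite !innerE trmx_mul trmxK mulmxA. Qed.

Lemma inner_rotation x y (A : 'M[R]_m) : A *m A^T = 1%:M ->
  inner (x *m A) (y *m A) = inner x y.
Proof. by move=> AA; rewrite inner_mulmxl -mulmxA AA mulmx1. Qed.

End inner_product.

Section reflections.
Context {R : realType} {m : nat}.
Implicit Types (x y z v : 'rV[R]_m).

Definition reflmx v : 'M[R]_m := 1%:M - ((2 / inner v v) *: v^T) *m v.

Lemma mulmx_refl x v :
  x *m reflmx v = x - (2 * inner x v / inner v v) *: v.
Proof.
rewrite mulmxBr mulmx1 mulmxA; congr (_ - _).
rewrite -scalemxAr -scalemxAl [x *m v^T]mx11_scalar -innerE mul_scalar_mx.
by rewrite scalerA; congr (_ *: _); ring.
Qed.

Lemma refl_sym v : (reflmx v)^T = reflmx v.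
Proof.
by rewrite /reflmx linearB /= trmx1 trmx_mul linearZ /= trmxK -scalemxAl -scalemxAr.
Qed.

Lemma reflK v : v != 0 -> involutive (mulmxr (reflmx v) : 'rV_m -> 'rV_m).
Proof.
rewrite -inner_eq0 => v0 x /=; rewrite !mulmx_refl innerBl innerZl.
rewrite -addrA -opprD -scalerDl.
have -> : 2 * inner x v / inner v v + 2 * (inner x v -
  2 * inner x v / inner v v * inner v v) / inner v v = 0 by field.
by rewrite scale0r subr0.
Qed.

Lemma inner_refl x y v : v != 0 ->
  inner (x *m reflmx v) (y *m reflmx v) = inner x y.
Proof.
rewrite -inner_eq0 => v0.
rewrite !mulmx_refl !(innerBl, innerBr, innerZl, innerZr) [inner v y]innerC.
by field.
Qed.

Lemma inner_reflC x y v : v != 0 -> inner (x *m reflmx v) y = inner x (y *m reflmx v).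
Proof. by move=> v0; rewrite inner_mulmxl refl_sym. Qed.

Lemma refl_orth v : v != 0 -> reflmx v *m (reflmx v)^T = 1%:M.
Proof.
move=> v0; rewrite refl_sym; apply/row_matrixP => i.
by rewrite !rowE mulmxA mulmx1; exact: (reflK v0).
Qed.

(** The matrix determinant lemma: the block matrix [M] factors into triangular blocks in two ways,
    one for each Schur complement. *)
Lemma det_1B_mul (u : 'cV[R]_m) (v : 'rV[R]_m) :
  \det (1%:M - u *m v) = 1 - (v *m u) 0 0.
Proof.
pose M := block_mx (1%:M : 'M[R]_m) u v (1%:M : 'M[R]_1).
have M1 : \det M = \det (1%:M - u *m v).
  have -> : M = block_mx (1%:M - u *m v) u 0 1%:M *m block_mx 1%:M 0 v 1%:M.
    rewrite mulmx_block !mulmx0 !mul0mx !mulmx1 !mul1mx.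
    by rewrite addrNK !add0r.
  by rewrite det_mulmx det_lblock det_ublock !det1 !mulr1.
have M2 : \det M = 1 - (v *m u) 0 0.
  have -> : M = block_mx 1%:M 0 v 1%:M *m block_mx 1%:M u 0 (1%:M - v *m u).
    rewrite mulmx_block !mulmx0 !mul0mx !mulmx1 !mul1mx !addr0.
    by rewrite addrC subrK.
  by rewrite det_mulmx det_lblock det_ublock !det1 !mul1r det_mx11 !mxE.
by rewrite -M1.
Qed.

Lemma det_refl v : v != 0 -> \det (reflmx v) = -1.
Proof.
rewrite -inner_eq0 => v0.
by rewrite /reflmx det_1B_mul -scalemxAr mxE -innerE; field.
Qed.

Lemma rotation_refl2 u v : u != 0 -> v != 0 -> rotation (reflmx u *m reflmx v).
Proof.
move=> u0 v0; split; last by rewrite det_mulmx !det_refl// mulrNN mulr1.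
by rewrite trmx_mul mulmxA -(mulmxA (reflmx u)) refl_orth// mulmx1 refl_orth.
Qed.

Lemma refl_swap x y : inner x x = inner y y -> x != y ->
  x *m reflmx (x - y) = y.
Proof.
move=> xy; rewrite -subr_eq0 => /negbTE xy0.
have N0 : inner (x - y) (x - y) != 0 by rewrite inner_eq0 xy0.
rewrite mulmx_refl.
have -> : 2 * inner x (x - y) / inner (x - y) (x - y) = 1.
  rewrite -[RHS](divff N0); congr (_ / _).
  by rewrite !(innerBl, innerBr) (innerC y x) -xy; ring.
by rewrite scale1r subKr.
Qed.

Lemma refl_neg x : x != 0 -> x *m reflmx x = - x.
Proof.
move=> x0; rewrite mulmx_refl mulfK ?inner_eq0// scaler_nat mulr2n.
by rewrite opprD addrA subrr add0r.
Qed.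

End reflections.

Section spherical_distance.
Context {R : realType} {m : nat}.
Implicit Types (x y z v : 'rV[R]_m).

Definition sdist x y : R := acos (inner x y).

Lemma sdistC x y : sdist x y = sdist y x.
Proof. by rewrite /sdist innerC. Qed.

Lemma inner_itv x y : inner x x = 1 -> inner y y = 1 ->
  inner x y \in `[(-1), 1].
Proof. by move=> x1 y1; rewrite in_itv /= inner_le1. Qed.

Lemma sdist_ge0 x y : inner x x = 1 -> inner y y = 1 -> 0 <= sdist x y.
Proof. by move=> x1 y1; rewrite acos_ge0// inner_le1. Qed.

Lemma sdist_lepi x y : inner x x = 1 -> inner y y = 1 -> sdist x y <= pi.
Proof. by move=> x1 y1; rewrite acos_lepi// inner_le1. Qed.

Lemma sdistxx x : inner x x = 1 -> sdist x x = 0.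
Proof. by move=> x1; rewrite /sdist x1 acos1. Qed.

Lemma sdist_refl x y v : v != 0 ->
  sdist (x *m reflmx v) (y *m reflmx v) = sdist x y.
Proof. by move=> v0; rewrite /sdist inner_refl. Qed.

Lemma acos_le_cos (t a : R) : -1 <= t <= 1 -> 0 <= a <= pi ->
  cos a <= t -> acos t <= a.
Proof.
move=> tI aI cat; rewrite -(@cosK _ a) ?in_itv//.
by apply: le_acos => //; rewrite in_itv /= ?tI// cos_geN1 cos_le1.
Qed.

(** Cauchy-Schwarz for the components of [x] and [z] orthogonal to [y] bounds [inner x z] from below
    by the cosine of the sum of the distances. A sum of at least [pi] is trivial, and must be set
    apart because [cos] stops decreasing there. *)
Lemma sdist_triangle x y z : inner x x = 1 -> inner y y = 1 -> inner z z = 1 ->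
  sdist x z <= sdist x y + sdist y z.
Proof.
move=> x1 y1 z1.
have [pile|lepi] := leP pi (sdist x y + sdist y z).
  by rewrite (le_trans (sdist_lepi x1 z1)).
apply: acos_le_cos; first exact: inner_le1.
  by rewrite addr_ge0 ?sdist_ge0//= ltW.
rewrite cosD !acosK ?inner_itv// !sin_acos ?inner_le1//.
have h := cauchy_schwarz (x - inner x y *: y) (z - inner y z *: y).
rewrite !(innerBl, innerBr, innerZl, innerZr) x1 y1 z1 in h.
rewrite [inner z y]innerC [inner y x]innerC in h.
rewrite lerBlDr -lerBlDl -sqrtrM; last first.
  by rewrite subr_ge0 -[leRHS](mulr1 1) -{1}x1 -{1}y1 cauchy_schwarz.
rewrite (le_trans (ler_norm _))// -sqrtr_sqr ler_wsqrtr//.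
by move: h; congr (_ <= _); ring.
Qed.

(* [v] is the normal of the mirror; for two points on the same side of it, the
   reflection of one of them moves it away from the other. *)
Lemma sdist_same_side x y v : inner x x = 1 -> inner y y = 1 -> v != 0 ->
  0 <= inner x v * inner y v -> sdist x y <= sdist x (y *m reflmx v).
Proof.
move=> x1 y1 v0 xyv.
apply: le_acos; rewrite ?inner_itv// ?inner_refl//.
rewrite mulmx_refl innerBr innerZr gerBl.
rewrite mulrAC mulr_ge0 ?invr_ge0 ?inner_ge0// -mulrA mulr_ge0//.
by rewrite mulrC.
Qed.

End spherical_distance.

(** * Means of bounded measurable functions; Borel maps on row vectors *)

Section bounded_measurable_functions.
Context d (T : measurableType d) (R : realType).
Variables (D : set T).
Implicit Types (f g : T -> R) (c : R).

Definition bdmeas f :=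
  measurable_fun D f /\ exists M, forall x, D x -> `|f x| <= M.

Lemma bdmeas_cst c : bdmeas (fun=> c).
Proof. by split; [exact: measurable_cst|exists `|c|]. Qed.

Lemma bdmeasD f g : bdmeas f -> bdmeas g -> bdmeas (fun x => f x + g x).
Proof.
move=> [mf [M fM]] [mg [N gN]]; split; first exact: measurable_funD.
by exists (M + N) => x Dx; rewrite (le_trans (ler_normD _ _))// lerD ?fM ?gN.
Qed.

Lemma bdmeasM f g : bdmeas f -> bdmeas g -> bdmeas (fun x => f x * g x).
Proof.
move=> [mf [M fM]] [mg [N gN]]; split; first exact: measurable_funM.
by exists (M * N) => x Dx; rewrite normrM ler_pM ?fM ?gN.
Qed.

Lemma bdmeasZ c f : bdmeas f -> bdmeas (fun x => c * f x).
Proof. by move=> bf; apply: bdmeasM => //; exact: bdmeas_cst. Qed.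

Lemma bdmeasN f : bdmeas f -> bdmeas (fun x => - f x).
Proof.
move=> /(bdmeasZ (-1)); congr bdmeas.
by apply/funext => x; rewrite mulN1r.
Qed.

Lemma bdmeasB f g : bdmeas f -> bdmeas g -> bdmeas (fun x => f x - g x).
Proof. by move=> bf bg; apply: bdmeasD => //; exact: bdmeasN. Qed.

Lemma bdmeasX n f : bdmeas f -> bdmeas (fun x => f x ^+ n).
Proof.
move=> bf; elim: n => [|n IH].
  by under eq_fun do rewrite expr0; exact: bdmeas_cst.
by under eq_fun do rewrite exprS; exact: bdmeasM.
Qed.

Lemma bdmeas_sum (I : Type) (s : seq I) (F : I -> T -> R) :
  (forall i, bdmeas (F i)) -> bdmeas (fun x => \sum_(i <- s) F i x).
Proof.
move=> bF; elim: s => [|i s IH].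
  by under eq_fun do rewrite big_nil; exact: bdmeas_cst.
by under eq_fun do rewrite big_cons; exact: bdmeasD.
Qed.

Lemma bdmeas_horner (p : {poly R}) f : bdmeas f -> bdmeas (fun x => p.[f x]).
Proof.
move=> bf; under eq_fun do rewrite horner_coef.
by apply: bdmeas_sum => i; apply: bdmeasZ; exact: bdmeasX.
Qed.

Lemma bdmeas_indic (A : set T) : measurable D -> measurable A -> bdmeas (\1_A : T -> R).
Proof.
move=> mD mA; split; first exact: measurable_indic.
by exists 1 => x _; rewrite ger0_norm.
Qed.

End bounded_measurable_functions.

Section mean.
Context d (T : measurableType d) (R : realType).
Variables (mu : probability T R) (D : set T).
Hypothesis mD : measurable D.
Implicit Types (f g : T -> R) (c : R).

Definition mean f : R := \int[mu]_(x in D) f x.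

Lemma bdmeas_integrable f : bdmeas D f -> mu.-integrable D (EFin \o f).
Proof.
move=> [mf [M fM]]; apply: measurable_bounded_integrable => //.
  by rewrite (le_lt_trans (probability_le1 _ _))// ltry.
exists M; split; first exact: num_real.
by move=> N MN x Dx; exact: le_trans (fM x Dx) (ltW MN).
Qed.

Lemma EFin_mean f : bdmeas D f -> (mean f)%:E = (\int[mu]_(x in D) (f x)%:E)%E.
Proof. by move=> bf; rewrite fineK// integrable_fin_num// bdmeas_integrable. Qed.

Lemma meanD f g : bdmeas D f -> bdmeas D g ->
  mean (fun x => f x + g x) = mean f + mean g.
Proof. by move=> bf bg; rewrite /mean RintegralD// bdmeas_integrable. Qed.

Lemma meanB f g : bdmeas D f -> bdmeas D g ->
  mean (fun x => f x - g x) = mean f - mean g.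
Proof. by move=> bf bg; rewrite /mean RintegralB// bdmeas_integrable. Qed.

Lemma meanZ c f : bdmeas D f -> mean (fun x => c * f x) = c * mean f.
Proof. by move=> bf; rewrite /mean RintegralZl// bdmeas_integrable. Qed.

Lemma mean_sum (I : Type) (s : seq I) (F : I -> T -> R) :
  (forall i, bdmeas D (F i)) ->
  mean (fun x => \sum_(i <- s) F i x) = \sum_(i <- s) mean (F i).
Proof.
move=> bF; elim: s => [|i s IH].
  under [X in mean X]eq_fun do rewrite big_nil.
  by rewrite big_nil /mean Rintegral_cst// mul0r.
under [X in mean X]eq_fun do rewrite big_cons.
by rewrite big_cons meanD ?IH//; exact: bdmeas_sum.
Qed.

Lemma eq_mean f g : (forall x, D x -> f x = g x) -> mean f = mean g.
Proof. by move=> fg; apply: eq_Rintegral => x; rewrite inE; exact: fg. Qed.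

Lemma le_mean f g : bdmeas D f -> bdmeas D g ->
  (forall x, D x -> f x <= g x) -> mean f <= mean g.
Proof. by move=> bf bg fg; apply: le_Rintegral => //; exact: bdmeas_integrable. Qed.

Lemma mean_indic (A : set T) : measurable A -> A `<=` D ->
  mean \1_A = fine (mu A).
Proof.
move=> mA AD; congr fine.
by rewrite integral_indic//; congr (mu _); exact: setIidl.
Qed.

Hypothesis muD : mu D = 1%E.

Lemma mean_cst c : mean (fun=> c) = c.
Proof.
rewrite /mean Rintegral_cst// -[RHS]mulr1; congr (_ * _).
by rewrite -[RHS]/(fine 1%E); congr fine; exact: muD.
Qed.

Lemma mean_dist_le f g c : bdmeas D f -> bdmeas D g ->
  (forall x, D x -> `|f x - g x| <= c) -> `|mean f - mean g| <= c.
Proof.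
move=> bf bg fg; rewrite -meanB// ler_norml; apply/andP; split.
  rewrite -[leLHS]mean_cst; apply: le_mean;
    [exact: bdmeas_cst|exact: bdmeasB|].
  by move=> x /fg; rewrite ler_norml => /andP[].
rewrite -[leRHS]mean_cst; apply: le_mean; [exact: bdmeasB|exact: bdmeas_cst|].
by move=> x /fg; rewrite ler_norml => /andP[].
Qed.

End mean.

Section borel_rV.
Context {R : realType}.

Lemma measurable_fun_borelRV (m : nat) (f : 'rV[R]_m -> R) :
  continuous f -> measurable_fun setT (f : borelRV R m -> R).
Proof.
move=> cf; apply: (measurability _ (RGenOpens.measurableE R)).
move=> _ [_ [a [b ->] <-]]; rewrite setTI.
apply: sub_sigma_algebra => /=.
by move/continuousP : cf; apply; exact: interval_open.
Qed.

Lemma measurable_coord (m : nat) (i : 'I_m) :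
  measurable_fun setT (fun x : borelRV R m => (x : 'rV[R]_m) 0 i).
Proof. by apply: measurable_fun_borelRV; exact: coord_continuous. Qed.

Lemma continuous_borelRV (m : nat) (h : 'rV[R]_m -> 'rV[R]_m) :
  continuous h -> measurable_fun setT (h : borelRV R m -> borelRV R m).
Proof.
move=> ch; apply: (@measurability _ _ (borelRV R m) (borelRV R m) _ _ (@open 'rV[R]_m)) => //.
move=> _ [B oB <-]; rewrite setTI.
by apply: sub_sigma_algebra => /=; move/continuousP : ch; apply.
Qed.

Lemma continuous_mulmxr (m : nat) (A : 'M[R]_m) :
  continuous (mulmxr A : 'rV[R]_m -> 'rV[R]_m).
Proof.
have -> : (mulmxr A : 'rV[R]_m -> 'rV[R]_m) =
    fun x => \sum_i x 0 i *: row i A.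
  by apply/funext => x /=; rewrite mulmx_sum_row.
apply: continuous_big => [|i _ x]; first exact: add_continuous.
by apply: cvgZr_tmp; [exact: nbhs_filter|exact: (@coord_continuous R 1 m 0 i x)].
Qed.

Lemma inner_continuous (m : nat) (y : 'rV[R]_m) : continuous (fun x => inner x y).
Proof.
apply: continuous_big => [|i _ x]; first exact: add_continuous.
by apply: cvgMr_tmp; [exact: nbhs_filter|exact: (@coord_continuous R 1 m 0 i x)].
Qed.

Lemma measurable_inner d (T : measurableType d) (m : nat) (f g : T -> borelRV R m) :
  measurable_fun setT f -> measurable_fun setT g ->
  measurable_fun setT (fun t => inner (f t : 'rV[R]_m) (g t : 'rV[R]_m)).
Proof.
move=> mf mg; apply: measurable_sum => i; apply: measurable_funM.
  exact: (measurableT_comp (measurable_coord i) mf).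
exact: (measurableT_comp (measurable_coord i) mg).
Qed.

Lemma measurable_sphere n : measurable (sphere R n).
Proof.
have := measurable_inner (@measurable_id _ (borelRV R n.+1) setT)
  (@measurable_id _ (borelRV R n.+1) setT).
move=> /(_ measurableT [set 1] (measurable_set1 1)).
by rewrite setTI.
Qed.

End borel_rV.

(** * Caps and Lipschitz functions on the sphere *)

Section spherical_lipschitz.
Context {R : realType} {n : nat}.
Local Notation rV := 'rV[R]_n.+1.
Local Notation S := (sphere R n).
Implicit Types (x y z v : rV) (u : rV -> R) (L : R).

Definition cap x (t : R) : set (borelRV R n.+1) := [set y | S y /\ t < inner x y].

Lemma measurable_cap x t : measurable (cap x t).
Proof.
apply: measurableI; first exact: measurable_sphere.
rewrite -[X in measurable X]setTI.
have := measurable_inner (@measurable_cst _ _ (borelRV R n.+1) (borelRV R n.+1) setT x)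
  (@measurable_id _ (borelRV R n.+1) setT).
move=> /(_ measurableT `]t, +oo[%classic (measurable_itv _)).
by congr (measurable (_ `&` _)); apply/seteqP; split => y /=; rewrite in_itv/= andbT.
Qed.

Lemma near_sdist (e : R) : 0 < e -> exists2 t : R, t < 1 &
  forall x y, S x -> S y -> t <= inner x y -> sdist x y <= e.
Proof.
(* Truncation at [pi] keeps the angle in the range where [cos] decreases. *)
move=> e0; exists (cos (Num.min e pi)).
  rewrite -[ltRHS]cos0 ltr_cos ?in_itv/= ?lexx ?pi_ge0//.
    by rewrite lt_min e0 pi_gt0.
  by rewrite le_min ge_min lexx orbT pi_ge0 ltW.
move=> x y Sx Sy tx; rewrite (@le_trans _ _ (Num.min e pi))// ?ge_min ?lexx//.
apply: acos_le_cos => //; first exact: inner_le1.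
by rewrite le_min ge_min lexx orbT pi_ge0 ltW.
Qed.

(* [u] is [L]-Lipschitz for the geodesic distance *)
Definition slip L u := forall x y, S x -> S y -> u x - u y <= L * sdist x y.

Lemma slip_norm L u x y : slip L u -> S x -> S y -> `|u x - u y| <= L * sdist x y.
Proof.
move=> lu Sx Sy; rewrite ler_norml lerNl opprB lu// sdistC lu//.
Qed.

Lemma slip_near L u (e : R) : slip L u -> 0 < e -> exists2 t : R, t < 1 &
  forall x y, S x -> S y -> t <= inner x y -> `|u x - u y| <= e.
Proof.
move=> lu e0.
(* The sign of [L] is not assumed; this is a positive Lipschitz constant in all cases. *)
have L0 : 0 < `|L| + 1 by rewrite ltr_wpDl.
have [|t t1 ht] := @near_sdist (e / (`|L| + 1)); first by rewrite divr_gt0.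
exists t => // x y Sx Sy txy; rewrite (le_trans (slip_norm lu Sx Sy))//.
have := ht _ _ Sx Sy txy; rewrite ler_pdivlMr// mulrC; apply: le_trans.
by rewrite ler_wpM2r ?sdist_ge0// (le_trans (ler_norm L))// lerDl.
Qed.

Lemma slip_measurable L u : slip L u -> measurable_fun S (u : borelRV R n.+1 -> R).
Proof.
move=> lu mS; apply: (measurability _ (RGenOInfty.measurableE R)) => //.
move=> _ [_ [a ->] <-].
pose O : set rV := \bigcup_(p in [set p : rV * R | S p.1 /\
  forall z, S z -> p.2 <= inner p.1 z -> a < u z]) [set y | p.2 < inner p.1 y].
suff -> : S `&` u @^-1` `]a, +oo[%classic = S `&` (O : set (borelRV R n.+1)).
  apply: measurableI => //; apply: sub_sigma_algebra => /=.
  apply: bigcup_open => -[p t] _ /=.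
  rewrite (_ : mkset _ = (fun y => inner y p) @^-1` `]t, +oo[%classic); last first.
    by apply/seteqP; split => y /=; rewrite in_itv/= andbT innerC.
  by have /continuousP := @inner_continuous R _ p; apply; exact: interval_open.
apply/seteqP; split => x /= [Sx]; rewrite in_itv/= andbT; last first.
  by move=> [[p t]/= [Sp H] tpx]; split => //; apply: H => //; exact: ltW.
move=> aux; split => //.
have [|t t1 ht] := slip_near lu (_ : 0 < (u x - a) / 2).
  by rewrite divr_gt0// subr_gt0.
exists (x, t) => /=; last by rewrite Sx.
split => // z Sz tz; have := ht _ _ Sx Sz tz.
move=> /(le_trans (ler_norm _)) h; move: h aux; lra.
Qed.

Lemma slip_bound L u : slip L u -> exists M, forall x, S x -> `|u x| <= M.
Proof.
move=> lu; have [[x0 Sx0]|S0] := pselect (exists x, S x); last first.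
  by exists 0 => x Sx; case: S0; exists x.
exists (`|u x0| + `|L| * pi) => x Sx.
rewrite -[X in `|X|](subrKC (u x0)) (le_trans (ler_normD _ _))// lerD2l.
rewrite (le_trans (slip_norm lu Sx Sx0))//.
rewrite (@le_trans _ _ (`|L| * sdist x x0))//.
  by rewrite ler_wpM2r ?sdist_ge0// ler_norm.
by rewrite ler_wpM2l// sdist_lepi.
Qed.

Lemma slip_bdmeas L u : slip L u -> bdmeas S (u : borelRV R n.+1 -> R).
Proof. by move=> lu; split; [exact: slip_measurable lu|exact: slip_bound lu]. Qed.

End spherical_lipschitz.

(** * Transitivity of the rotation group *)

Section transitivity.
Context {R : realType} {n : nat}.
Local Notation S := (sphere R n).
Implicit Types (x y : 'rV[R]_n.+1).

Lemma sphere_neq0 x : S x -> x != 0.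
Proof. by rewrite /sphere/= => Sx; rewrite -inner_eq0 Sx oner_eq0. Qed.

Lemma sphere_refl x v : v != 0 -> S x -> S (x *m reflmx v).
Proof. by move=> v0; rewrite /sphere/= inner_refl. Qed.

Lemma sphere_rotation x (A : 'M[R]_n.+1) : rotation A -> S x -> S (x *m A).
Proof. by move=> [AA _]; rewrite /sphere/= inner_rotation. Qed.

Lemma rotationM (A B : 'M[R]_n.+1) : rotation A -> rotation B -> rotation (A *m B).
Proof.
move=> [AA dA] [BB dB]; split; last by rewrite det_mulmx dA dB mulr1.
by rewrite trmx_mul mulmxA -(mulmxA A) BB mulmx1.
Qed.

Lemma delta_inner (i j : 'I_n.+1) :
  inner (delta_mx 0 i : 'rV[R]_n.+1) (delta_mx 0 j) = (i == j)%:R.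
Proof.
rewrite /inner (bigD1 i)//= !mxE !eqxx/= mul1r big1 ?addr0// => k ki.
by rewrite !mxE (negbTE ki) andbF mul0r.
Qed.

(** One reflection takes [x] to [- y], a second one takes [- y] to [y], and a product of two
    reflections is a rotation. The first has no mirror when [x = - y]. *)
Lemma transitive_neq x y : S x -> S y -> x != - y ->
  exists2 A, rotation A & x *m A = y.
Proof.
move=> Sx Sy xy; exists (reflmx (x - - y) *m reflmx y).
  by apply: rotation_refl2; [rewrite subr_eq0|exact: sphere_neq0].
have xNy : inner x x = inner (- y) (- y) by rewrite innerNl innerNr opprK Sx Sy.
by rewrite mulmxA (refl_swap xNy xy) mulNmx refl_neg ?opprK// sphere_neq0.
Qed.

(** Antipodal points are joined through a third point [z] different from [x] and [- x]. It exists
    because [0 < n] provides two orthogonal coordinate vectors, which cannot both be [x] or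
    [- x]. *)
Lemma sphere_transitive x y : (0 < n)%N -> S x -> S y ->
  exists2 A, rotation A & x *m A = y.
Proof.
move=> n0 Sx Sy.
have [xy|/transitive_neq] := eqVneq x (- y); last exact.
have S_delta i : S (delta_mx 0 i) by rewrite /sphere/= delta_inner eqxx.
have [z Sz /andP[zx zNx]] : exists2 z, S z & (z != - x) && (z != x).
  pose e := delta_mx 0 (ord0 : 'I_n.+1) : 'rV[R]_n.+1.
  pose e' := delta_mx 0 (inord 1 : 'I_n.+1) : 'rV[R]_n.+1.
  have ee' : inner e e' = 0.
    rewrite delta_inner; case: eqP => // /(congr1 val) /=.
    by rewrite inordK.
  have Se : S e by exact: S_delta.
  have Se' : S e' by exact: S_delta.
  clearbody e e'.
  have [|] := boolP ((e != - x) && (e != x)); first by exists e.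
  rewrite negb_and !negbK => ex; exists e' => //.
  apply/andP; split; apply/eqP => e'x; move: ee'; rewrite e'x;
    case/orP: ex => /eqP ->; rewrite ?innerNl ?innerNr ?opprK Sx;
    by move=> /eqP; rewrite ?oppr_eq0 oner_eq0.
have xNz : x != - z by apply: contra_neq zx => ->; rewrite opprK.
have zNy : z != - y by rewrite -xy.
have [A rA xA] := transitive_neq Sx Sz xNz.
have [B rB zB] := transitive_neq Sz Sy zNy.
by exists (A *m B); [exact: rotationM|rewrite mulmxA xA].
Qed.

End transitivity.

(** * Haar measure: caps have positive mass, reflections preserve means *)

Section haar_sphere.
Context {R : realType} {n : nat}.
Variables (n_gt0 : (0 < n)%N) (sigma : probability (borelRV R n.+1) R).
Hypothesis haar : is_haar_sphere sigma.
Local Notation S := (sphere R n).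
Local Notation E := (mean sigma S).
Implicit Types (x y z v : 'rV[R]_n.+1).

Lemma haar_rotation (A : 'M[R]_n.+1) (f : borelRV R n.+1 -> R) : rotation A ->
  bdmeas S f -> bdmeas S (f \o mulmxr A) /\ E (f \o mulmxr A) = E f.
Proof.
move=> rA bf; have mS := @measurable_sphere R n.
pose r : borelRV R n.+1 -> borelRV R n.+1 := mulmxr A.
have mA : measurable_fun setT r.
  by apply: continuous_borelRV; exact: continuous_mulmxr.
have SA : r @^-1` S = S.
  by apply/seteqP; split => x; rewrite /r/sphere/= inner_rotation//; case: rA.
have bfA : bdmeas S (f \o r).
  case: bf => mf [M fM]; split; last first.
    by exists M => x Sx; apply: fM; exact: sphere_rotation.
  apply: (@measurable_comp _ _ _ _ _ _ S) => //.
    by move=> _ [x Sx <-]; exact: sphere_rotation.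
  exact: measurable_funTS.
(* Extension by zero gives a function measurable on the whole space, to which the image-measure
   formula applies. *)
split=> //; pose g := f \_ S.
have mg : measurable_fun setT g.
  by apply/(measurable_restrictT _ _).1 => //; case: bf.
have gE x : (f (r x) = g (r x)) \/ ~ S x.
  have [Sx|] := pselect (S x); [left|by right].
  by rewrite /g patchE mem_set//; exact: sphere_rotation.
have -> : E (f \o r) = E (g \o r).
  by apply: eq_mean => x Sx; case: (gE x).
have -> : E f = E g by apply: eq_mean => x Sx; rewrite /g patchE mem_set.
have bg : bdmeas S g.
  case: bf => mf [M fM]; split; first exact: measurable_funTS.
  by exists M => x Sx; rewrite /g patchE mem_set//; exact: fM.
rewrite /mean /Rintegral; congr fine.
transitivity (\int[pushforward sigma r]_(x in S) (g x)%:E)%E; last first.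
  apply: eq_measure_integral => B mB _; exact: (haar_invariant haar rA mB).
rewrite integral_pushforward//=.
- by rewrite SA.
- exact/measurable_EFinP.
- rewrite SA; apply: (@bdmeas_integrable _ _ _ sigma S mS (g \o r)).
  split; first by apply: measurable_funTS; exact: measurableT_comp.
  case: bg => _ [M gM]; exists M => x Sx; apply: gM; exact: sphere_rotation.
Qed.

Lemma haar_cap x y t : S x -> S y -> sigma (cap x t) = sigma (cap y t).
Proof.
move=> Sx Sy; have [A rA xA] := sphere_transitive n_gt0 Sx Sy.
have := haar_invariant haar rA (measurable_cap y t).
rewrite (_ : [set z | _] = cap x t)//.
apply/seteqP; split => z [Sz tz].
  split; last by rewrite -xA inner_rotation in tz; case: rA.
  by move: Sz; rewrite /sphere/= inner_rotation//; case: rA.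
split; first exact: sphere_rotation.
by rewrite -xA inner_rotation//; case: rA.
Qed.

Lemma sphere_compact : compact (S : set 'rV[R]_n.+1).
Proof.
apply: bounded_closed_compact.
  exists 1; split; first exact: num_real.
  move=> M M1 x Sx; rewrite /= [leLHS]mx_normrE; apply/bigmax_leP.
  split=> [|[i j] _ /=]; first by rewrite ltW// (lt_trans _ M1).
  rewrite (le_trans _ (ltW M1))// -(@ler_pXn2r _ 2)// ?nnegrE// expr1n.
  rewrite real_normK ?num_real// -[leRHS]Sx /inner (bigD1 j)//= ord1 expr2.
  by rewrite lerDl; apply: sumr_ge0 => k _; rewrite -expr2 sqr_ge0.
have cS : continuous (fun x : 'rV[R]_n.+1 => inner x x).
  apply: continuous_big => [|i _ x]; first exact: add_continuous.
  by apply: cvgM; (exact: nbhs_filter || exact: (@coord_continuous R 1 n.+1 0 i x)).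
apply: (@preimage_closed _ _ (fun x : 'rV[R]_n.+1 => inner x x) [set 1]).
  by move=> x _; exact: cS.
exact: closed_eq.
Qed.

(** Finitely many caps of the same height cover the compact sphere, and they all have the same
    measure; were it zero, the sphere would be negligible. *)
Lemma haar_cap_gt0 x t : S x -> t < 1 -> (0 < sigma (cap x t))%E.
Proof.
move=> Sx t1; rewrite lt0e measure_ge0 andbT; apply/eqP => cap0.
have := sphere_compact; rewrite compact_cover.
move=> /(_ 'rV[R]_n.+1 S (fun x => [set y | t < inner x y]))[].
- move=> y Sy; rewrite (_ : mkset _ = (fun z => inner z y) @^-1` `]t, +oo[%classic); last first.
    by apply/seteqP; split => z /=; rewrite in_itv/= andbT innerC.
  by have /continuousP := @inner_continuous R _ y; apply; exact: interval_open.
- by move=> y Sy; exists y => //=; rewrite Sy.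
move=> D DS SD.
have : sigma S = 0%E; last by rewrite (haar_carried haar) => /eqP; rewrite onee_eq0.
apply/eqP; rewrite -measure_le0.
have : (sigma.-negligible (\bigcup_(i in [set` D]) cap i t)).
  rewrite bigcup_fset big_seq; elim/big_ind : _.
  - exact: negligible_set0.
  - exact: negligibleU.
  - move=> i iD; exists (cap i t); split => //; first exact: measurable_cap.
    by rewrite (haar_cap _ _ Sx)//; apply/set_mem/DS.
move=> [B [mB B0 DB]]; rewrite -B0; apply: le_measure; rewrite ?inE//.
  exact: measurable_sphere.
by apply: subset_trans DB => y Sy; have [z Dz zy] := SD _ Sy; exists z.
Qed.

Lemma slip_refl L f v : v != 0 -> slip L f -> slip L (fun x => f (x *m reflmx v)).
Proof.
move=> v0 lf x y Sx Sy; rewrite (le_trans (lf _ _ _ _)) ?sdist_refl//;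
exact: sphere_refl.
Qed.

(* The kernel 1[t < <x, s y>] is close to the diagonal of the reflected pairs
   and, by transitivity, has the same mass in each variable; integrating it by
   Fubini in both orders compares [f] with [f] composed with the reflection. *)
Lemma le_mean_refl L f v (e : R) : slip L f -> (forall x, S x -> 0 <= f x) ->
  v != 0 -> 0 < e -> E f <= E (fun x => f (x *m reflmx v)) + e.
Proof.
move=> lf f0 v0 e0; have mS := @measurable_sphere R n.
have lfv := slip_refl v0 lf.
have [t t1 ht] := slip_near lf e0.
pose s : borelRV R n.+1 -> borelRV R n.+1 := mulmxr (reflmx v).
have [x0 Sx0] : exists x0, S x0.
  by exists (delta_mx 0 0); rewrite /sphere/= delta_inner eqxx.
pose c := sigma (cap x0 t).
have c0 : (0 < c)%E by exact: haar_cap_gt0.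
have cfin : c \is a fin_num.
  rewrite ge0_fin_numE ?measure_ge0//.
  by rewrite (le_lt_trans (probability_le1 _ _)) ?ltry//; exact: measurable_cap.
pose M : set (borelRV R n.+1 * borelRV R n.+1) :=
  [set z | [/\ S z.1, S z.2 & t < inner z.1 (s z.2)]].
have minner : measurable_fun setT (fun z : borelRV R n.+1 * borelRV R n.+1 =>
    inner (z.1 : 'rV[R]_n.+1) (s z.2)).
  apply: measurable_inner; first exact: measurable_fst.
  apply: (measurableT_comp _ measurable_snd).
  by apply: continuous_borelRV; exact: continuous_mulmxr.
have mM : measurable M.
  rewrite (_ : M = (fst @^-1` S) `&` ((snd @^-1` S) `&`
    ((fun z : borelRV R n.+1 * borelRV R n.+1 =>
      inner (z.1 : 'rV[R]_n.+1) (s z.2)) @^-1` `]t, +oo[%classic))).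
    apply: measurableI.
      by rewrite -[X in measurable X]setTI; exact: measurable_fst.
    apply: measurableI.
      by rewrite -[X in measurable X]setTI; exact: measurable_snd.
    rewrite -[X in measurable X]setTI.
    exact: (minner measurableT _ (measurable_itv _)).
  apply/seteqP; split => z /=; rewrite in_itv/= andbT; first by case.
  by case=> ? [].
(* Extended by zero so that Tonelli applies on the whole product space. *)
pose g := f \_ S; pose g' := (f \o s) \_ S.
have mg : measurable_fun setT (g : borelRV R n.+1 -> R).
  by apply/(measurable_restrictT _ _).1 => //; exact: slip_measurable lf.
have mg' : measurable_fun setT (g' : borelRV R n.+1 -> R).
  by apply/(measurable_restrictT _ _).1 => //; exact: slip_measurable lfv.
have g0 x : 0 <= g x.
  by rewrite /g patchE; case: ifPn => // /set_mem; exact: f0.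
have g'0 x : 0 <= g' x.
  rewrite /g' patchE; case: ifPn => // /set_mem Sx; apply: f0.
  exact: sphere_refl.
have intk k (A : set (borelRV R n.+1)) : 0 <= k -> measurable A ->
    (\int[sigma]_y (k * \1_A y)%:E = k%:E * sigma A)%E.
  move=> k0 mA; under eq_integral do rewrite EFinM.
  rewrite ge0_integralZl_EFin//; last first.
    exact/measurable_EFinP/measurable_indic.
  by rewrite integral_indic// setIT.
have intM1 x : (\int[sigma]_y (g x * \1_M (x, y))%:E = (g x)%:E * c)%E.
  rewrite (_ : (fun y => _) = fun y => (g x * \1_[set y | M (x, y)] y)%:E)//.
  have [Sx|Sx] := pselect (S x); last first.
    have -> : g x = 0 by rewrite /g patchE memNset.
    by under eq_integral do rewrite mul0r; rewrite integral0 mul0e.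
  have -> : [set y | M (x, y)] = cap (s x) t.
    by apply/seteqP; split => y /=; rewrite /M/s/= /cap/= inner_reflC//; [case|case].
  rewrite intk//; last exact: measurable_cap.
  by congr (_ * _)%E; apply: haar_cap => //; exact: sphere_refl.
(* Only an inequality: for [y] off the sphere the section of [M] is empty, while [g' y + e] is still
   [e]. *)
have intM2 y : (\int[sigma]_x ((g' y + e) * \1_M (x, y))%:E <= (g' y + e)%:E * c)%E.
  rewrite (_ : (fun x => _) = fun x => ((g' y + e) * \1_[set x | M (x, y)] x)%:E)//.
  have ge0 : 0 <= g' y + e by rewrite addr_ge0// ltW.
  have [Sy|Sy] := pselect (S y); last first.
    rewrite (_ : mkset _ = set0); last by apply/seteqP; split => x //= -[].
    under eq_integral do rewrite indic0 mulr0.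
    by rewrite integral0 mule_ge0// ?lee_fin// ltW.
  have -> : [set x | M (x, y)] = cap (s y) t.
    by apply/seteqP; split => x /=; rewrite /M/s/= /cap/= innerC; [case|case].
  rewrite intk//; last exact: measurable_cap.
  by rewrite (haar_cap t (sphere_refl v0 Sy) Sx0).
have mF : measurable_fun setT
    (fun z : borelRV R n.+1 * borelRV R n.+1 => (g z.1 * \1_M z)%:E).
  apply/measurable_EFinP/measurable_funM; last exact: measurable_indic.
  exact: (measurableT_comp mg measurable_fst).
have mH : measurable_fun setT
    (fun z : borelRV R n.+1 * borelRV R n.+1 => ((g' z.2 + e) * \1_M z)%:E).
  apply/measurable_EFinP/measurable_funM; last exact: measurable_indic.
  apply: measurable_funD => //.
  exact: (measurableT_comp mg' measurable_snd).
have FH (z : borelRV R n.+1 * borelRV R n.+1) : g z.1 * \1_M z <= (g' z.2 + e) * \1_M z.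
  rewrite indicE; have [/set_mem[S1 S2 tz]|] := boolP (z \in M); last by rewrite !mulr0.
  rewrite !mulr1 /g /g' !patchE !mem_set//= -lerBlDl (le_trans (ler_norm _))//.
  by apply: ht; rewrite ?ltW//; exact: sphere_refl.
have F0 (z : borelRV R n.+1 * borelRV R n.+1) : (0 <= (g z.1 * \1_M z)%:E)%E.
  by rewrite lee_fin mulr_ge0.
have H0 (z : borelRV R n.+1 * borelRV R n.+1) :
    (0 <= ((g' z.2 + e) * \1_M z)%:E)%E.
  by rewrite lee_fin mulr_ge0// addr_ge0// ltW.
have key : (\int[sigma]_x ((g x)%:E * c) <= \int[sigma]_y ((g' y + e)%:E * c))%E.
  under eq_integral do rewrite -intM1.
  apply: (@le_trans _ _ (\int[sigma]_x \int[sigma]_y ((g' y + e) * \1_M (x, y))%:E)%E).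
    apply: ge0_le_integral => //.
    - by move=> x _; apply: integral_ge0 => y _; rewrite lee_fin mulr_ge0.
    - exact: (measurable_fun_fubini_tonelli_F _ mF F0).
    - exact: (measurable_fun_fubini_tonelli_F _ mH H0).
    - move=> x _; apply: ge0_le_integral => //.
      + by move=> y _; rewrite lee_fin mulr_ge0.
      + exact: (measurableT_comp mF (measurable_fun_pair (@measurable_cst _ _ _ _ _ x) (@measurable_id _ _ _))).
      + exact: (measurableT_comp mH (measurable_fun_pair (@measurable_cst _ _ _ _ _ x) (@measurable_id _ _ _))).
      + by move=> y _; rewrite lee_fin; exact: (FH (x, y)).
  rewrite (fubini_tonelli _ mH H0).
  apply: ge0_le_integral => //.
  - by move=> y _; apply: integral_ge0 => x _; rewrite lee_fin mulr_ge0// addr_ge0// ltW.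
  - exact: (measurable_fun_fubini_tonelli_G _ mH H0).
  - apply: emeasurable_funM => //; apply/measurable_EFinP.
    exact: measurable_funD.
  - by move=> y _; exact: intM2.
have mEg : measurable_fun setT (EFin \o g : borelRV R n.+1 -> \bar R).
  exact/measurable_EFinP.
have mEg' : measurable_fun setT (EFin \o g' : borelRV R n.+1 -> \bar R).
  exact/measurable_EFinP.
have I1 : (\int[sigma]_x ((g x)%:E * c) = (\int[sigma]_x (EFin \o g) x) * c)%E.
  by apply: ge0_integralZr => //; [move=> x _; rewrite lee_fin|exact: ltW].
have I2 : (\int[sigma]_x ((g' x + e)%:E * c) =
    (\int[sigma]_x (EFin \o g') x + e%:E) * c)%E.
  rewrite (@ge0_integralZr _ _ _ sigma _ measurableT (fun x => (g' x + e)%:E)).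
  - congr (_ * c)%E.
    transitivity (\int[sigma]_x (EFin \o g') x + \int[sigma]_x (cst e%:E x))%E.
      apply: (@ge0_integralD _ _ _ sigma _ measurableT (EFin \o g') (cst e%:E)) => //.
      + by move=> x _; rewrite lee_fin.
      + by move=> x _; rewrite lee_fin ltW.
    rewrite integral_cst//; congr (_ + _)%E; rewrite -[RHS]mule1.
    by congr (_ * _)%E; exact: probability_setT.
  - by apply/measurable_EFinP; exact: measurable_funD.
  - by move=> x _; rewrite lee_fin addr_ge0// ltW.
  - exact: ltW.
(* The common mass [c] of the sections cancels, being positive and finite. *)
move: key; rewrite I1 I2 lee_pmul2r//.
rewrite -(restrict_EFin f) -(restrict_EFin (f \o s)) -!integral_mkcond.
rewrite -lee_fin EFinD !EFin_mean//; [exact: slip_bdmeas lfv|exact: slip_bdmeas lf].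
Qed.

Lemma slip_addr L f c : slip L f -> slip L (fun x => f x + c).
Proof. by move=> lf x y Sx Sy; rewrite (le_trans _ (lf _ _ Sx Sy))//; lra. Qed.

(** [le_mean_refl] is applied to [f] and to its reflection, both shifted by a bound [M] to become
    nonnegative; then [e] tends to 0. *)
Lemma mean_refl L f v : slip L f -> v != 0 ->
  E (fun x => f (x *m reflmx v)) = E f.
Proof.
move=> lf v0.
have mS := @measurable_sphere R n.
have [M fM] := slip_bound lf.
have bf := slip_bdmeas lf.
have bfv := slip_bdmeas (slip_refl v0 lf).
have bM := @bdmeas_cst _ (borelRV R n.+1) R S M.
have lg := slip_addr M lf.
have g0 x : S x -> 0 <= f x + M.
  by move=> /fM; rewrite ler_norml => /andP[+ _]; rewrite lerNl -subr_ge0 opprK addrC.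
have g0v x : S x -> 0 <= f (x *m reflmx v) + M.
  by move=> Sx; apply: g0; exact: sphere_refl.
have EM h : bdmeas S h -> E (fun x => h x + M) = E h + E (fun=> M).
  by move=> bh; rewrite meanD.
have ss : E (fun x => f (x *m reflmx v *m reflmx v) + M) = E (fun x => f x + M).
  by apply: eq_mean => x _; have /= -> := reflK v0 x.
apply/eqP; rewrite eq_le; apply/andP; split; apply/ler_addgt0Pr => e e0.
  have := le_mean_refl (slip_refl v0 lg) g0v v0 e0.
  by rewrite ss !EM// addrAC lerD2r.
have := le_mean_refl lg g0 v0 e0.
by rewrite !EM// addrAC lerD2r.
Qed.

End haar_sphere.

(** * Primitives of powers of sine and their log-concavity *)

Section sine_integral.
Context {R : realType}.
Local Notation mu := (@lebesgue_measure R).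
Implicit Types (k : nat) (x y a b s d : R).

(* clamped to [0, pi] so as to be continuous on the whole line *)
Definition sinint k x : R := \int[mu]_(t in `[0%R, clamp 0 pi x]) (sin t ^+ k).

Lemma SigmaE n x : 0 <= x <= pi -> Sigma n x = sinint n.-1 x / sinint n.-1 pi.
Proof. by move=> x0pi; rewrite /sinint !clamp_id ?in_itv/= ?lexx ?pi_ge0. Qed.

Lemma sinint0 k : sinint k 0 = 0.
Proof.
by rewrite /sinint clamp_id ?in_itv/= ?lexx ?pi_ge0// set_itv1 Rintegral_set1.
Qed.

Lemma sinint_continuous k : continuous (sinint k).
Proof.
exact: (within_clamp (pi_ge0 R)
  (parameterized_integral_continuous (pi_ge0 R) (@integrable_sinX R k 0 pi))).
Qed.

Lemma is_derive_sinint k x : 0 < x < pi -> is_derive x 1 (sinint k) (sin x ^+ k).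
Proof.
move=> x0pi; have /andP[x0 xpi] := x0pi.
have [] := @continuous_FTC1_closed R (fun t => sin t ^+ k) 0 x pi xpi
  (@integrable_sinX R k 0 pi) x0 (@continuous_sinX R k x).
move=> d dE.
apply: (@near_eq_is_derive _ _ _ (fun y => \int[mu]_(t in `[0%R, y]) (sin t ^+ k))).
  have : x \in `]0, pi[ by rewrite in_itv.
  move=> /near_in_itvoo; apply: filterS => y y0pi; rewrite /sinint clamp_id//.
  exact: subset_itv_oo_cc.
by apply: DeriveDef => //; rewrite -derive1E.
Qed.

(** The derivative is asked for only inside the interval, since [is_derive_sinint] stops short of 0
    and [pi]. *)
Lemma is_derive_le (f df : R -> R) a b : a <= b -> continuous f ->
  (forall x, a < x < b -> is_derive x 1 f (df x)) ->
  (forall x, a < x < b -> 0 <= df x) -> f a <= f b.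
Proof.
move=> + cf dfE df0; rewrite le_eqVlt => /predU1P[->//|ab].
have dfE' x : x \in `]a, b[ -> is_derive x 1 f (df x) by rewrite in_itv; exact: dfE.
have [x xab fE] := MVT ab dfE' (continuous_subspaceT cf).
rewrite -subr_ge0 fE mulr_ge0 ?subr_ge0 ?(ltW ab)// df0//.
Qed.

Lemma le_sinint k x y : 0 <= x -> x <= y -> y <= pi -> sinint k x <= sinint k y.
Proof.
move=> x0 xy ypi.
apply: (@is_derive_le (sinint k) (fun t => sin t ^+ k)) => //.
- exact: sinint_continuous.
- move=> t /andP[xt ty]; apply: is_derive_sinint.
  by rewrite (le_lt_trans x0)// (lt_le_trans ty).
- move=> t /andP[xt ty]; rewrite exprn_ge0// sin_ge0_pi//.
  by rewrite (le_trans x0) ?ltW//= (lt_le_trans ty).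
Qed.

Lemma sinint_ge0 k x : 0 <= x -> x <= pi -> 0 <= sinint k x.
Proof. by move=> x0 xpi; rewrite -(sinint0 k) le_sinint. Qed.

Lemma sinint_gt0 k : 0 < sinint k pi.
Proof.
have p2 : pi / 2 <= pi :> R by rewrite ler_pdivrMr// ler_peMr ?pi_ge0// ler1n.
have p20 : 0 < pi / 2 :> R by rewrite divr_gt0// pi_gt0.
have D x : x \in `]0, pi / 2[ -> is_derive x 1 (sinint k) (sin x ^+ k).
  rewrite in_itv/= => /andP[x0 xp]; apply: is_derive_sinint.
  by rewrite x0 (lt_le_trans xp).
have [x] := MVT p20 D (continuous_subspaceT (@sinint_continuous k)).
rewrite in_itv/= sinint0 !subr0 => /andP[x0 xp] E.
rewrite (lt_le_trans _ (le_sinint k (ltW p20) p2 (lexx _)))// E mulr_gt0//.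
by rewrite exprn_gt0// sin_gt0_pi// x0 (lt_le_trans xp).
Qed.

(** This is log-concavity of sine: for s <= y and angles in [0, pi] the right side is nonnegative,
    so sin (s + d) / sin s decreases with s. *)
Lemma sin_mul_shift y s d :
  sin y * sin (s + d) - sin (y + d) * sin s = sin d * sin (y - s).
Proof. by rewrite sinB !sinD; ring. Qed.

(** The logarithmic derivative of [sinint k] decreases. The same comparison for sin^k, which is
    [sin_mul_shift] raised to the power k, is integrated from 0 to [y]: [H] is nondecreasing, and
    its value at [y] gives the claim up to the nonnegative boundary term left at 0. *)
Lemma sinint_shift k y d : 0 <= y -> 0 <= d -> y + d <= pi ->
  sin (y + d) ^+ k * sinint k y <= sin y ^+ k * sinint k (y + d).
Proof.
move=> y0 d0 ydpi.
have dpi : d <= pi by rewrite (le_trans _ ydpi)// lerDr.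
have ypi : y <= pi by rewrite (le_trans _ ydpi)// lerDl.
have sy : 0 <= sin y by rewrite sin_ge0_pi// y0.
pose H s := sin y ^+ k * sinint k (s + d) - sin (y + d) ^+ k * sinint k s.
suff : H 0 <= H y.
  rewrite /H sinint0 mulr0 subr0 add0r => h; rewrite -subr_ge0 (le_trans _ h)//.
  by rewrite mulr_ge0 ?exprn_ge0// sinint_ge0.
apply: (@is_derive_le _ (fun s => sin y ^+ k * sin (s + d) ^+ k -
    sin (y + d) ^+ k * sin s ^+ k)) => //.
- move=> s; apply: cvgB; apply: cvgM; try exact: cvg_cst; last exact: sinint_continuous.
  apply: (@continuous_comp _ _ _ (shift d) (sinint k)); last exact: sinint_continuous.
  by apply: cvgD; [exact: cvg_id|exact: cvg_cst].
- move=> s /andP[s0 sy'].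
  have D1 : is_derive s 1 (sinint k) (sin s ^+ k).
    by apply: is_derive_sinint; rewrite s0 (lt_le_trans sy').
  have D2 : is_derive (shift d s) 1 (sinint k) (sin (s + d) ^+ k).
    apply: is_derive_sinint; rewrite (lt_le_trans s0) ?lerDl//=.
    by rewrite (lt_le_trans _ ydpi)// ltrD2r.
  have D3 := is_derive1_comp D2 (is_derive_shift s 1 d).
  have := is_deriveB (is_deriveZ (sin y ^+ k) D3) (is_deriveZ (sin (y + d) ^+ k) D1).
  by rewrite mulr1.
- move=> s /andP[s0 sy']; rewrite -!exprMn subr_ge0 lerXn2r ?nnegrE//.
  + rewrite mulr_ge0// sin_ge0_pi//; first by rewrite ydpi addr_ge0.
    by rewrite (ltW s0)//= (le_trans (ltW sy')).
  + rewrite mulr_ge0// sin_ge0_pi// addr_ge0 ?(ltW s0)//=.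
    by rewrite (le_trans _ ydpi)// lerD2r ltW.
  + rewrite -subr_ge0 sin_mul_shift mulr_ge0// sin_ge0_pi ?d0 ?dpi//.
    by rewrite subr_ge0 (ltW sy')//= (le_trans _ ypi)// gerBl ltW.
Qed.

(** Spread the arguments to m + t and m - t around their midpoint: by [sinint_shift] the product
    decreases as t goes from 0, where it is the square, to [h], where it is the left side. *)
Lemma sinint_logconcave k a b : 0 <= a -> 0 <= b -> a + b <= pi ->
  sinint k a * sinint k b <= sinint k ((a + b) / 2) ^+ 2.
Proof.
wlog ab : a b / a <= b.
  have [ab h|/ltW ba h a0 b0 abpi] := leP a b; first exact: h.
  by rewrite mulrC addrC h// addrC.
move=> a0 b0 abpi; pose m := (a + b) / 2; pose h := (b - a) / 2.
have hm : h <= m by rewrite /h /m; lra.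
have mhpi : m + h <= pi by rewrite /h /m; lra.
have mhb : m + h = b by rewrite /m /h; field.
have mha : m - h = a by rewrite /m /h; field.
have h0 : 0 <= h by rewrite /h; lra.
rewrite -/m; clearbody m h.
pose P t := - (sinint k (m + t) * sinint k (m - t)).
suff : P 0 <= P h.
  by rewrite /P addr0 subr0 lerN2 -expr2 mhb mha [sinint k b * _]mulrC.
apply: (@is_derive_le _ (fun t => - (sin (m + t) ^+ k * sinint k (m - t) -
    sinint k (m + t) * sin (m - t) ^+ k))) => //.
- move=> t; apply: cvgN; apply: cvgM.
    apply: (@continuous_comp _ _ _ (fun t => m + t) (sinint k)); last exact: sinint_continuous.
    by apply: cvgD; [exact: cvg_cst|exact: cvg_id].
  apply: (@continuous_comp _ _ _ (fun t => m - t) (sinint k)); last exact: sinint_continuous.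
  by apply: cvgB; [exact: cvg_cst|exact: cvg_id].
- move=> t /andP[t0 th].
  have D1 : is_derive (m + t) 1 (sinint k) (sin (m + t) ^+ k).
    by apply: is_derive_sinint; apply/andP; split; lra.
  have D2 : is_derive (m - t) 1 (sinint k) (sin (m - t) ^+ k).
    by apply: is_derive_sinint; apply/andP; split; lra.
  have E1 : is_derive t 1 (fun t => m + t) (0 + 1).
    by apply: is_deriveD.
  have E2 : is_derive t 1 (fun t => m - t) (0 - 1).
    by apply: is_deriveB.
  have := is_deriveN (is_deriveM
    (@is_derive1_comp _ (sinint k) (fun t => m + t) t _ _ D1 E1)
    (@is_derive1_comp _ (sinint k) (fun t => m - t) t _ _ D2 E2)).
  move=> DD; apply: (is_derive_eq DD); rewrite /= /GRing.scale/=; ring.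
- move=> t /andP[t0 th]; rewrite opprB subr_ge0.
  have := @sinint_shift k (m - t) (t + t); rewrite (_ : m - t + (t + t) = m + t); last ring.
  by move=> sh; rewrite [leRHS]mulrC; apply: sh; lra.
Qed.

End sine_integral.

(** * Moments of the cosine against powers of sine *)

Section trigonometric_moments.
Context {R : realType}.
Local Notation mu := (@lebesgue_measure R).
Local Notation I := (`[0, pi]%classic : set R).
Implicit Types (f g : R -> R) (k j : nat) (p : {poly R}).

Lemma continuous_integrable_pi f : continuous f -> mu.-integrable I (EFin \o f).
Proof.
move=> cf; apply: continuous_compact_integrable; first exact: segment_compact.
exact: continuous_subspaceT.
Qed.

Lemma continuous_cosX j : continuous (fun t : R => cos t ^+ j).
Proof.
move=> t; apply: (@continuous_comp _ _ _ (@cos R) (fun u : R => u ^+ j)).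
  exact: continuous_cos.
exact: exprn_continuous.
Qed.

Lemma continuous_cossin j k : continuous (fun t : R => cos t ^+ j * sin t ^+ k).
Proof.
by move=> t; apply: cvgM; [exact: continuous_cosX|exact: continuous_sinX].
Qed.

Definition trigmean k f : R := \int[mu]_(t in I) (f (cos t) * sin t ^+ k).

(** The derivative of sin^(k+1) cos^j is integrated over [0, pi]; the boundary values vanish. For j
    = 0 the truncated exponent [j.-1] is multiplied by 0. *)
Lemma trigmoment_rec k j :
  (j + k.+1)%:R * trigmean k (fun u => u ^+ j.+1) =
  j%:R * trigmean k (fun u => u ^+ j.-1).
Proof.
pose F (t : R) := sin t ^+ k.+1 * cos t ^+ j.
pose a (t : R) := cos t ^+ j.+1 * sin t ^+ k.
pose b (t : R) := cos t ^+ j.-1 * sin t ^+ k.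
pose f (t : R) := (j + k.+1)%:R * a t - j%:R * b t.
have ca : continuous a by exact: continuous_cossin.
have cb : continuous b by exact: continuous_cossin.
have cf : continuous f.
  by move=> t; apply: cvgB; apply: cvgM; try exact: cvg_cst; [exact: ca|exact: cb].
have FE : F = (@sin R) ^+ k.+1 * (@cos R) ^+ j.
  by apply/funext => t; rewrite /F !fctE.
have dF (t : R) : is_derive t 1 F (f t).
  rewrite FE.
  have := is_deriveM (is_deriveX k.+1 (is_derive_sin t)) (is_deriveX j (is_derive_cos t)).
  move=> D; apply: (is_derive_eq D); rewrite /f /a /b /= /GRing.scale/= !fctE.
  case: j {F FE a b f ca cb cf D} => [|j]; rewrite /= ?natrD ?exprS; last first.
    transitivity (cos t * cos t ^+ j * (k.+1%:R * sin t ^+ k * cos t) -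
      j.+1%:R * cos t ^+ j * sin t ^+ k * sin t ^+ 2); first by ring.
    by rewrite sin2cos2; ring.
  by rewrite !expr0; ring.
have cF : continuous F.
  by move=> t; apply/differentiable_continuous/derivable1_diffP; case: (dF t).
have dFo : derivable_oo_LRcontinuous F 0 pi.
  split; first by move=> t _; case: (dF t).
    by apply: cvg_at_right_filter; exact: cF.
  by apply: cvg_at_left_filter; exact: cF.
have F'f : {in `]0, pi[, derive1 F =1 f}.
  by move=> t _; rewrite derive1E; case: (dF t).
have := continuous_FTC2 (pi_gt0 R) (continuous_subspaceT cf) dFo F'f.
move=> /(congr1 fine).
have F0 : F 0 = 0 by rewrite /F sin0 expr0n mul0r.
have Fpi : F pi = 0 by rewrite /F sinpi expr0n mul0r.
rewrite F0 Fpi subee//=.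
rewrite -/(Rintegral mu I f) RintegralB//; last 2 first.
- by apply: continuous_integrable_pi => t; apply: cvgM; [exact: cvg_cst|exact: ca].
- by apply: continuous_integrable_pi => t; apply: cvgM; [exact: cvg_cst|exact: cb].
rewrite !RintegralZl//; try exact: continuous_integrable_pi.
by move=> /eqP; rewrite subr_eq0 => /eqP.
Qed.

Lemma trigmean1 k : trigmean k (fun=> 1) = sinint k pi.
Proof.
rewrite /sinint clamp_id ?in_itv/= ?lexx ?pi_ge0//.
by apply: eq_Rintegral => t _; rewrite mul1r.
Qed.

Lemma trigmean_horner k p :
  trigmean k (horner p) = \sum_(i < size p) p`_i * trigmean k (fun u => u ^+ i).
Proof.
have cont q : continuous (fun t : R => q.[cos t] * sin t ^+ k).
  move=> t; apply: cvgM; last exact: continuous_sinX.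
  apply: (@continuous_comp _ _ _ (@cos R) (horner q)); first exact: continuous_cos.
  exact: continuous_horner.
rewrite -{1}[p]coefK poly_def.
elim/big_rec2 : _ => [|i y q _ IH].
  by rewrite /trigmean; under eq_Rintegral do rewrite horner0 mul0r;
    rewrite Rintegral_cst// mul0r.
rewrite -IH /trigmean -RintegralZl//; last first.
  exact/continuous_integrable_pi/continuous_cossin.
rewrite -RintegralD//; last 2 first.
- apply: continuous_integrable_pi => t; apply: cvgM; first exact: cvg_cst.
  exact: continuous_cossin.
- exact/continuous_integrable_pi/cont.
by apply: eq_Rintegral => t _; rewrite hornerD hornerZ hornerXn mulrDl mulrA.
Qed.

End trigonometric_moments.

(** * Moments of the height on the sphere, by infinitesimal rotations *)

Section first_order_expansion.
Context {R : realType}.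
Implicit Types (p q s a : R) (k : nat).

(** The Taylor remainder for k+1 is (p + q) times the one for k, plus k p^(k-1) q^2; the constant
    follows by induction from k^2 + k <= (k + 1)^2. *)
Lemma exprD_first_order p q k : `|p| <= 1 -> `|p + q| <= 1 ->
  `|(p + q) ^+ k - p ^+ k - k%:R * p ^+ k.-1 * q| <= k%:R ^+ 2 * q ^+ 2.
Proof.
move=> p1 pq1; elim: k => [|k IH].
  by rewrite !expr0 !mul0r subrr subr0 normr0 expr0n mul0r.
have pk : k%:R * (p * p ^+ k.-1) = k%:R * p ^+ k.
  by case: k {IH} => [|k]; rewrite ?mul0r// -exprS.
have -> : (p + q) ^+ k.+1 - p ^+ k.+1 - k.+1%:R * p ^+ k.+1.-1 * q =
    (p + q) * ((p + q) ^+ k - p ^+ k - k%:R * p ^+ k.-1 * q) +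
    k%:R * p ^+ k.-1 * q ^+ 2.
  have : k%:R * (p * p ^+ k.-1) * q = k%:R * p ^+ k * q by rewrite pk.
  rewrite !exprS -natr1 /= => e.
  apply/eqP; rewrite -subr_eq0; apply/eqP.
  transitivity (k%:R * (p * p ^+ k.-1) * q - k%:R * p ^+ k * q); first by ring.
  by rewrite e subrr.
have h1 : `|(p + q) * ((p + q) ^+ k - p ^+ k - k%:R * p ^+ k.-1 * q)| <=
    k%:R ^+ 2 * q ^+ 2.
  by rewrite normrM (le_trans _ IH)// ler_piMl.
have h2 : `|k%:R * p ^+ k.-1 * q ^+ 2| <= k%:R * q ^+ 2.
  rewrite normrM (ger0_norm (sqr_ge0 q)) ler_wpM2r ?sqr_ge0//.
  by rewrite normrM normr_nat ler_piMr// normrX exprn_ile1.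
rewrite (le_trans (ler_normD _ _))// (le_trans (lerD h1 h2))//.
rewrite -mulrDl ler_wpM2r ?sqr_ge0// -natrX -natrD -natrX ler_nat.
by rewrite !expnS !expn0; lia.
Qed.

(** [p] and [q] are two coordinates turned by an angle with cosine 1 - 2 a^2 and sine [s]; the bound
    is the first-order change of q p^k. The constant adds up four errors, [b1] to [b4]: 2k, 16k^2, 2
    and 64k^2 + 16k, each times a^2. *)
Lemma plane_rotation_first_order p q s a k :
  `|p| <= 1 -> `|q| <= 1 -> 0 <= a -> a <= 1 -> 0 <= s -> s <= 2 * a ->
  let p' := (1 - 2 * a ^+ 2) * p + s * q in
  let q' := (1 - 2 * a ^+ 2) * q - s * p in
  `|p'| <= 1 ->
  `|q' * p' ^+ k - q * p ^+ k - s * (k%:R * p ^+ k.-1 * q ^+ 2 - p ^+ k.+1)|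
    <= (2 + 18 * k%:R + 80 * k%:R ^+ 2) * a ^+ 2.
Proof.
move=> p1 q1 a0 a1 s0 sa p' q' p'1.
pose eta := p' - p; pose zeta := q' - q.
pose r := (p + eta) ^+ k - p ^+ k - k%:R * p ^+ k.-1 * eta.
have etaE : eta = s * q - 2 * a ^+ 2 * p by rewrite /eta /p'; ring.
have zetaE : zeta = - (s * p) - 2 * a ^+ 2 * q by rewrite /zeta /q'; ring.
have a2 : 2 * a ^+ 2 <= 2 * a by rewrite ler_pM2l// expr2 ler_piMr.
have c0 : 0 <= 2 * a ^+ 2 by rewrite mulr_ge0// sqr_ge0.
have le4 x y : `|x| <= 1 -> `|y| <= 1 -> `|s * x - 2 * a ^+ 2 * y| <= 4 * a.
  move=> x1 y1; rewrite (le_trans (ler_normB _ _))//.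
  rewrite (normrM s) (normrM (2 * a ^+ 2)) (ger0_norm s0) (ger0_norm c0).
  rewrite (@le_trans _ _ (s + 2 * a ^+ 2))//; last by lra.
  by rewrite lerD// ler_piMr.
have eta4 : `|eta| <= 4 * a by rewrite etaE le4.
have zeta4 : `|zeta| <= 4 * a.
  by rewrite zetaE -mulrN le4// normrN.
have eta2 : eta ^+ 2 <= 16 * a ^+ 2.
  rewrite -real_normK ?num_real// (_ : 16 * a ^+ 2 = (4 * a) ^+ 2); last by ring.
  by rewrite lerXn2r// nnegrE mulr_ge0.
have rle : `|r| <= 16 * k%:R ^+ 2 * a ^+ 2.
  rewrite (le_trans (exprD_first_order k p1 _))//; first by rewrite /eta subrKC.
  rewrite (_ : 16 * _ * _ = k%:R ^+ 2 * (16 * a ^+ 2)); last by ring.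
  by rewrite ler_wpM2l// sqr_ge0.
have pk1 j : `|p ^+ j| <= 1 by rewrite normrX exprn_ile1.
have dE : p' ^+ k - p ^+ k = r + k%:R * p ^+ k.-1 * eta.
  by rewrite /r /eta subrKC; ring.
have dle : `|p' ^+ k - p ^+ k| <= 16 * k%:R ^+ 2 * a ^+ 2 + 4 * k%:R * a.
  rewrite dE (le_trans (ler_normD _ _))// lerD// (normrM (_ * _)) normrM normr_nat.
  rewrite (_ : 4 * k%:R * a = k%:R * 1 * (4 * a)); last by ring.
  by rewrite ler_pM// ?mulr_ge0// ler_wpM2l.
have -> : q' * p' ^+ k - q * p ^+ k - s * (k%:R * p ^+ k.-1 * q ^+ 2 - p ^+ k.+1) =
    q * (k%:R * p ^+ k.-1) * (eta - s * q) + q * r + (zeta + s * p) * p ^+ k +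
    zeta * (p' ^+ k - p ^+ k).
  have -> : p' ^+ k = p ^+ k + r + k%:R * p ^+ k.-1 * eta.
    by rewrite -addrA -dE subrKC.
  have -> : q' = q + zeta by rewrite /zeta subrKC.
  by rewrite (exprS p k); ring.
have a2_ge0 : 0 <= a ^+ 2 by exact: sqr_ge0.
have k0 : 0 <= k%:R :> R by [].
have b1 : `|q * (k%:R * p ^+ k.-1) * (eta - s * q)| <= 2 * k%:R * a ^+ 2.
  rewrite (_ : eta - s * q = - (2 * a ^+ 2 * p)); last by rewrite etaE; ring.
  rewrite mulrN normrN (normrM (q * _)) (normrM q) (normrM k%:R) (normrM (2 * a ^+ 2)).
  rewrite normr_nat (ger0_norm c0).
  rewrite (_ : 2 * k%:R * a ^+ 2 = 1 * (k%:R * 1) * (2 * a ^+ 2 * 1)); last by ring.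
  by apply: ler_pM; rewrite ?mulr_ge0//; [apply: ler_pM => //|]; rewrite ?mulr_ge0// ler_wpM2l.
have b2 : `|q * r| <= 16 * k%:R ^+ 2 * a ^+ 2.
  by rewrite normrM (le_trans _ rle)// ler_piMl.
have b3 : `|(zeta + s * p) * p ^+ k| <= 2 * a ^+ 2.
  rewrite (_ : zeta + s * p = - (2 * a ^+ 2 * q)); last by rewrite zetaE; ring.
  rewrite normrM normrN (normrM (2 * a ^+ 2)) (ger0_norm c0).
  rewrite [leRHS](_ : _ = 2 * a ^+ 2 * 1 * 1); last by ring.
  by apply: ler_pM => //; rewrite ?mulr_ge0// ler_wpM2l.
have b4 : `|zeta * (p' ^+ k - p ^+ k)| <= (64 * k%:R ^+ 2 + 16 * k%:R) * a ^+ 2.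
  rewrite normrM (@le_trans _ _ ((4 * a) * (16 * k%:R ^+ 2 * a ^+ 2 + 4 * k%:R * a)))//.
    by rewrite ler_pM.
  have : a * a ^+ 2 <= a ^+ 2 by rewrite ler_piMl.
  move=> /(ler_wpM2l (_ : 0 <= 64 * k%:R ^+ 2)) h.
  have {}h : 64 * k%:R ^+ 2 * (a * a ^+ 2) <= 64 * k%:R ^+ 2 * a ^+ 2.
    by apply: h; rewrite mulr_ge0// sqr_ge0.
  rewrite [leRHS]mulrDl [leLHS](_ : _ =
    64 * k%:R ^+ 2 * (a * a ^+ 2) + 16 * k%:R * a ^+ 2); last by ring.
  by rewrite lerD2r.
rewrite (le_trans (ler_normD _ _))// (le_trans (lerD (ler_normD _ _) b4))//.
rewrite (le_trans (lerD (lerD (ler_normD _ _) b3) (lexx _)))//.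
rewrite (le_trans (lerD (lerD (lerD b1 b2) (lexx _)) (lexx _)))//.
lra.
Qed.

End first_order_expansion.

Section moments.
Context {R : realType} {n : nat}.
Variables (n_gt0 : (0 < n)%N) (sigma : probability (borelRV R n.+1) R).
Hypothesis haar : is_haar_sphere sigma.
Local Notation S := (sphere R n).
Local Notation E := (mean sigma S).
Local Notation coord i := (fun x : borelRV R n.+1 => (x : 'rV[R]_n.+1) 0 i).
Implicit Types (x : 'rV[R]_n.+1).

Lemma inner_delta x i : inner x (delta_mx 0 i) = x 0 i.
Proof.
rewrite /inner (bigD1 i)//= mxE !eqxx mulr1 big1 ?addr0// => j ji.
by rewrite mxE (negbTE ji) andbF mulr0.
Qed.

Lemma coord_le1 x i : S x -> `|x 0 i| <= 1.
Proof.
move=> Sx; rewrite ler_norml -inner_delta inner_le1//.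
by rewrite delta_inner eqxx.
Qed.

Lemma bdmeas_coord i : bdmeas S (coord i).
Proof.
split; first by apply: measurable_funTS; exact: measurable_coord.
by exists 1 => x; exact: coord_le1.
Qed.

(** Reflections in [e i] and in a unit vector [v] whose angle with [e i] has sine [a] and cosine [b]
    compose to a rotation by twice that angle, so s = 2 a b. The bound on [a] keeps b >= 1/2, hence
    s >= a. *)
Lemma plane_rotation (i : 'I_n.+1) (a : R) : i != 0 -> 0 <= a -> a <= 1 / 2 ->
  exists A : 'M[R]_n.+1, exists s : R, [/\ rotation A, a <= s, s <= 2 * a &
    forall x, (x *m A) 0 0 = (1 - 2 * a ^+ 2) * x 0 0 + s * x 0 i /\
              (x *m A) 0 i = (1 - 2 * a ^+ 2) * x 0 i - s * x 0 0].
Proof.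
move=> i0 a0 a12; pose b := Num.sqrt (1 - a ^+ 2).
have b2 : b ^+ 2 = 1 - a ^+ 2.
  by rewrite sqr_sqrtr// subr_ge0 exprn_ile1//; lra.
have b0 : 0 <= b by exact: sqrtr_ge0.
have b1 : b <= 1 by rewrite -(@ler_pXn2r _ 2)// ?nnegrE// b2 expr1n gerBl sqr_ge0.
have b12 : 1 / 2 <= b.
  rewrite -(@ler_pXn2r _ 2)// ?nnegrE// b2.
  have : a ^+ 2 <= (1 / 2) ^+ 2 by rewrite lerXn2r// nnegrE.
  lra.
pose e j : 'rV[R]_n.+1 := delta_mx 0 j.
pose v := a *: e 0 + b *: e i.
have vv : inner v v = 1.
  rewrite /v !(innerDl, innerDr, innerZl, innerZr) !delta_inner !eqxx.
  rewrite (negbTE i0) eq_sym (negbTE i0).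
  by transitivity (a ^+ 2 + b ^+ 2); [rewrite /=; ring|rewrite b2 subrKC].
exists (reflmx (e i) *m reflmx v), (2 * a * b); split.
- apply: rotation_refl2; rewrite -inner_eq0 ?vv ?oner_eq0//.
  by rewrite delta_inner eqxx oner_eq0.
- by rewrite -mulrA mulrCA ler_peMr//; lra.
- by rewrite ler_piMr// mulr_ge0.
- move=> x; rewrite mulmxA !mulmx_refl vv delta_inner eqxx inner_delta !divr1.
  rewrite /v !(innerDr, innerBl, innerZl, innerZr) !inner_delta.
  rewrite !mxE !eqxx/= eq_sym (negbTE i0).
  split; apply/eqP; rewrite -subr_eq0; rewrite ?mulr0n; apply/eqP; first by ring.
  transitivity (2 * x 0 i * (b ^+ 2 - (1 - a ^+ 2))); first by ring.
  by rewrite b2 subrr mulr0.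
Qed.

Local Notation x0 := (fun x : borelRV R n.+1 => (x : 'rV[R]_n.+1) 0 0).

(* Invariance under the plane rotations, to first order in the angle. *)
Lemma moment_coord (i : 'I_n.+1) k : i != 0 ->
  k%:R * E (fun x => x0 x ^+ k.-1 * coord i x ^+ 2) = E (fun x => x0 x ^+ k.+1).
Proof.
move=> i0; have mS := @measurable_sphere R n.
have b0 := bdmeas_coord 0; have bi := bdmeas_coord i.
pose h x := coord i x * x0 x ^+ k.
have bh : bdmeas S h by apply: bdmeasM => //; exact: bdmeasX.
have b1 : bdmeas S (fun x => x0 x ^+ k.-1 * coord i x ^+ 2).
  by apply: bdmeasM; exact: bdmeasX.
have b2 : bdmeas S (fun x => x0 x ^+ k.+1) by exact: bdmeasX.
pose g x := k%:R * (x0 x ^+ k.-1 * coord i x ^+ 2) - x0 x ^+ k.+1.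
have bg : bdmeas S g by apply: bdmeasB => //; exact: bdmeasZ.
pose C : R := 2 + 18 * k%:R + 80 * k%:R ^+ 2.
have C0 : 0 <= C by rewrite /C !addr_ge0// ?mulr_ge0// sqr_ge0.
have gE : E g = k%:R * E (fun x => x0 x ^+ k.-1 * coord i x ^+ 2) -
    E (fun x => x0 x ^+ k.+1).
  by rewrite /g meanB// ?meanZ//; exact: bdmeasZ.
(* [h] has the same mean before and after the rotation, so only the first-order term survives: s |E
   g| <= C a^2, and s >= a. *)
have gC a : 0 < a -> a <= 1 / 2 -> `|E g| <= C * a.
  move=> a0 a12.
  have [A [s [rA sa s2a xA]]] := plane_rotation i0 (ltW a0) a12.
  have [bhA hA] := haar_rotation haar rA bh.
  have s0 : 0 < s by exact: lt_le_trans sa.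
  have : `|E (fun x => (h \o mulmxr A) x - h x) - E (fun x => s * g x)| <= C * a ^+ 2.
    apply: mean_dist_le => //; first exact: (haar_carried haar).
    - exact: bdmeasB.
    - exact: bdmeasZ.
    - move=> x Sx; rewrite /h /g /=.
      have [x0A xiA] := xA x.
      have := @plane_rotation_first_order R (x 0 0) (x 0 i) s a k.
      rewrite -x0A -xiA mulrA; apply.
      + exact: coord_le1.
      + exact: coord_le1.
      + exact: ltW.
      + by lra.
      + exact: ltW.
      + by [].
      + by apply: coord_le1; exact: sphere_rotation.
  rewrite meanB// meanZ// hA subrr sub0r normrN normrM gtr0_norm// => le2.
  rewrite -(ler_pM2l a0) (le_trans (ler_wpM2r (normr_ge0 _) sa))//.
  by rewrite (le_trans le2)// expr2 mulrCA.
have /eqP : E g = 0; last by rewrite gE subr_eq0 => /eqP.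
apply/eqP; rewrite -normr_le0; apply/ler_addgt0Pr => e e0; rewrite add0r.
pose a := Num.min (1 / 2) (e / (C + 1)).
have C1 : 0 < C + 1 by rewrite ltr_wpDl.
have a0 : 0 < a by rewrite lt_min !divr_gt0.
rewrite (le_trans (gC a a0 _)) ?ge_min ?lexx//.
have : a <= e / (C + 1) by rewrite ge_min lexx orbT.
rewrite ler_pdivlMr// => h1; rewrite (le_trans _ h1)// mulrC ler_pM2l//.
by rewrite lerDl.
Qed.

(** Sum [moment_coord] over the n coordinates other than the first, using that the squares of all
    coordinates add up to 1. The outcome is the recursion [trigmoment_rec] for the exponent
    [n.-1]. *)
Lemma moment_rec k :
  (k + n)%:R * E (fun x => x0 x ^+ k.+1) = k%:R * E (fun x => x0 x ^+ k.-1).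
Proof.
have mS := @measurable_sphere R n.
have b0 := bdmeas_coord 0.
have bX j : bdmeas S (fun x => x0 x ^+ j) by exact: bdmeasX.
have bXi (i : 'I_n.+1) : bdmeas S (fun x => x0 x ^+ k.-1 * coord i x ^+ 2).
  by apply: bdmeasM; [exact: bX|apply: bdmeasX; exact: bdmeas_coord].
have h1 : \sum_(i < n.+1) E (fun x => x0 x ^+ k.-1 * coord i x ^+ 2) =
    E (fun x => x0 x ^+ k.-1).
  rewrite -mean_sum//; apply: eq_mean => x Sx.
  by rewrite -mulr_sumr -[RHS]mulr1 -[in RHS]Sx; congr (_ * _).
have h2 : k%:R * \sum_(i < n.+1) E (fun x => x0 x ^+ k.-1 * coord i x ^+ 2) =
    k%:R * E (fun x => x0 x ^+ k.+1) + n%:R * E (fun x => x0 x ^+ k.+1).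
  rewrite mulr_sumr (bigD1 0)//=; congr (_ + _).
    case: k {bXi h1} => [|k]; first by rewrite !mul0r.
    by congr (_ * _); apply: eq_mean => x _; rewrite -exprD addn2.
  rewrite (eq_bigr (fun=> E (fun x => x0 x ^+ k.+1))); last first.
    by move=> i i0; exact: moment_coord.
  by rewrite sumr_const cardC1 card_ord -[LHS]mulr_natl.
by rewrite -h1 h2 natrD mulrDl.
Qed.

(** The height is distributed as cos t under the normalized density sin^(n-1), at least when tested
    on polynomials: both moment sequences obey the same two-step recursion, agree at order 0, and
    vanish at order 1. *)
Lemma mean_x0_trig (p : {poly R}) :
  sinint n.-1 pi * E (fun x => p.[x0 x]) = trigmean n.-1 (horner p).
Proof.
have mS := @measurable_sphere R n.
have moments k : sinint n.-1 pi * E (fun x => x0 x ^+ k) =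
    trigmean n.-1 (fun u => u ^+ k).
  have [m] := ubnP k; elim: m k => // m IH [|k] km.
    rewrite (_ : E _ = 1) ?mulr1 ?trigmean1//.
    by under [X in E X]eq_fun do rewrite expr0; rewrite mean_cst// (haar_carried haar).
  have kn : (k + n)%:R != 0 :> R by rewrite pnatr_eq0; lia.
  apply: (mulfI kn); rewrite mulrCA moment_rec.
  have := @trigmoment_rec R n.-1 k; rewrite prednK// => ->.
  rewrite mulrCA; case: k km {kn} => [|k] km; first by rewrite !mul0r.
  by rewrite /= IH//; lia.
rewrite trigmean_horner (@eq_mean _ _ _ sigma S _
    (fun x => \sum_(i < size p) p`_i * x0 x ^+ i)); last first.
  by move=> x _; rewrite horner_coef.
have b0 := bdmeas_coord 0.
have bX j : bdmeas S (fun x => x0 x ^+ j) by exact: bdmeasX.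
rewrite mean_sum//; last by move=> i; apply: bdmeasZ; exact: bX.
rewrite mulr_sumr; apply: eq_bigr => i _; rewrite -moments mulrCA; congr (_ * _).
by rewrite meanZ.
Qed.

End moments.

(** * Polynomial approximation of a step, and the measure of caps *)

Section polynomial_threshold.
Context {R : realType}.
Implicit Types (y z d : R) (N m : nat).

Lemma bernoulli_ge z m : 0 <= z -> z <= 1 -> 1 - m%:R * z <= (1 - z) ^+ m.
Proof.
move=> z0 z1; elim: m => [|m IH]; first by rewrite mul0r subr0 expr0.
rewrite exprS.
have := ler_wpM2l (_ : 0 <= 1 - z) IH; rewrite subr_ge0 => /(_ z1).
apply: le_trans; rewrite -natr1 -subr_ge0.
rewrite (_ : _ - _ = m%:R * z ^+ 2); last by ring.
by rewrite mulr_ge0// sqr_ge0.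
Qed.

Lemma bernoulli_le z m : 0 <= z -> 1 + m%:R * z <= (1 + z) ^+ m.
Proof.
move=> z0; elim: m => [|m IH]; first by rewrite mul0r addr0 expr0.
rewrite exprS.
have := ler_wpM2l (_ : 0 <= 1 + z) IH; rewrite addr_ge0// => /(_ isT).
apply: le_trans; rewrite -natr1 -subr_ge0.
rewrite (_ : _ - _ = m%:R * z ^+ 2); last by ring.
by rewrite mulr_ge0// sqr_ge0.
Qed.

(* tends to 1 on [0, 1/2[ and to 0 on ]1/2, 1] as N grows *)
Definition threshold N y := (1 - y ^+ N) ^+ (2 ^ N).

Lemma threshold_itv N y : 0 <= y -> y <= 1 -> 0 <= threshold N y <= 1.
Proof.
move=> y0 y1; have yN1 : y ^+ N <= 1 by rewrite exprn_ile1.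
have yN0 : 0 <= y ^+ N by rewrite exprn_ge0.
by rewrite exprn_ge0 ?subr_ge0// exprn_ile1 ?subr_ge0// gerBl.
Qed.

(** Since 2 y (1 + 2 d) <= (1 - 2 d) (1 + 2 d) <= 1, Bernoulli's inequality leaves an error (2 y)^N
    of at most (1 + 2 d)^-N. *)
Lemma threshold_near1 N y d : 0 <= y -> 0 <= d -> y <= 1 / 2 - d ->
  1 - (1 + 2 * d) ^- N <= threshold N y.
Proof.
move=> y0 d0 yd.
have yN1 : y ^+ N <= 1 by rewrite exprn_ile1//; lra.
have yN0 : 0 <= y ^+ N by rewrite exprn_ge0.
rewrite (le_trans _ (bernoulli_ge _ yN0 yN1))// lerB// natrX -exprMn.
rewrite -exprVn lerXn2r ?nnegrE ?mulr_ge0// ?invr_ge0 ?addr_ge0 ?mulr_ge0//.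
rewrite -[leRHS]mul1r ler_pdivlMr; last by rewrite ltr_wpDr// mulr_ge0.
rewrite (@le_trans _ _ ((1 - 2 * d) * (1 + 2 * d)))//.
  by rewrite ler_wpM2r//; [rewrite addr_ge0// mulr_ge0|lra].
rewrite (_ : _ * _ = 1 - (2 * d) ^+ 2); last by ring.
by rewrite gerBl sqr_ge0.
Qed.

(** Multiplication by (1 + y^N)^(2^N), which is at least 1 + (2 y)^N, turns the threshold into (1 -
    y^(2N))^(2^N) <= 1. *)
Lemma threshold_near0 N y d : y <= 1 -> 0 <= d -> 1 / 2 + d <= y ->
  threshold N y <= (1 + 2 * d) ^- N.
Proof.
move=> y1 d0 yd.
have y0 : 0 <= y by lra.
have yN1 : y ^+ N <= 1 by rewrite exprn_ile1.
have yN0 : 0 <= y ^+ N by rewrite exprn_ge0.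
have d1 : 0 < (1 + 2 * d) ^+ N by rewrite exprn_gt0// ltr_wpDr// mulr_ge0.
have /andP[t0 _] := threshold_itv N y0 y1.
rewrite -[leRHS]mul1r ler_pdivlMr//.
rewrite (@le_trans _ _ (threshold N y * (1 + y ^+ N) ^+ (2 ^ N)))//.
  rewrite ler_wpM2l// (le_trans _ (bernoulli_le _ yN0))// natrX -exprMn.
  rewrite (@le_trans _ _ ((2 * y) ^+ N))//; last by rewrite lerDr.
  by rewrite lerXn2r// ?nnegrE ?mulr_ge0// ?addr_ge0 ?mulr_ge0//; lra.
rewrite /threshold -exprMn (_ : _ * _ = 1 - (y ^+ N) ^+ 2); last by ring.
have yN2 : (y ^+ N) ^+ 2 <= 1 by rewrite exprn_ile1.
by rewrite exprn_ile1 ?subr_ge0// gerBl sqr_ge0.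
Qed.

End polynomial_threshold.

Section cap_measure.
Context {R : realType} {n : nat}.
Variables (n_gt0 : (0 < n)%N) (sigma : probability (borelRV R n.+1) R).
Hypothesis haar : is_haar_sphere sigma.
Local Notation S := (sphere R n).
Local Notation E := (mean sigma S).
Local Notation mu := (@lebesgue_measure R).
Implicit Types (x : 'rV[R]_n.+1) (r : R).

Definition polar_cap r : set (borelRV R n.+1) :=
  [set x | S x /\ cos r <= (x : 'rV[R]_n.+1) 0 0].

Lemma measurable_polar_cap r : measurable (polar_cap r).
Proof.
apply: measurableI; first exact: measurable_sphere.
rewrite -[X in measurable X]setTI.
have := @measurable_coord R n.+1 0 measurableT `[cos r, +oo[%classic (measurable_itv _).
by congr (measurable (_ `&` _)); apply/seteqP; split => y /=; rewrite in_itv/= andbT.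
Qed.

(** A polynomial in the height is nearly 1 on the cap of radius [r] and nearly 0 outside that of
    radius [r']; its mean is known from the moments, and integrating it against sin^(n-1) brings in
    [r']. *)
Lemma polar_cap_le_shift N r r' : 0 <= r -> r < r' -> r' <= pi ->
  fine (sigma (polar_cap r)) * sinint n.-1 pi <= sinint n.-1 r' +
    2 * (1 + 2 * ((cos r - cos r') / 8)) ^- N * sinint n.-1 pi.
Proof.
move=> r0 rr' r'pi; have mS := @measurable_sphere R n.
set W := sinint n.-1 pi.
have W0 : 0 <= W by rewrite ltW// sinint_gt0.
have cc' : cos r' < cos r.
  by rewrite ltr_cos// in_itv/=; apply/andP; split; rewrite ?(ltW (lt_le_trans rr' _))//; lra.
pose d := (cos r - cos r') / 8; rewrite -/d.
have d0 : 0 <= d by rewrite divr_ge0// subr_ge0 ltW.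
pose m := (cos r + cos r') / 2.
pose v := (1 + 2 * d) ^- N; rewrite -/v.
have d1 : 1 <= 1 + 2 * d by rewrite lerDl mulr_ge0.
have v1 : v <= 1 by rewrite invf_le1 ?exprn_gt0 ?exprn_ege1// (lt_le_trans ltr01).
have v0 : 0 <= v by rewrite invr_ge0 exprn_ge0// (le_trans ler01).
(* Maps [-1, 1] into [0, 1], the midpoint [m] to 1/2, and [cos r], [cos r'] to 1/2 - [d], 1/2 + [d];
   hence the 8 in [d]. *)
pose q : {poly R} := (1 / 2 + m / 4)%:P - (1 / 4) *: 'X.
pose P := (1 - q ^+ N) ^+ (2 ^ N).
have PE u : P.[u] = threshold N (1 / 2 + (m - u) / 4).
  rewrite /P /threshold !hornerE; congr ((1 - _ ^+ _) ^+ _). lra.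
have q01 u : -1 <= u -> u <= 1 -> 0 <= 1 / 2 + (m - u) / 4 <= 1.
  have := cos_geN1 r; have := cos_geN1 r'; have := cos_le1 r; have := cos_le1 r'.
  by move=> *; rewrite /m; apply/andP; split; lra.
have P01 u : -1 <= u -> u <= 1 -> 0 <= P.[u] <= 1.
  by move=> u0 u1; have /andP[] := q01 u u0 u1; rewrite PE; exact: threshold_itv.
pose A := polar_cap r.
have mA : measurable A by exact: measurable_polar_cap.
have bA : bdmeas S (\1_A : borelRV R n.+1 -> R) by exact: bdmeas_indic.
have AE : fine (sigma A) = E \1_A by rewrite mean_indic// => x [].
have A1 : fine (sigma A) <= 1.
  by rewrite -[leRHS]/(fine 1%E) fine_le ?fin_num_measure// probability_le1.
have b0 := @bdmeas_coord R n 0.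
have bP := bdmeas_horner P b0.
have lower : (1 - v) * fine (sigma A) <=
    E (fun x : borelRV R n.+1 => P.[(x : 'rV[R]_n.+1) 0 0]).
  rewrite AE -meanZ//; apply: le_mean => //; first exact: bdmeasZ.
  move=> x Sx; have := coord_le1 0 Sx; rewrite ler_norml => /andP[x0 x1].
  have /andP[P0 _] := P01 _ x0 x1; have /andP[q0 _] := q01 _ x0 x1.
  rewrite indicE; have [/set_mem[_ rx]|_] := boolP (x \in A); last by rewrite mulr0.
  by rewrite mulr1 PE threshold_near1// /m /d; lra.
have upper : trigmean n.-1 (horner P) <= sinint n.-1 r' + v * W.
  have iX (D : set R) : D `<=` `[0, pi]%classic -> measurable D ->
      mu.-integrable D (EFin \o (fun t => sin t ^+ n.-1)).
    by move=> DI mD; apply: integrableS (@integrable_sinX R n.-1 0 pi).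
  have vW : v * W = \int[mu]_(t in `[0, pi]) (v * sin t ^+ n.-1).
    by rewrite RintegralZl//; [rewrite /W /sinint clamp_id ?in_itv/= ?lexx ?pi_ge0|exact: iX].
  have r'0 : 0 <= r' by rewrite (le_trans r0)// ltW.
  have mr' : measurable (`[0, r']%classic : set R) by exact: measurable_itv.
  pose w (t : R) := \1_(`[0, r']%classic) t * sin t ^+ n.-1 : R.
  have sub : (`[0, r']%classic : set R) `<=` `[0, pi] by apply: subset_itvl; rewrite bnd_simp.
  have wE : sinint n.-1 r' = \int[mu]_(t in `[0, pi]) w t.
    rewrite /sinint clamp_id ?in_itv/= ?r'0// -[in LHS](setIidr sub).
    rewrite Rintegral_mkcondr; apply: eq_Rintegral => t _.
    by rewrite /w patchE indicE; case: ifPn; rewrite ?mul1r ?mul0r.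
  have mI : measurable (`[0, pi]%classic : set R) by exact: measurable_itv.
  have bdI (h : R -> R) : measurable_fun setT h -> (forall t, `|h t| <= 1) ->
      mu.-integrable `[0, pi] (EFin \o h).
    move=> mh h1; apply: measurable_bounded_integrable => //.
    - by rewrite /= lebesgue_measure_itv/=; case: ifP => // _; rewrite -EFinB ltry.
    - exact: measurable_funTS.
    - exists 1; split; first exact: num_real.
      by move=> M M1 t _; exact: le_trans (h1 t) (ltW M1).
  have msin : measurable_fun setT (fun t : R => sin t ^+ n.-1).
    by apply: continuous_measurable_fun; exact: continuous_sinX.
  have sin1 (t : R) : `|sin t ^+ n.-1| <= 1.
    by rewrite normrX exprn_ile1// ler_norml sin_geN1 sin_le1.
  have iw : mu.-integrable `[0, pi] (EFin \o w).
    apply: bdI; first by apply: measurable_funM => //; exact: measurable_indic.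
    move=> t; rewrite normrM -[leRHS]mulr1 ler_pM//.
    by rewrite indicE; case: (_ \in _); rewrite ?normr1 ?normr0.
  have iv : mu.-integrable `[0, pi] (EFin \o (fun t => v * sin t ^+ n.-1)).
    apply: bdI; first by apply: measurable_funM => //; exact: measurable_cst.
    by move=> t; rewrite normrM -[leRHS]mulr1 ler_pM// ger0_norm.
  rewrite vW wE -RintegralD//; apply: le_Rintegral => //.
  - apply: continuous_integrable_pi => t; apply: cvgM; last exact: continuous_sinX.
    apply: (@continuous_comp _ _ _ (@cos R) (horner P)); first exact: continuous_cos.
    exact: continuous_horner.
  - rewrite (_ : EFin \o _ = (EFin \o w) \+ (EFin \o (fun t => v * sin t ^+ n.-1))).
      exact: integrableD.
    by apply/funext => t.
  - move=> t; rewrite /= in_itv/= => /andP[t0 tpi].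
    have st : 0 <= sin t ^+ n.-1 by rewrite exprn_ge0// sin_ge0_pi// t0.
    have /andP[P0 P1] := P01 _ (cos_geN1 t) (cos_le1 t).
    rewrite -mulrDl ler_wpM2r//.
    rewrite indicE; have [_|] := boolP (t \in _); first by rewrite (le_trans P1)// lerDl.
    rewrite add0r notin_setE/= in_itv/= t0/= => /negP; rewrite -ltNge => r't.
    have : cos t < cos r' by rewrite ltr_cos// in_itv/= ?t0 ?tpi// r'0.
    have /andP[_ q1] := q01 _ (cos_geN1 t) (cos_le1 t).
    by move=> ?; rewrite PE; apply: threshold_near0 => //; rewrite /m /d; lra.
rewrite -(mean_x0_trig n_gt0 haar) -/W in upper.
have := ler_wpM2l W0 lower.
(* Together with the error already present in [upper], this makes the factor 2. *)
have vA : W * (v * fine (sigma A)) <= W * v by rewrite ler_wpM2l// ler_piMr.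
rewrite -/A; lra.
Qed.

(** First N tends to infinity, then r' decreases to r. The radius [pi] leaves no room for r' and is
    settled by total mass 1. *)
Lemma polar_cap_le r : 0 <= r -> r <= pi ->
  fine (sigma (polar_cap r)) <= Sigma n r.
Proof.
move=> r0 rpi; pose W : R := sinint n.-1 pi.
have W0 : 0 < W by exact: sinint_gt0.
rewrite SigmaE ?r0// ler_pdivlMr// -/W.
have [rp|rp] := ltP r pi; last first.
  have -> : r = pi by apply/le_anti; rewrite rpi rp.
  apply: ler_piMl; first exact: ltW.
  rewrite -[leRHS]/(fine 1%E).
  by rewrite fine_le ?fin_num_measure// ?probability_le1//; exact: measurable_polar_cap.
have le_r' r' : r < r' -> r' <= pi -> fine (sigma (polar_cap r)) * W <= sinint n.-1 r'.
  move=> rr' r'pi; pose z := (1 + 2 * ((cos r - cos r') / 8))^-1.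
  have cc' : cos r' < cos r.
    by rewrite ltr_cos// in_itv/=; apply/andP; split; rewrite ?(ltW (le_lt_trans r0 rr'))//; lra.
  have z1 : `|z| < 1.
    have d1 : 1 < 1 + 2 * ((cos r - cos r') / 8) by lra.
    by rewrite normfV ger0_norm; [rewrite invf_lt1//; lra|lra].
  have h1 : (fun N => sinint n.-1 r' + 2 * z ^+ N * W) @ \oo --> sinint n.-1 r'.
    rewrite -[X in _ --> X]addr0; apply: cvgD; first exact: cvg_cst.
    rewrite -(mul0r W); apply: cvgM; last exact: cvg_cst.
    rewrite -(mulr0 2); apply: cvgM; first exact: cvg_cst.
    exact: cvg_expr.
  rewrite -(cvg_lim _ h1)//; apply: limr_ge; first by apply/cvg_ex; eexists; exact: h1.
  apply: nearW => N; rewrite /z exprVn; exact: polar_cap_le_shift.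
have h2 : sinint n.-1 x @[x --> r^'+] --> sinint n.-1 r.
  by apply: cvg_at_right_filter; exact: sinint_continuous.
rewrite -(cvg_lim _ h2)//; apply: limr_ge; first by apply/cvg_ex; eexists; exact: h2.
near=> r'; apply: le_r'; first by near: r'; exact: nbhs_right_gt.
by near: r'; exact: nbhs_right_le.
Unshelve. all: by end_near. Qed.

End cap_measure.

(** * Two-point symmetrization and its effect on means *)

Section slip_closure.
Context {R : realType} {n : nat}.
Local Notation rV := 'rV[R]_n.+1.
Local Notation S := (sphere R n).
Implicit Types (x y z v : rV) (u w f g : rV -> R) (L : R).

Lemma slipN L f : slip L f -> slip L (fun x => - f x).
Proof. by move=> lf x y Sx Sy; rewrite opprK addrC sdistC lf. Qed.

Lemma slipD L L' f g : slip L f -> slip L' g -> slip (L + L') (fun x => f x + g x).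
Proof.
move=> lf lg x y Sx Sy; rewrite opprD addrACA mulrDl lerD//; [exact: lf|exact: lg].
Qed.

Lemma slipB L L' f g : slip L f -> slip L' g -> slip (L + L') (fun x => f x - g x).
Proof. by move=> lf /slipN; exact: slipD. Qed.

Lemma slipM L L' f g : slip L f -> slip L' g ->
  exists L2, slip L2 (fun x => f x * g x).
Proof.
move=> lf lg; have [M fM] := slip_bound lf; have [M' gM'] := slip_bound lg.
exists (`|M| * L' + `|M'| * L) => x y Sx Sy.
have -> : f x * g x - f y * g y = f x * (g x - g y) + g y * (f x - f y) by ring.
rewrite mulrDl -!mulrA lerD// (le_trans (ler_norm _))// normrM ler_pM//.
- by rewrite (le_trans (fM _ Sx))// ler_norm.
- exact: slip_norm.
- by rewrite (le_trans (gM' _ Sy))// ler_norm.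
- exact: slip_norm.
Qed.

Lemma slip_sdist e : S e -> slip 1 (fun x => sdist x e).
Proof. by move=> Se x y Sx Sy; rewrite mul1r lerBlDr sdist_triangle. Qed.

Lemma slip_ramp L f (m : nat) : slip L f ->
  slip (m%:R * L) (fun x => Num.max 0 (1 - m%:R * f x)).
Proof.
move=> lf x y Sx Sy.
have h : m%:R * (f y - f x) <= m%:R * L * sdist x y.
  by rewrite -mulrA ler_wpM2l// sdistC lf.
(* Adding the Lipschitz bounds for (x, y) and (y, x) gives the sign. *)
have L0 : 0 <= m%:R * L * sdist x y.
  have := lf _ _ Sx Sy; have := lf _ _ Sy Sx; rewrite sdistC => h1 h2.
  by rewrite -mulrA mulr_ge0//; lra.
rewrite lerBlDr ge_max; apply/andP; split.
  by rewrite addr_ge0// le_max lexx.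
rewrite (@le_trans _ _ (m%:R * L * sdist x y + (1 - m%:R * f y)))//; first by lra.
by rewrite lerD2l le_max lexx orbT.
Qed.

(* two-point symmetrization *)
Definition polarize v u x :=
  if 0 <= inner x v then Num.max (u x) (u (x *m reflmx v))
  else Num.min (u x) (u (x *m reflmx v)).

Lemma inner_refl_normal x v : v != 0 -> inner (x *m reflmx v) v = - inner x v.
Proof.
by move=> v0; rewrite inner_reflC// refl_neg// innerNr.
Qed.

(** On a mirror pair polarization only permutes the two values; on the mirror itself the pair
    collapses to one point. [phi] is free so as to cover the ramps as well as [u] itself. *)
Lemma polarize_pair v u x (phi : R -> R) : v != 0 ->
  phi (polarize v u x) + phi (polarize v u (x *m reflmx v)) =
  phi (u x) + phi (u (x *m reflmx v)).
Proof.
move=> v0; rewrite /polarize inner_refl_normal// oppr_ge0.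
have -> : x *m reflmx v *m reflmx v = x by have /= -> := reflK v0 x.
have [xv|xv|xv] := ltrgt0P (inner x v).
- rewrite minC; case: (leP (u x) (u (x *m reflmx v))) => // _.
  by rewrite addrC.
- rewrite maxC; case: (leP (u x) (u (x *m reflmx v))) => // _.
  by rewrite addrC.
- have -> : x *m reflmx v = x by rewrite mulmx_refl xv mulr0 mul0r scale0r subr0.
  by rewrite maxxx.
Qed.

Lemma polarize_itv v u (a b : R) x : (forall y, a <= u y <= b) ->
  a <= polarize v u x <= b.
Proof.
move=> uab; have /andP[? ?] := uab x; have /andP[? ?] := uab (x *m reflmx v).
rewrite /polarize; case: ifP => _; case: (leP (u x) _) => _; by apply/andP; split.
Qed.

(** The delicate case is a maximum at [x] against a minimum at [y] across the mirror: cross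
    differences between one point and the image of the other appear, and their distance is at most
    that of [x] and [y]. *)
Lemma slip_polarize L v u : 0 <= L -> v != 0 -> slip L u -> slip L (polarize v u).
Proof.
move=> L0 v0 lu x y Sx Sy.
have Sx' := sphere_refl v0 Sx; have Sy' := sphere_refl v0 Sy.
have d1 : sdist (x *m reflmx v) (y *m reflmx v) = sdist x y by exact: sdist_refl.
have d2 : sdist (x *m reflmx v) y = sdist x (y *m reflmx v).
  by rewrite /sdist inner_reflC.
have h1 := lu _ _ Sx Sy; have h2 := lu _ _ Sx' Sy'; rewrite d1 in h2.
have h3 := lu _ _ Sx Sy'; have h4 := lu _ _ Sx' Sy; rewrite d2 in h4.
(* on opposite sides the reflection brings the points together *)
have opp : inner x v * inner y v <= 0 -> sdist x (y *m reflmx v) <= sdist x y.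
  move=> xyv; have := @sdist_same_side _ _ x (y *m reflmx v) v Sx Sy' v0.
  rewrite inner_refl_normal// mulrN oppr_ge0 => /(_ xyv).
  by have /= -> := reflK v0 y.
rewrite /polarize; case: (leP 0 (inner x v)) => xv; case: (leP 0 (inner y v)) => yv.
- rewrite lerBlDr ge_max; apply/andP; split.
    by rewrite -lerBlDr (le_trans _ h1)// lerB// le_max lexx.
  by rewrite -lerBlDr (le_trans _ h2)// lerB// le_max lexx orbT.
- have {}opp := ler_wpM2l L0 (opp (mulr_ge0_le0 xv (ltW yv))).
  by case: (leP (u x)) => _; case: (leP (u y)) => _; lra.
- have {}opp := ler_wpM2l L0 (opp (mulr_le0_ge0 (ltW xv) yv)).
  rewrite lerBlDr ge_min; apply/orP; left.
  by rewrite -lerBlDr (le_trans _ h1)// lerB// le_max lexx.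
- rewrite lerBlDl -lerBlDr le_min; apply/andP; split.
    by rewrite lerBlDr -lerBlDl (le_trans _ h1)// lerB// ge_min lexx.
  by rewrite lerBlDr -lerBlDl (le_trans _ h2)// lerB// ge_min lexx orbT.
Qed.

End slip_closure.

Section polarization_mean.
Context {R : realType} {n : nat}.
Variables (n_gt0 : (0 < n)%N) (sigma : probability (borelRV R n.+1) R).
Hypothesis haar : is_haar_sphere sigma.
Local Notation rV := 'rV[R]_n.+1.
Local Notation S := (sphere R n).
Local Notation E := (mean sigma S).
Implicit Types (x y z v e : rV) (u h : rV -> R) (L : R).

(** Integrating [polarize_pair] gives twice the mean on each side, by reflection invariance. *)
Lemma mean_polarize v u (phi : R -> R) L L' : v != 0 ->
  slip L (phi \o u) -> slip L' (phi \o polarize v u) ->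
  E (phi \o polarize v u) = E (phi \o u).
Proof.
move=> v0 lu lp; have mS := @measurable_sphere R n.
have bu := slip_bdmeas lu; have bp := slip_bdmeas lp.
have bu' := slip_bdmeas (slip_refl v0 lu).
have bp' := slip_bdmeas (slip_refl v0 lp).
have : E (phi \o polarize v u) + E (fun x => (phi \o polarize v u) (x *m reflmx v)) =
    E (phi \o u) + E (fun x => (phi \o u) (x *m reflmx v)).
  rewrite -!meanD//; apply: eq_mean => x _; exact: polarize_pair.
by rewrite (mean_refl n_gt0 haar lp v0) (mean_refl n_gt0 haar lu v0); lra.
Qed.

Lemma mean_gt0 L h x : slip L h -> (forall y, S y -> 0 <= h y) -> S x -> 0 < h x ->
  0 < E h.
Proof.
move=> lh h0 Sx hx; have mS := @measurable_sphere R n.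
have [|t t1 ht] := slip_near lh (_ : 0 < h x / 2); first by rewrite divr_gt0.
have mc := measurable_cap x t.
have c0 := haar_cap_gt0 n_gt0 haar Sx t1.
have bc : bdmeas S (\1_(cap x t) : borelRV R n.+1 -> R) by exact: bdmeas_indic.
apply: (@lt_le_trans _ _ (h x / 2 * E \1_(cap x t))).
  rewrite mulr_gt0 ?divr_gt0// mean_indic//; last by move=> y [].
  by apply: fine_gt0; rewrite c0 (le_lt_trans (probability_le1 _ _)) ?ltry.
rewrite -meanZ//; apply: le_mean => //; [exact: bdmeasZ|exact: slip_bdmeas lh|].
move=> y Sy; rewrite indicE; have [/set_mem[_ ty]|_] := boolP (y \in _).
  by have := ht _ _ Sx Sy (ltW ty); rewrite ler_norml mulr1 => /andP[_]; lra.
by rewrite mulr0 h0.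
Qed.

(* The polarized function is larger near [e]: pairing each point with its
   mirror image, [u] gives the larger of its two values to the nearer one. *)
Lemma mean_polarize_lt L u e x y : slip L u -> 0 <= L -> S e -> S x -> S y ->
  inner y e < inner x e -> u x < u y ->
  E (fun z => polarize (x - y) u z * sdist z e) < E (fun z => u z * sdist z e).
Proof.
move=> lu L0 Se Sx Sy yx uxy; have mS := @measurable_sphere R n.
pose v := x - y; rewrite -/v.
have xy : x != y by apply: contraTneq yx => ->; rewrite ltxx.
have v0 : v != 0 by rewrite subr_eq0.
have sx : x *m reflmx v = y by rewrite refl_swap// Sx Sy.
have ve : 0 < inner v e by rewrite innerBl subr_gt0.
have lp := slip_polarize L0 v0 lu.
have le := slip_sdist Se.
pose w z := polarize v u z - u z.
have lw : slip (L + L) w by exact: slipB.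
have wN z : w (z *m reflmx v) = - w z.
  have := @polarize_pair _ _ v u z id v0; rewrite /w /= => h.
  by apply/eqP; rewrite -subr_eq0; apply/eqP; move: h; lra.
have [Lw lwe] := slipM lw le.
have lwe' := slip_refl v0 lwe.
have [L3 lwe3] := slipM lw (slip_refl v0 le).
have [Lp lpe] := slipM lp le; have [Lu lue] := slipM lu le.
(* Both factors are odd under the reflection and nonnegative on the side of [e], so [h] is
   nonnegative everywhere; its mean is -2 times the change of the integral. *)
pose h z := w z * (sdist (z *m reflmx v) e - sdist z e).
have [Lh lh] : exists L', slip L' h by apply: slipM lw (slipB (slip_refl v0 le) le).
have Eh : E h = - (2 * E (fun z => w z * sdist z e)).
  have -> : E h = E (fun z => w z * sdist (z *m reflmx v) e - w z * sdist z e).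
    by apply: eq_mean => z _; rewrite /h mulrBr.
  rewrite meanB//; [|exact: slip_bdmeas lwe3|exact: slip_bdmeas lwe].
  have -> : E (fun z => w z * sdist (z *m reflmx v) e) =
      - E (fun z => w z * sdist z e).
    rewrite -(mean_refl n_gt0 haar lwe v0) -[RHS]mulN1r -meanZ//; last first.
      exact: slip_bdmeas lwe'.
    by apply: eq_mean => z _; rewrite wN; ring.
  by ring.
have wE : E (fun z => w z * sdist z e) =
    E (fun z => polarize v u z * sdist z e) - E (fun z => u z * sdist z e).
  rewrite -meanB//; [|exact: slip_bdmeas lpe|exact: slip_bdmeas lue].
  by apply: eq_mean => z _; rewrite /w mulrBl.
suff : 0 < E h by rewrite Eh wE; lra.
have inner_s z : inner (z *m reflmx v) e = inner z e - 2 * inner z v / inner v v * inner v e.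
  by rewrite mulmx_refl innerBl innerZl.
have vv : 0 < inner v v by rewrite inner_gt0.
apply: (mean_gt0 lh _ Sx).
  move=> z Sz; rewrite /h /w /polarize.
  have Sz' := sphere_refl v0 Sz.
  case: (leP 0 (inner z v)) => zv.
    rewrite mulr_ge0// subr_ge0; first by rewrite le_max lexx.
    apply: le_acos; rewrite ?inner_itv//.
    by rewrite inner_s gerBl !mulr_ge0 ?invr_ge0 ?(ltW vv) ?(ltW ve).
  rewrite mulr_le0// subr_le0; first by rewrite ge_min lexx.
  apply: le_acos; rewrite ?inner_itv//.
  rewrite inner_s lerDl oppr_ge0 mulr_le0_ge0 ?(ltW ve)// mulr_le0_ge0//.
    by rewrite mulr_ge0_le0// ltW.
  by rewrite invr_ge0 ltW.
rewrite /h /w /polarize sx.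
have -> : 0 <= inner x v.
  rewrite /v innerBr Sx subr_ge0.
  by have /andP[] := inner_le1 Sx Sy.
rewrite mulr_gt0// subr_gt0; first by rewrite lt_max uxy orbT.
rewrite ltNge; apply/negP => le1.
have : cos (sdist x e) <= cos (sdist y e).
  by rewrite leNgt ltr_cos ?in_itv/= ?sdist_ge0 ?sdist_lepi// -leNgt.
by rewrite !acosK ?inner_itv// leNgt yx.
Qed.

End polarization_mean.

(** * The extremal problem and its monotone solution *)

Section extremal.
Context {R : realType} {n : nat}.
Variables (n_gt0 : (0 < n)%N) (sigma : probability (borelRV R n.+1) R).
Hypothesis haar : is_haar_sphere sigma.
Local Notation rV := 'rV[R]_n.+1.
Local Notation S := (sphere R n).
Local Notation E := (mean sigma S).
Local Notation ptws := (prod_topology (fun _ : rV => R)).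
Implicit Types (x y z v e : rV) (u w : ptws) (L alpha a b : R).

Lemma sphere_net (t : R) : t < 1 -> exists2 s : seq rV, (forall p, p \in s -> S p) &
  forall x, S x -> exists2 p, p \in s & t < inner p x.
Proof.
move=> t1; have := @sphere_compact R n; rewrite compact_cover.
move=> /(_ 'rV[R]_n.+1 S (fun x => [set y | t < inner x y]))[].
- move=> y Sy; rewrite (_ : mkset _ = (fun z => inner z y) @^-1` `]t, +oo[%classic); last first.
    by apply/seteqP; split => z /=; rewrite in_itv/= andbT innerC.
  by have /continuousP := @inner_continuous R _ y; apply; exact: interval_open.
- by move=> y Sy; exists y => //=; rewrite Sy.
move=> D DS SD; exists D; first by move=> p /DS /set_mem.
by move=> x /SD[p Dp px]; exists p.
Qed.

Lemma near_on_seq (s : seq rV) u (e : R) : 0 < e ->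
  \forall w \near u, forall p, p \in s -> `|u p - w p| < e.
Proof.
move=> e0; have FF : Filter (nbhs u) by exact: nbhs_filter.
elim: s => [|q s IH]; first by apply: (@filterE _ _ FF) => w p; rewrite in_nil.
have hq : \forall w \near u, `|u q - w q| < e.
  exact: (@proj_continuous rV (fun _ => R) q u _ (nbhsx_ballx (u q) e e0)).
apply: (@filterS2 _ _ FF _ _ _ _ IH hq) => w ws wq p.
by rewrite inE => /orP[/eqP->//|]; exact: ws.
Qed.

(** Among 1-Lipschitz functions, closeness on a finite net implies closeness on the whole sphere, so
    pointwise neighbourhoods are uniform ones. *)
Lemma near_on_sphere u (e : R) : slip 1 u -> 0 < e ->
  \forall w \near u, slip 1 w -> forall x, S x -> `|u x - w x| <= e.
Proof.
move=> lu e0.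
have e3 : 0 < e / 3 by rewrite divr_gt0.
have [t t1 ht] := @near_sdist R n _ e3.
have [s sS ns] := sphere_net t1.
apply: (@filterS _ _ (nbhs_filter u) _ _ _ (near_on_seq s u e3)) => w uw lw x Sx.
have [p ps px] := ns x Sx; have Sp := sS _ ps.
have d := ht _ _ Sp Sx (ltW px).
have h1 := slip_norm lu Sx Sp; have h2 := slip_norm lw Sp Sx.
rewrite mul1r sdistC in h1; rewrite mul1r in h2.
have h3 := uw _ ps.
have -> : u x - w x = (u x - u p) + (u p - w p) + (w p - w x) by ring.
rewrite (le_trans (ler_normD _ _))// (le_trans (lerD (ler_normD _ _) (lexx _)))//.
by lra.
Qed.

(** For t >= 0, Lipschitz majorants of the indicator of 0 that decrease to it as m grows. *)
Definition ramp (m : nat) (t : R) : R := Num.max 0 (1 - m%:R * t).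

Lemma ramp_dist (m : nat) (s t : R) : `|ramp m s - ramp m t| <= m%:R * `|s - t|.
Proof.
wlog st : s t / s <= t.
  have [st h|/ltW ts h] := leP s t; first exact: h.
  by rewrite distrC (distrC s) h.
have mst : m%:R * s <= m%:R * t by rewrite ler_wpM2l.
rewrite [X in _ * X]distrC (@ger0_norm _ (t - s)) ?subr_ge0//.
rewrite /ramp; case: (leP 0 (1 - m%:R * s)) => s1; case: (leP 0 (1 - m%:R * t)) => t1.
- by rewrite ger0_norm; lra.
- by rewrite ger0_norm; lra.
- by lra.
- by rewrite subrr normr0 mulr_ge0// subr_ge0.
Qed.

(* Functions that separate, in mean, sets of measures [a] (where [u] vanishes)
   and [b] (where [u] is [alpha]); unlike the indicators of these two sets, the
   ramps make the conditions closed under pointwise convergence. *)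
Definition admissible alpha a b : set ptws := [set u |
  [/\ forall x, 0 <= u x <= alpha, slip 1 u,
      forall m, a <= E (fun x => ramp m (u x)) &
      forall m, b <= E (fun x => ramp m (alpha - u x))]].

Lemma slip_ramp_comp L (m : nat) (f : rV -> R) : slip L f ->
  bdmeas S (fun x : borelRV R n.+1 => ramp m (f x)).
Proof. by move=> lf; have := slip_bdmeas (slip_ramp m lf). Qed.

Lemma slip_cstB L c (f : rV -> R) : slip L f -> slip L (fun x => c - f x).
Proof.
by move=> lf x y Sx Sy; have := lf _ _ Sy Sx; rewrite sdistC; lra.
Qed.

Lemma mean_ramp_le (m : nat) L (f g : rV -> R) (e : R) : slip L f -> slip L g ->
  (forall x, S x -> `|f x - g x| <= e) ->
  E (fun x => ramp m (f x)) <= E (fun x => ramp m (g x)) + m%:R * e.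
Proof.
move=> lf lg fg; have mS := @measurable_sphere R n.
have : `|E (fun x => ramp m (f x)) - E (fun x => ramp m (g x))| <= m%:R * e.
  apply: mean_dist_le => //; first exact: (haar_carried haar).
  - exact: slip_ramp_comp lf.
  - exact: slip_ramp_comp lg.
  - by move=> x Sx; rewrite (le_trans (ramp_dist _ _ _))// ler_wpM2l// fg.
by rewrite ler_norml => /andP[_]; lra.
Qed.

Lemma ler_addgt0_mul (k : R) (s t : R) : 0 <= k ->
  (forall e : R, 0 < e -> s <= t + k * e) -> s <= t.
Proof.
move=> k0 h; apply/ler_addgt0Pr => e e0.
have k1 : 0 < k + 1 by rewrite ltr_wpDl.
rewrite (le_trans (h (e / (k + 1)) _)) ?divr_gt0// lerD2l.
by rewrite mulrA ler_pdivrMr// mulrC ler_pM2l// lerDl.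
Qed.

(** Approximation at two points already makes the limit 1-Lipschitz; only then is uniform
    approximation available, and it carries the conditions on means over to the limit. *)
Lemma admissible_closed alpha a b : closed (admissible alpha a b).
Proof.
move=> u /= cu.
have lu : slip 1 u.
  move=> x y Sx Sy; apply: (@ler_addgt0_mul 2) => // e e0.
  have [w [[_ lw _ _]]] := cu _ (near_on_seq [:: x; y] u e0).
  move=> /= uw; have := lw _ _ Sx Sy.
  have := uw x; have := uw y; rewrite !inE !eqxx orbT => /(_ isT) + /(_ isT).
  rewrite !ltr_norml => /andP[? ?] /andP[? ?]; lra.
have approx (e : R) : 0 < e -> exists w, admissible alpha a b w /\
    forall x, S x -> `|u x - w x| <= e.
  move=> e0; have [w [aw uw]] := cu _ (near_on_sphere lu e0).
  by exists w; split => //; apply: uw; case: aw.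
split=> //.
- move=> x; apply/andP; split; apply/ler_addgt0Pr => e e0;
    have [w [[+ _ _ _] /= uw]] := cu _ (near_on_seq [:: x] u e0);
    move=> /(_ x) /andP[? ?]; have := uw x; rewrite inE eqxx => /(_ isT);
    by rewrite ltr_norml => /andP[? ?]; lra.
- move=> m; apply: (@ler_addgt0_mul m%:R) => // e e0.
  have [w [[_ lw aw _] uw]] := approx e e0.
  rewrite (le_trans (aw m))//; apply: (mean_ramp_le _ lw lu) => x Sx.
  by rewrite distrC uw.
- move=> m; apply: (@ler_addgt0_mul m%:R) => // e e0.
  have [w [[_ lw _ bw] uw]] := approx e e0.
  rewrite (le_trans (bw m))//.
  apply: (mean_ramp_le _ (slip_cstB alpha lw) (slip_cstB alpha lu)) => x Sx.
  have -> : alpha - w x - (alpha - u x) = u x - w x by ring.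
  exact: uw.
Qed.

Lemma admissible_compact alpha a b : compact (admissible alpha a b).
Proof.
apply: (subclosed_compact (@admissible_closed alpha a b)
  (tychonoff (fun _ : rV => @segment_compact R 0 alpha))).
by move=> u [u0 _ _ _] x /=; rewrite in_itv/=.
Qed.

Lemma mean_sdist_continuous alpha a b e : S e ->
  {within admissible alpha a b, continuous (fun u : ptws => E (fun x => u x * sdist x e))}.
Proof.
move=> Se; have mS := @measurable_sphere R n.
apply/subspace_continuousP => u [_ lu _ _].
have p0 : 0 < pi + 1 :> R by rewrite ltr_wpDl ?pi_ge0.
apply/cvgrPdist_le => eps eps0.
have e0 : 0 < eps / (pi + 1) by rewrite divr_gt0.
apply: (@filterS _ _ (nbhs_filter u) _ _ _ (near_on_sphere lu e0)) => w uw [_ lw _ _].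
have le := slip_sdist Se.
have [L1 l1] := slipM lu le; have [L2 l2] := slipM lw le.
apply: mean_dist_le => //; first exact: (haar_carried haar).
- exact: slip_bdmeas l1.
- exact: slip_bdmeas l2.
move=> x Sx; rewrite -mulrBl normrM.
have -> : eps = eps / (pi + 1) * (pi + 1) by rewrite divfK// gt_eqF.
apply: ler_pM => //; first exact: uw.
by rewrite ger0_norm ?sdist_ge0// (le_trans (sdist_lepi Sx Se))// lerDl.
Qed.

(* [u] minimizes [E (u * sdist ^~ e)]: no polarization improves it. *)
Lemma monotone_admissible alpha a b e u0 : S e -> admissible alpha a b u0 ->
  exists2 u, admissible alpha a b u &
    forall x y, S x -> S y -> inner y e < inner x e -> u y <= u x.
Proof.
move=> Se au0.
have [u /set_mem au umin] := compact_EVT_min (ex_intro _ u0 au0)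
  (@admissible_compact alpha a b) (@mean_sdist_continuous alpha a b e Se).
exists u => // x y Sx Sy yx; rewrite leNgt; apply/negP => uxy.
have [u0a lu ua ub] := au.
have v0 : x - y != 0.
  by rewrite subr_eq0; apply: contraTneq yx => ->; rewrite ltxx.
have lp := slip_polarize ler01 v0 lu.
have ap : admissible alpha a b (polarize (x - y) u).
  split=> //.
  - by move=> z; exact: polarize_itv.
  - move=> m; rewrite (le_trans (ua m))//.
    by rewrite -(@mean_polarize _ _ n_gt0 _ haar _ u (ramp m) _ _ v0
      (slip_ramp m lu) (slip_ramp m lp)).
  - move=> m; rewrite (le_trans (ub m))//.
    by rewrite -(@mean_polarize _ _ n_gt0 _ haar _ u (fun t => ramp m (alpha - t))
      _ _ v0 (slip_ramp m (slip_cstB alpha lu)) (slip_ramp m (slip_cstB alpha lp))).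
have := umin _ (mem_set ap); rewrite leNgt => /negP; apply.
exact: (mean_polarize_lt n_gt0 haar lu).
Qed.

End extremal.

(** * Isoperimetric inequality for two separated sets *)

Section isoperimetry.
Context {R : realType} {n : nat}.
Variables (n_gt0 : (0 < n)%N) (sigma : probability (borelRV R n.+1) R).
Hypothesis haar : is_haar_sphere sigma.
Local Notation rV := 'rV[R]_n.+1.
Local Notation S := (sphere R n).
Local Notation E := (mean sigma S).
Implicit Types (x y z : rV) (A B : set (borelRV R n.+1)) (alpha a b t s p q : R).

Lemma lt_sinint k s t : 0 <= s -> s < t -> t <= pi -> @sinint R k s < sinint k t.
Proof.
move=> s0 st tpi.
have D c : c \in `]s, t[ -> is_derive c 1 (@sinint R k) (sin c ^+ k).
  rewrite in_itv/= => /andP[sx xt]; apply: is_derive_sinint.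
  by rewrite (le_lt_trans s0)// (lt_le_trans xt).
have [c] := MVT st D (continuous_subspaceT (@sinint_continuous R k)).
rewrite in_itv/= => /andP[sx xt] h; rewrite -subr_gt0 h mulr_gt0 ?subr_gt0//.
by rewrite exprn_gt0// sin_gt0_pi// (le_lt_trans s0)//= (lt_le_trans xt).
Qed.

Lemma Sigma_surj b : 0 <= b -> b <= 1 -> exists p, 0 <= p <= pi /\ Sigma n p = b.
Proof.
move=> b0 b1; have W0 := @sinint_gt0 R n.-1.
have [|p] := @IVT R (sinint n.-1) 0 pi (b * sinint n.-1 pi) (pi_ge0 R)
  (continuous_subspaceT (@sinint_continuous R n.-1)).
  rewrite sinint0 (min_idPl (ltW W0)) (max_idPr (ltW W0)).
  by rewrite mulr_ge0 ?(ltW W0)//= ler_piMl// ltW.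
rewrite in_itv/= => pI pE; exists p; split => //.
by rewrite SigmaE// pE mulfK// gt_eqF.
Qed.

Lemma lt_Sigma s t : 0 <= s -> s < t -> t <= pi -> Sigma n s < Sigma n t.
Proof.
move=> s0 st tpi; have W0 := @sinint_gt0 R n.-1.
rewrite !SigmaE ?s0 ?tpi ?(le_trans s0) ?(ltW st)//; last by rewrite (le_trans (ltW st)).
by rewrite ltr_pM2r ?invr_gt0// lt_sinint.
Qed.

Lemma Sigma0 : Sigma n 0 = 0 :> R.
Proof. by rewrite SigmaE ?lexx ?pi_ge0// sinint0 mul0r. Qed.

Lemma Sigma_ge0 s : 0 <= s <= pi -> 0 <= Sigma n s.
Proof.
move=> /andP[s0 spi]; rewrite SigmaE ?s0// divr_ge0 ?sinint_ge0 ?pi_ge0//.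
Qed.

Lemma Sigma_logconcave p q : 0 <= p -> 0 <= q -> p + q <= pi ->
  Sigma n p * Sigma n q <= Sigma n ((p + q) / 2) ^+ 2.
Proof.
move=> p0 q0 pq; have W0 := @sinint_gt0 R n.-1.
rewrite !SigmaE; try (apply/andP; split; lra).
rewrite mulf_div expr_div_n -expr2 ler_pM2r ?invr_gt0 ?exprn_gt0//.
exact: sinint_logconcave.
Qed.

(** The point at angle t from the pole on a fixed great circle, along which differences of angles
    are geodesic distances; [inord 1] is a second coordinate because [0 < n]. *)
Definition meridian t : rV :=
  cos t *: delta_mx 0 0 + sin t *: delta_mx 0 (inord 1).

Lemma inner_meridian s t : inner (meridian s) (meridian t) = cos (s - t).
Proof.
have i01 : (0 == inord 1 :> 'I_n.+1) = false.
  by apply/eqP => /(congr1 val) /=; rewrite inordK.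
rewrite /meridian !(innerDl, innerDr, innerZl, innerZr) !delta_inner !eqxx.
by rewrite i01 eq_sym i01 cosB /=; ring.
Qed.

Lemma sphere_meridian t : S (meridian t).
Proof. by rewrite /sphere/= inner_meridian subrr cos0. Qed.

Lemma meridian0 t : meridian t 0 0 = cos t.
Proof.
have i01 : (0 == inord 1 :> 'I_n.+1) = false.
  by apply/eqP => /(congr1 val) /=; rewrite inordK.
by rewrite /meridian !mxE !eqxx i01 /= mulr1 mulr0 addr0.
Qed.

Lemma sdist_meridian s t : 0 <= s -> s <= t -> t <= pi ->
  sdist (meridian s) (meridian t) = t - s.
Proof.
move=> s0 st tpi; rewrite /sdist inner_meridian -cosN opprB cosK//.
by rewrite in_itv/= subr_ge0 st (le_trans _ tpi)// gerBl.
Qed.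

Lemma measurable_lower_cap t :
  measurable ([set x | S x /\ (x : rV) 0 0 <= cos t] : set (borelRV R n.+1)).
Proof.
apply: measurableI; first exact: measurable_sphere.
rewrite -[X in measurable X]setTI.
have := @measurable_coord R n.+1 0 measurableT `]-oo, cos t]%classic (measurable_itv _).
by congr (measurable (_ `&` _)); apply/seteqP; split => y /=; rewrite in_itv/=.
Qed.

(** Reversing the coordinates 0 and 1 is a rotation that takes this set to the polar cap of radius
    pi - t; the antipodal map need not be a rotation. *)
Lemma lower_cap_le t : 0 <= t -> t <= pi ->
  fine (sigma [set x | S x /\ (x : rV) 0 0 <= cos t]) <= Sigma n (pi - t).
Proof.
move=> t0 tpi.
have tpi' : 0 <= pi - t <= pi by apply/andP; split; lra.
have /andP[h1 h2] := tpi'.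
apply: le_trans (polar_cap_le n_gt0 haar h1 h2).
pose e j : rV := delta_mx 0 j.
have e0 j : e j != 0 by rewrite -inner_eq0 delta_inner eqxx oner_eq0.
have rA := rotation_refl2 (e0 0) (e0 (inord 1)).
rewrite -(haar_invariant haar rA (measurable_polar_cap (pi - t))).
have i01 : (0 == inord 1 :> 'I_n.+1) = false.
  by apply/eqP => /(congr1 val) /=; rewrite inordK.
have xA x : (x *m (reflmx (e 0) *m reflmx (e (inord 1)))) 0 0 = - x 0 0.
  rewrite mulmxA !mulmx_refl !delta_inner !eqxx !innerBl !innerZl !inner_delta.
  by rewrite !mxE !eqxx i01/=; field.
rewrite le_eqVlt; apply/orP; left; apply/eqP; congr (fine (sigma _)).
apply/seteqP; split => x /= [].
  move=> Sx xt; split; first exact: sphere_rotation.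
  by rewrite xA cosB cospi sinpi mul0r addr0 mulN1r lerN2.
rewrite xA cosB cospi sinpi mul0r addr0 mulN1r lerN2 => Sx xt; split => //.
by move: Sx; rewrite /sphere/= inner_rotation//; case: rA.
Qed.

(* The distance to [A], truncated at [alpha], is admissible. A monotone
   competitor shows that opposite caps of the measures of [A] and [B] are still
   [alpha] apart, and log-concavity of [Sigma] balances their radii. *)
Lemma separated_sets A B alpha : measurable A -> measurable B ->
  A `<=` S -> B `<=` S -> 0 < alpha -> alpha <= pi ->
  (forall x y, A x -> B y -> alpha <= sdist x y) ->
  fine (sigma A) * fine (sigma B) <= Sigma n ((pi - alpha) / 2) ^+ 2.
Proof.
move=> mA mB AS BS alpha0 alphapi AB; have mS := @measurable_sphere R n.
set a := fine (sigma A); set b := fine (sigma B).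
have sq : 0 <= Sigma n ((pi - alpha) / 2) ^+ 2 :> R by exact: sqr_ge0.
have a_ge0 : 0 <= a by rewrite fine_ge0.
have b_ge0 : 0 <= b by rewrite fine_ge0.
have a1 : a <= 1 by rewrite -[leRHS]/(fine 1%E) fine_le ?fin_num_measure ?probability_le1.
have b1 : b <= 1 by rewrite -[leRHS]/(fine 1%E) fine_le ?fin_num_measure ?probability_le1.
have [aE|aN0] := eqVneq a 0; first by rewrite aE mul0r.
have [bE|bN0] := eqVneq b 0; first by rewrite bE mulr0.
have a0 : 0 < a by rewrite lt_def aN0.
have b0 : 0 < b by rewrite lt_def bN0.
have [x0 Ax0] : A !=set0.
  by apply/set0P; apply: contra_neq aN0 => A0; rewrite /a A0 measure0.
pose D x := [set sdist x y | y in A].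
have D0 x : D x !=set0 by exists (sdist x x0), x0.
have lbD x : S x -> has_lbound (D x).
  by move=> Sx; exists 0 => _ [y Ay <-]; rewrite sdist_ge0//; exact: AS.
have infD x y : S x -> A y -> inf (D x) <= sdist x y.
  by move=> Sx Ay; apply: ge_inf; [exact: lbD|exists y].
have infD_ge x c : (forall y, A y -> c <= sdist x y) -> c <= inf (D x).
  by move=> h; apply: lb_le_inf => // _ [y Ay <-]; exact: h.
(* The value 0 off the sphere keeps the range in [0, alpha] on the whole space, as [admissible]
   demands. *)
pose u0 : rV -> R := fun x => if x \in S then Num.min alpha (inf (D x)) else 0.
have u0E x : S x -> u0 x = Num.min alpha (inf (D x)).
  by move=> Sx; rewrite /u0 mem_set.
have lu0 : slip 1 u0.
  move=> x y Sx Sy; rewrite !u0E// mul1r lerBlDr -lerBlDl le_min; apply/andP; split.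
    by rewrite lerBlDl ge_min lerDr sdist_ge0.
  apply: infD_ge => z Az; rewrite lerBlDl ge_min; apply/orP; right.
  by rewrite (le_trans (infD _ _ Sx Az))// sdist_triangle//; exact: AS.
have u0_itv x : 0 <= u0 x <= alpha.
  rewrite /u0; case: ifPn => [/set_mem Sx|_]; last by rewrite lexx ltW.
  rewrite ge_min lexx le_min (ltW alpha0) !andbT/=.
  by apply: infD_ge => y Ay; rewrite sdist_ge0//; exact: AS.
have mean_ge (C : set (borelRV R n.+1)) (f : rV -> R) m L : measurable C -> C `<=` S ->
    slip L f -> (forall x, C x -> f x = 0) ->
    fine (sigma C) <= E (fun x => ramp m (f x)).
  move=> mC CS lf f0; rewrite -(mean_indic sigma mS mC CS); apply: le_mean => //.
  - exact: bdmeas_indic.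
  - exact: slip_ramp_comp lf.
  move=> x Sx; rewrite indicE; have [/set_mem Cx|_] := boolP (x \in C).
    by rewrite f0// /ramp mulr0 subr0 le_max lexx orbT.
  by rewrite /ramp le_max lexx.
have au0 : admissible sigma alpha a b u0.
  split=> // m; [apply: (mean_ge _ _ _ _ mA AS lu0)|
                 apply: (mean_ge _ _ _ _ mB BS (slip_cstB alpha lu0))] => x Cx.
    have Sx := AS _ Cx.
    rewrite u0E//; apply/le_anti; rewrite ge_min le_min (ltW alpha0)/=.
    have -> : inf (D x) <= 0 by rewrite -(sdistxx Sx) infD.
    rewrite orbT/=.
    by apply: infD_ge => y Ay; rewrite sdist_ge0//; exact: AS.
  have Sx := BS _ Cx; rewrite u0E// (min_idPl _) ?subrr//.
  by apply: infD_ge => y Ay; rewrite sdistC; exact: AB.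
have Se : S (delta_mx 0 0) by rewrite /sphere/= delta_inner eqxx.
have [u [u_itv lu ua ub] umono] := monotone_admissible n_gt0 haar Se au0.
have {}umono x y : S x -> S y -> y 0 0 < x 0 0 -> u y <= u x.
  by move=> Sx Sy yx; apply: umono => //; rewrite !inner_delta.
(* A ramp steeper than 1/c vanishes where f >= c, so it lies below the indicator of [C]. *)
have mean_le (C : set (borelRV R n.+1)) (f : rV -> R) L c : measurable C -> C `<=` S ->
    slip L f -> 0 < c -> (forall x, S x -> 0 <= f x) ->
    (forall x, S x -> ~ C x -> c <= f x) ->
    exists m, E (fun x => ramp m (f x)) <= fine (sigma C).
  move=> mC CS lf c0 f0 fc; exists (Num.truncn c^-1).+1.
  rewrite -(mean_indic sigma mS mC CS); apply: le_mean => //.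
  - exact: slip_ramp_comp lf.
  - exact: bdmeas_indic.
  move=> x Sx; rewrite indicE; have [_|/negP] := boolP (x \in C).
    by rewrite /ramp ge_max ler01 gerBl mulr_ge0// f0.
  move=> nC; rewrite /ramp ge_max lexx subr_le0/=.
  have {}nC : ~ C x by move=> Cx; apply: nC; exact: mem_set.
  rewrite (@le_trans _ _ ((Num.truncn c^-1).+1%:R * c))//; last first.
    by rewrite ler_wpM2l// fc.
  by rewrite -ler_pdivrMr// div1r ltW// truncnS_gt.
(* By monotonicity [u] is bounded below by this positive value at all greater heights, so what
   stands for its zero set is confined to the lower cap. [up] is the mirror argument for the value
   [alpha]. *)
have low t : 0 <= t -> t <= pi -> 0 < u (meridian t) -> a <= Sigma n (pi - t).
  move=> t0 tpi ut; apply: le_trans (lower_cap_le t0 tpi).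
  have CS : [set x | S x /\ (x : rV) 0 0 <= cos t] `<=` S by move=> x [].
  have u0' x : S x -> 0 <= u x by move=> _; have /andP[] := u_itv x.
  have uC x : S x -> ~ (S x /\ x 0 0 <= cos t) -> u (meridian t) <= u x.
    move=> Sx nC; apply: umono => //; first exact: sphere_meridian.
    by rewrite meridian0 ltNge; apply/negP => xt; apply: nC.
  have [m] := mean_le _ _ _ _ (measurable_lower_cap t) CS lu ut u0' uC.
  exact: le_trans (ua m).
have up t : 0 <= t -> t <= pi -> u (meridian t) < alpha -> b <= Sigma n t.
  move=> t0 tpi ut; apply: le_trans (polar_cap_le n_gt0 haar t0 tpi).
  have ut' : 0 < alpha - u (meridian t) by rewrite subr_gt0.
  have CS : polar_cap t `<=` (S : set (borelRV R n.+1)) by move=> x [].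
  have u0' x : S x -> 0 <= alpha - u x.
    by move=> _; rewrite subr_ge0; have /andP[] := u_itv x.
  have uC x : S x -> ~ polar_cap t x -> alpha - u (meridian t) <= alpha - u x.
    move=> Sx nC; rewrite lerB//; apply: umono => //; first exact: sphere_meridian.
    by rewrite meridian0 ltNge; apply/negP => xt; apply: nC.
  have [m] := mean_le _ _ _ _ (measurable_polar_cap t) CS (slip_cstB alpha lu) ut' u0' uC.
  exact: le_trans (ub m).
have [p [/andP[p0 ppi] pE]] := Sigma_surj b_ge0 b1.
have [q [/andP[q0 qpi] qE]] := Sigma_surj a_ge0 a1.
(* By [up] and [low], [u] equals [alpha] at angle p1 from the pole and 0 at angle q1 from the
   opposite pole; the Lipschitz bound along the meridian separates them by at least [alpha]. *)
have pq p1 q1 : 0 <= p1 -> p1 < p -> 0 <= q1 -> q1 < q -> p1 + q1 <= pi - alpha.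
  move=> p10 p1p q10 q1q.
  have hp : u (meridian p1) = alpha.
    apply/le_anti; have /andP[_ ->] := u_itv (meridian p1); rewrite leNgt/=.
    apply/negP => ut; have := up _ p10 (le_trans (ltW p1p) ppi) ut.
    by rewrite -pE leNgt lt_Sigma.
  have hq : u (meridian (pi - q1)) = 0.
    apply/le_anti; have /andP[-> _] := u_itv (meridian (pi - q1)); rewrite leNgt/= andbT.
    have h1 : 0 <= pi - q1 by lra.
    have h2 : pi - q1 <= pi by lra.
    apply/negP => ut; have := low _ h1 h2 ut.
    by rewrite subKr -qE leNgt lt_Sigma.
  have p1q1 : p1 <= pi - q1.
    rewrite leNgt; apply/negP => lt1.
    have /umono : (meridian p1 : rV) 0 0 < (meridian (pi - q1) : rV) 0 0.
      by rewrite !meridian0 ltr_cos ?in_itv/=; [|apply/andP; split; lra..].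
    move=> /(_ (sphere_meridian _) (sphere_meridian _)); rewrite hp hq.
    by rewrite leNgt alpha0.
  have := lu _ _ (sphere_meridian p1) (sphere_meridian (pi - q1)).
  rewrite hp hq sdist_meridian//; last by lra.
  by lra.
have {}pq : p + q <= pi - alpha.
  rewrite leNgt; apply/negP => lt1.
  (* A quarter of the excess: shortening both radii by [d] still leaves half of it. The maximum with
     0 keeps the shortened radii admissible. *)
  pose d := (p + q - (pi - alpha)) / 4.
  have d0 : 0 < d by rewrite /d; lra.
  have p_gt0 : 0 < p.
    rewrite lt_def p0 andbT; apply: contraTneq b0 => pz.
    by rewrite -pE pz Sigma0 ltxx.
  have q_gt0 : 0 < q.
    rewrite lt_def q0 andbT; apply: contraTneq a0 => qz.
    by rewrite -qE qz Sigma0 ltxx.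
  have := pq (Num.max 0 (p - d)) (Num.max 0 (q - d)).
  rewrite !le_max lexx !gt_max p_gt0 q_gt0 !ltrBlDr !ltrDl d0 => /(_ isT isT isT isT).
  have : p - d <= Num.max 0 (p - d) by rewrite le_max lexx orbT.
  have : q - d <= Num.max 0 (q - d) by rewrite le_max lexx orbT.
  by rewrite /d; lra.
rewrite -qE -pE mulrC (le_trans (Sigma_logconcave p0 q0 _))//; first by lra.
rewrite lerXn2r ?nnegrE ?Sigma_ge0//; try (apply/andP; split; lra).
have [<-//|] := eqVneq ((p + q) / 2) ((pi - alpha) / 2).
by move=> ne; apply/ltW/lt_Sigma; rewrite ?lt_neqAle ?ne; lra.
Qed.

End isoperimetry.

(** * Layer-cake formula in exponential coordinates *)

Section exponential_layer_cake.
Context {R : realType}.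
Local Notation leb := (@lebesgue_measure R).
Implicit Types (c t : R).

Lemma integral_expR_Ny c t : 0 < c ->
  (\int[leb]_(x in `]-oo, t[) (expR (c * x))%:E = (c^-1 * expR (c * t))%:E)%E.
Proof.
move=> c0; have cN0 : c != 0 by rewrite gt_eqF.
have cexp : continuous (fun x : R => expR (c * x)).
  move=> x; apply: (@continuous_comp _ _ _ (fun x => c * x) expR); last exact: continuous_expR.
  by apply: cvgM; [exact: cvg_cst|exact: cvg_id].
have mexp : measurable_fun setT (fun x : R => expR (c * x)) by exact: continuous_measurable_fun.
rewrite integral_itv_bndo_bndc; last exact/measurable_EFinP/measurable_funTS.
rewrite -{1}(opprK t) ge0_integration_by_substitutionNy; last 2 first.
- exact: continuous_subspaceT.
- by move=> x _; exact: expR_ge0.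
pose F (x : R) := - (c^-1 * expR (- (c * x))).
have dF (x : R) : is_derive x 1 F (expR (c * - x)).
  have D1 : is_derive x 1 (fun x => - (c * x)) (- (c * 1)).
    by apply: is_deriveN; apply: is_deriveZ.
  have D2 := @is_derive1_comp _ expR (fun x => - (c * x)) x _ _ (is_derive_expR _) D1.
  have D3 := is_deriveN (is_deriveZ c^-1 D2).
  apply: (is_derive_eq D3); rewrite /GRing.scale/=.
  transitivity (expR (- (c * x)) * (c * c^-1)); first by ring.
  by rewrite mulfV// mulr1 mulrN.
have cF : continuous F.
  by move=> x; apply/differentiable_continuous/derivable1_diffP; case: (dF x).
rewrite (@ge0_continuous_FTC2y R _ F _ 0).
- by rewrite sub0e -EFinN /F opprK mulrN opprK.
- by move=> x _; exact: expR_ge0.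
- apply: continuous_subspaceT => x.
  apply: (@continuous_comp _ _ _ -%R (fun x => expR (c * x))); last exact: cexp.
  exact: opp_continuous.
- rewrite /F -oppr0; apply: cvgN; rewrite -(mulr0 c^-1).
  apply: cvgM; first exact: cvg_cst.
  apply: (@cvg_comp _ _ _ (fun x => c * x) (fun y => expR (- y)) _ +oo); last exact: cvgr_expR.
  exact: gt0_cvgMry.
- by move=> x _; case: (dF x).
- by apply: cvg_at_right_filter; exact: cF.
- by move=> x _; rewrite derive1E; case: (dF x).
Qed.

Variables (d : measure_display) (T : measurableType d).
Variable mu : {sigma_finite_measure set T -> \bar R}.

(** Tonelli on the set expR (c a) < h x: for fixed x with h x > 0, a runs up to ln (h x) / c, where
    the exponential integrates to h x / c. *)
Lemma layer_cake_expR c (h : T -> R) : 0 < c -> measurable_fun setT h ->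
  (forall x, 0 <= h x) ->
  measurable_fun setT (fun a => mu [set x | (expR (c * a) < h x)%R] * (expR (c * a))%:E)%E /\
  (\int[leb]_a (mu [set x | (expR (c * a) < h x)%R] * (expR (c * a))%:E) =
   c^-1%:E * \int[mu]_x (h x)%:E)%E.
Proof.
move=> c0 mh h0; have cN0 : c != 0 by rewrite gt_eqF.
pose M : set (T * measurableTypeR R) := [set z | expR (c * z.2) < h z.1].
have mexp : measurable_fun setT (fun a : measurableTypeR R => expR (c * a)).
  apply: continuous_measurable_fun => x.
  apply: (@continuous_comp _ _ _ (fun x => c * x) expR); last exact: continuous_expR.
  by apply: cvgM; [exact: cvg_cst|exact: cvg_id].
have mM : measurable M.
  have m1 : measurable_fun setT (fun z : T * measurableTypeR R => h z.1 - expR (c * z.2)).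
    apply: measurable_funB; first exact: (measurableT_comp mh measurable_fst).
    exact: (measurableT_comp mexp measurable_snd).
  rewrite (_ : M = setT `&` (fun z : T * measurableTypeR R => h z.1 - expR (c * z.2))
      @^-1` `]0, +oo[); first exact: (m1 measurableT _ (measurable_itv _)).
  by apply/seteqP; split => z; rewrite /M/= in_itv/= andbT subr_gt0 //; case.
have mF : measurable_fun setT (fun z : T * measurableTypeR R => (expR (c * z.2) * \1_M z)%:E).
  apply/measurable_EFinP/measurable_funM; last exact: measurable_indic.
  exact: (measurableT_comp mexp measurable_snd).
have F0 (z : T * measurableTypeR R) : (0 <= (expR (c * z.2) * \1_M z)%:E)%E.
  by rewrite lee_fin mulr_ge0// expR_ge0.
have Ma a : measurable [set x | expR (c * a) < h x].
  rewrite (_ : mkset _ = setT `&` h @^-1` `]expR (c * a), +oo[).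
    exact: (mh measurableT _ (measurable_itv _)).
  by apply/seteqP; split => z; rewrite /= in_itv/= andbT //; case.
have FE : (fun a => mu [set x | (expR (c * a) < h x)%R] * (expR (c * a))%:E)%E =
    (fun a => \int[mu]_x (expR (c * a) * \1_M (x, a))%:E)%E.
  apply/funext => a.
  rewrite (_ : (fun x => _) = fun x => ((expR (c * a))%:E *
    (\1_[set x | (expR (c * a) < h x)%R] x)%:E)%E)//.
  rewrite ge0_integralZl_EFin ?expR_ge0//; last first.
    exact/measurable_EFinP/measurable_indic.
  by rewrite integral_indic// setIT muleC.
rewrite FE; split.
  exact: (measurable_fun_fubini_tonelli_G (fun z : T * measurableTypeR R =>
    (expR (c * z.2) * \1_M z)%:E) mF F0).
rewrite -(fubini_tonelli _ mF F0) -ge0_integralZl_EFin//; last 3 first.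
- by move=> x _; rewrite lee_fin.
- exact/measurable_EFinP.
- by rewrite invr_ge0 ltW.
apply: eq_integral => x _.
have [hx|hx] := leP (h x) 0.
  have -> : h x = 0 by apply/le_anti; rewrite hx h0.
  rewrite mule0 integral0_eq// => a _.
  rewrite indicE memNset ?mulr0// /M/=; apply/negP; rewrite -leNgt.
  by rewrite (le_trans hx)// expR_ge0.
have hE : h x = expR (c * (c^-1 * ln (h x))).
  by rewrite mulrA mulfV// mul1r lnK.
rewrite -EFinM [in RHS]hE -(integral_expR_Ny _ c0) [RHS]integral_mkcond.
apply: eq_integral => a _; rewrite patchE.
have -> : (a \in `]-oo, c^-1 * ln (h x)[%classic) = ((x, a) \in M).
  apply/idP/idP => /set_mem; rewrite /M/= => ha; apply: mem_set => /=.
    by rewrite hE ltr_expR ltr_pM2l//; move: ha; rewrite in_itv.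
  by rewrite in_itv/= -(ltr_pM2l c0) -ltr_expR -hE.
by rewrite indicE; case: ifP => _; rewrite ?mulr1 ?mulr0.
Qed.

End exponential_layer_cake.

(** * Brunn-Minkowski inequality on the line *)

Section brunn_minkowski_line.
Context {R : realType}.
Local Notation leb := (@lebesgue_measure R).
Implicit Types (A B C : set (measurableTypeR R)) (d : R).

Lemma lebesgue_shift A d : measurable A -> leb [set x | A (x + d)] = leb A.
Proof.
move=> mA.
have mphi : measurable_fun setT (shift d : measurableTypeR R -> measurableTypeR R).
  apply: continuous_measurable_fun => x.
  by apply: cvgD; [exact: cvg_id|exact: cvg_cst].
pose phi : {mfun measurableTypeR R >-> measurableTypeR R} :=
  HB.pack (shift d : measurableTypeR R -> measurableTypeR R)
    (isMeasurableFun.Build _ _ _ _ _ mphi).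
apply/esym/(@lebesgue_measure_unique _ (pushforward leb phi)) => //= _ [[a b]] _ <-.
rewrite /pushforward/= (_ : _ @^-1` _ = `]a - d, b - d]%classic); last first.
  by apply/seteqP; split => x /=; rewrite !in_itv/= ltrBlDr lerBrDr.
rewrite !lebesgue_measure_itv/= !lte_fin ltrD2r.
by case: ifP => // _; rewrite -!EFinB; congr (_%:E); ring.
Qed.

(** Stands in for a largest point of [A], which may not exist. If [A] is bounded above, what lies
    beyond a point within [e] of the supremum has measure at most [e]; otherwise the parts of [A]
    below the integers exhaust it. *)
Lemma lebesgue_lower_part A (x y : \bar R) : measurable A -> A !=set0 -> (0 <= x)%E ->
  (forall a, A a -> leb (A `&` `]-oo, a[) + x <= y)%E -> (leb A + x <= y)%E.
Proof.
move=> mA [a0 Aa0] x0 Ay.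
have mAI (i : interval R) : measurable (A `&` [set` i]).
  by apply: measurableI => //; exact: measurable_itv.
have xy : (x <= y)%E by rewrite (le_trans _ (Ay _ Aa0))// leeDr.
have [->|yoo] := eqVneq y +oo%E; first exact: leey.
have yfin : y \is a fin_num by rewrite ge0_fin_numE ?ltey// (le_trans x0).
have xfin : x \is a fin_num.
  by rewrite ge0_fin_numE// (le_lt_trans xy)// ltey.
rewrite -leeBrDr//.
have {}Ay a : A a -> (leb (A `&` `]-oo, a[) <= y - x)%E.
  by move=> Aa; rewrite leeBrDr// Ay.
have [ubA|nubA] := pselect (has_ubound A).
  have supA : has_sup A by split => //; exists a0.
  apply/lee_addgt0Pr => e e0.
  have [a Aa ea] := sup_adherent e0 supA.
  apply: (@le_trans _ _ (leb ((A `&` `]-oo, a[) `|` `[a, sup A]))%E).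
    apply: le_measure; rewrite ?inE//.
      by apply: measurableU; [exact: mAI|exact: measurable_itv].
    move=> b Ab; have [ba|ab] := ltP b a; [left|right]; first by rewrite /= in_itv.
    by rewrite /= in_itv/= ab sup_ubound.
  rewrite (le_trans (measureU2 _ (mAI `]-oo, a[) (measurable_itv `[a, sup A])))//.
  rewrite leeD ?Ay//= lebesgue_measure_itv/= lte_fin; case: ifP => _.
    by rewrite -EFinB lee_fin lerBlDl -lerBlDr ltW.
  by rewrite lee_fin ltW.
pose F k := A `&` `]-oo, (k%:R : R)].
have ndF : nondecreasing_seq F.
  move=> k l kl; apply/subsetPset => b [Ab /=]; rewrite in_itv/= => bk.
  by split => //; rewrite /= in_itv/= (le_trans bk)// ler_nat.
have FE : \bigcup_k F k = A.
  apply/seteqP; split => [b [k _ []]//|b Ab].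
  exists (Num.truncn `|b|).+1 => //; split => //=; rewrite in_itv/=.
  by rewrite (le_trans (ler_norm _))// ltW// truncnS_gt.
have := @nondecreasing_cvg_mu _ _ _ leb F (fun k => mAI _) _ ndF.
rewrite FE => /(_ mA); apply: cvge_le; apply: nearW => k.
have [a Aa ka] : exists2 a, A a & k%:R < a.
  apply: contra_notP nubA => h; exists k%:R => a Aa; rewrite leNgt; apply/negP => ka.
  by apply: h; exists a.
apply: le_trans (Ay _ Aa); apply: le_measure; rewrite ?inE//; try exact: mAI.
move=> b [Ab /=]; rewrite in_itv/= => bk.
by split => //; rewrite /= in_itv/= (le_lt_trans bk).
Qed.

(** Fix a point [a] of [A] and a point of [B], written [- b] below. The part of [A] below [a] moved
    by [- b], and the part of [B] above [- b] moved by [a], both lie in [C], on opposite sides of a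
    - b. [lebesgue_lower_part], for [A] and for the reflection of [B], recovers the full
    measures. *)
Lemma brunn_minkowski_line A B C : measurable A -> measurable B -> measurable C ->
  A !=set0 -> B !=set0 -> (forall a b, A a -> B b -> C (a + b)) ->
  (leb A + leb B <= leb C)%E.
Proof.
move=> mA mB mC A0 B0 ABC.
apply: lebesgue_lower_part => // a Aa; rewrite addeC.
pose NB : set (measurableTypeR R) := [set b | B (- b)].
have NE (D : set (measurableTypeR R)) : measurable D -> leb [set b | D (- b)] = leb D.
  by move=> mD; rewrite -[RHS](lebesgue_measureN mD).
have mNB : measurable NB.
  have mN : measurable_fun setT (-%R : measurableTypeR R -> measurableTypeR R).
    by apply: continuous_measurable_fun; exact: opp_continuous.
  by rewrite -[NB]setTI; exact: (mN measurableT _ mB).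
rewrite -(NE _ mB); apply: lebesgue_lower_part => //.
  by have [b Bb] := B0; exists (- b); rewrite /NB/= opprK.
move=> b /= Bb.
have mAI (D : set (measurableTypeR R)) (i : interval R) : measurable D ->
    measurable (D `&` [set` i]).
  by move=> mD; apply: measurableI => //; exact: measurable_itv.
have mshift (D : set (measurableTypeR R)) e : measurable D -> measurable [set c | D (c + e)].
  move=> mD.
  have mphi : measurable_fun setT (shift e : measurableTypeR R -> measurableTypeR R).
    apply: continuous_measurable_fun => x.
    by apply: cvgD; [exact: cvg_id|exact: cvg_cst].
  by rewrite -[X in measurable X]setTI; exact: (mphi measurableT _ mD).
pose A' := A `&` `]-oo, a[.
pose B' := B `&` `]- b, +oo[.
have mA' : measurable A' by exact: mAI.
have mB' : measurable B' by exact: mAI.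
have -> : leb (NB `&` `]-oo, b[) = leb B'.
  rewrite -(NE _ mB'); congr (leb _); apply/seteqP; split => c /=;
    by rewrite /B'/= !in_itv/= andbT ltrN2.
rewrite -(lebesgue_shift (- a) mB') -(lebesgue_shift b mA').
rewrite -measureU; [|exact: mshift|exact: mshift|].
  apply: le_measure; rewrite ?inE//; first by apply: measurableU; exact: mshift.
  move=> c [[Bc _]|[Ac _]].
    by have := ABC _ _ Aa Bc; rewrite addrC subrK.
  by have := ABC _ _ Ac Bb; rewrite addrK.
apply/seteqP; split => // c [[_ h1] [_ h2]]; move: h1 h2.
by rewrite /= !in_itv/= andbT; lra.
Qed.

End brunn_minkowski_line.

(** * Prekopa-Leindler inequality on the line *)

Section prekopa_leindler_line.
Context {R : realType}.
Local Notation leb := (@lebesgue_measure R).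
Implicit Types (U V W : measurableTypeR R -> R).

(** The arithmetic-geometric mean inequality: after squaring, the normalizing constants cancel and
    the gap is (i/p - j/q)^2 p q. *)
Lemma prekopa_leindler_real (p q i j k : R) : 0 < p -> 0 < q -> 0 <= i -> 0 <= j ->
  0 <= k -> i / p + j / q <= k / Num.sqrt (p * q) -> 4 * (i * j) <= k * k.
Proof.
move=> p0 q0 i0 j0 k0; have pq : 0 < p * q by rewrite mulr_gt0.
rewrite ler_pdivlMr ?sqrtr_gt0// => h.
have h0 : 0 <= (i / p + j / q) * Num.sqrt (p * q).
  by rewrite mulr_ge0 ?addr_ge0 ?divr_ge0 ?sqrtr_ge0// ltW.
have := ler_pM h0 h0 h h; apply: le_trans.
rewrite -expr2 exprMn sqr_sqrtr ?(ltW pq)// -subr_ge0.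
have -> : (i / p + j / q) ^+ 2 * (p * q) - 4 * (i * j) = (i / p - j / q) ^+ 2 * (p * q).
  by field; rewrite !gt_eqF.
by rewrite mulr_ge0 ?sqr_ge0// ltW.
Qed.

(** Divided by their suprema, [U] and [V] have nonempty level sets for the same t in [0, 1[, so
    Brunn-Minkowski, which fails for empty sets, applies at every level that counts. Boundedness
    serves to have these suprema. *)
Lemma prekopa_leindler_bounded U V W (k : R) :
  measurable_fun setT U -> measurable_fun setT V -> measurable_fun setT W ->
  (forall a, 0 <= U a <= k) -> (forall a, 0 <= V a <= k) -> (forall a, 0 <= W a) ->
  (forall a b, U a * V b <= W (a + b) ^+ 2) ->
  (4%:E * (\int[leb]_a (U a)%:E * \int[leb]_a (V a)%:E) <=
   \int[leb]_a (W a)%:E * \int[leb]_a (W a)%:E)%E.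
Proof.
move=> mU mV mW U0k V0k W0 UVW.
have U0 a : 0 <= U a by have /andP[] := U0k a.
have V0 a : 0 <= V a by have /andP[] := V0k a.
set I := (\int[leb]_a (U a)%:E)%E; set J := (\int[leb]_a (V a)%:E)%E.
set K := (\int[leb]_a (W a)%:E)%E.
have I0 : (0 <= I)%E by apply: integral_ge0 => a _; rewrite lee_fin.
have J0 : (0 <= J)%E by apply: integral_ge0 => a _; rewrite lee_fin.
have K0 : (0 <= K)%E by apply: integral_ge0 => a _; rewrite lee_fin.
have sup_pos (X : measurableTypeR R -> R) : (forall a, 0 <= X a <= k) -> (forall a, X a = 0) \/
    [/\ 0 < sup (range X), forall a, X a <= sup (range X) &
        forall t, t < 1 -> 0 <= t -> exists a, t * sup (range X) < X a].
  move=> X0k; have [X0|nX0] := pselect (forall a, X a = 0); [by left|right].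
  have [a0 Xa0] : exists a, X a != 0.
    by apply: contra_notP nX0 => h a; apply/eqP; apply: contra_notT h => Xa; exists a.
  have hs : has_sup (range X).
    split; first by exists (X a0), a0.
    by exists k => _ [a _ <-]; have /andP[] := X0k a.
  have Xle a : X a <= sup (range X) by apply: sup_ubound; [case: hs|exists a].
  have s0 : 0 < sup (range X).
    rewrite (lt_le_trans _ (Xle a0))// lt_def Xa0.
    by have /andP[] := X0k a0.
  split => // t t1 t0.
  have e0 : 0 < (1 - t) * sup (range X) by rewrite mulr_gt0// subr_gt0.
  have [_ [a _ <-]] := sup_adherent e0 hs.
  by rewrite (_ : _ - _ = t * sup (range X)); [exists a|ring].
have [Uz|[p0 Up Uex]] := sup_pos U U0k.
  rewrite (_ : I = 0%E) ?mul0e ?mule0 ?mule_ge0//.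
  by rewrite /I; under eq_integral do rewrite Uz; rewrite integral0.
have [Vz|[q0 Vq Vex]] := sup_pos V V0k.
  rewrite (_ : J = 0%E) ?mule0 ?mule_ge0//.
  by rewrite /J; under eq_integral do rewrite Vz; rewrite integral0.
set p := sup (range U) in p0 Up Uex; set q := sup (range V) in q0 Vq Vex.
(* Values above t p and t q multiply to more than (t r)^2, so [W] exceeds t r at the sum of the
   points. *)
pose r := Num.sqrt (p * q).
have pq0 : 0 < p * q by rewrite mulr_gt0.
have r0 : 0 < r by rewrite sqrtr_gt0.
have r2 : r ^+ 2 = p * q by rewrite sqr_sqrtr// ltW.
have scale (X : measurableTypeR R -> R) (s : R) : 0 < s -> measurable_fun setT X -> (forall a, 0 <= X a) ->
    measurable_fun setT (fun a => X a / s) /\ (forall a, 0 <= X a / s).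
  move=> s0 mX X0; split; last by move=> a; rewrite divr_ge0// ltW.
  by apply: measurable_funM => //; exact: measurable_cst.
have [mU' U'0] := scale U p p0 mU U0; have [mV' V'0] := scale V q q0 mV V0.
have [mW' W'0] := scale W r r0 mW W0.
have [mLU LU] := layer_cake_expR leb ltr01 mU' U'0.
have [mLV LV] := layer_cake_expR leb ltr01 mV' V'0.
have [mLW LW] := layer_cake_expR leb ltr01 mW' W'0.
have mlev (X : measurableTypeR R -> R) t : measurable_fun setT X -> measurable [set x | t < X x].
  move=> mX; rewrite (_ : mkset _ = setT `&` X @^-1` `]t, +oo[).
    exact: (mX measurableT _ (measurable_itv _)).
  by apply/seteqP; split => z; rewrite /= in_itv/= andbT //; case.
have key : (\int[leb]_a ((U a / p)%:E) + \int[leb]_a ((V a / q)%:E) <=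
    \int[leb]_a ((W a / r)%:E))%E.
  rewrite -[leRHS]mul1e -{1}invr1 -LW.
  rewrite -[X in (X + _)%E]mul1e -[X in (_ + X)%E]mul1e -{1 2}invr1 -LU -LV.
  rewrite -ge0_integralD//; last 2 first.
  - by move=> a _; rewrite mule_ge0// lee_fin expR_ge0.
  - by move=> a _; rewrite mule_ge0// lee_fin expR_ge0.
  apply: ge0_le_integral => //.
  - by move=> a _; rewrite adde_ge0// mule_ge0// lee_fin expR_ge0.
  - exact: emeasurable_funD.
  move=> a _; rewrite -ge0_muleDl// lee_wpmul2r ?lee_fin ?expR_ge0//.
  rewrite mul1r; set t := expR a.
  have t0 : 0 <= t by exact: expR_ge0.
  have [t1|t1] := leP 1 t.
    have empty (X : measurableTypeR R -> R) (s : R) : 0 < s -> (forall a, X a <= s) -> [set x | t < X x / s] = set0.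
      move=> s0 Xs; apply/seteqP; split => x //=; rewrite ltNge => /negP; apply.
      by rewrite ler_pdivrMr// (le_trans (Xs x))// ler_peMl// ltW.
    by rewrite (empty _ _ p0 Up) (empty _ _ q0 Vq) measure0 add0e.
  apply: brunn_minkowski_line; try exact: mlev.
  - by have [x tx] := Uex _ t1 t0; exists x => /=; rewrite ltr_pdivlMr.
  - by have [x tx] := Vex _ t1 t0; exists x => /=; rewrite ltr_pdivlMr.
  move=> x y /=; rewrite !ltr_pdivlMr// => tx ty.
  rewrite -(@ltr_pXn2r _ 2)// ?nnegrE// ?mulr_ge0 ?(ltW r0)//.
  rewrite (lt_le_trans _ (UVW x y))// exprMn r2.
  rewrite (_ : t ^+ 2 * (p * q) = (t * p) * (t * q)); last by ring.
  by apply: ltr_pM => //; rewrite mulr_ge0// ltW.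
have intZ (X : measurableTypeR R -> R) (s : R) : 0 < s -> measurable_fun setT X -> (forall a, 0 <= X a) ->
    (\int[leb]_a (X a / s)%:E = \int[leb]_a (X a)%:E * s^-1%:E)%E.
  move=> s0 mX X0; under eq_integral do rewrite EFinM.
  rewrite ge0_integralZr//.
  - exact/measurable_EFinP.
  - by move=> a _; rewrite lee_fin.
  - by rewrite lee_fin invr_ge0 ltW.
rewrite !intZ// -/I -/J -/K in key.
have [Koo|Koo] := eqVneq K +oo%E; first by rewrite Koo mulyy leey.
have Kfin : K \is a fin_num by rewrite ge0_fin_numE// ltey.
have fin_ (X : \bar R) (s : R) : (0 <= X)%E -> 0 < s -> (X * s^-1%:E < +oo -> X \is a fin_num)%E.
  move=> X0 s0; case: X X0 => [x|_|]//.
  by rewrite gt0_mulye ?lte_fin ?invr_gt0.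
have Kr : (K * r^-1%:E < +oo)%E by rewrite -(fineK Kfin) -EFinM ltry.
have Ifin : I \is a fin_num.
  apply: (fin_ _ p) => //; apply: le_lt_trans Kr; apply: le_trans key.
  by rewrite leeDl// mule_ge0// lee_fin invr_ge0 ltW.
have Jfin : J \is a fin_num.
  apply: (fin_ _ q) => //; apply: le_lt_trans Kr; apply: le_trans key.
  by rewrite leeDr// mule_ge0// lee_fin invr_ge0 ltW.
move: key; rewrite -(fineK Ifin) -(fineK Jfin) -(fineK Kfin) -!EFinM -EFinD !lee_fin.
by apply: prekopa_leindler_real => //; exact: fine_ge0.
Qed.

(** Truncate [U] and [V] at m, which preserves the hypothesis with the same [W], and use monotone
    convergence. *)
Lemma prekopa_leindler_line U V W :
  measurable_fun setT U -> measurable_fun setT V -> measurable_fun setT W ->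
  (forall a, 0 <= U a) -> (forall a, 0 <= V a) -> (forall a, 0 <= W a) ->
  (forall a b, U a * V b <= W (a + b) ^+ 2) ->
  (4%:E * (\int[leb]_a (U a)%:E * \int[leb]_a (V a)%:E) <=
   \int[leb]_a (W a)%:E * \int[leb]_a (W a)%:E)%E.
Proof.
move=> mU mV mW U0 V0 W0 UVW.
set I := (\int[leb]_a (U a)%:E)%E; set J := (\int[leb]_a (V a)%:E)%E.
have I0 : (0 <= I)%E by apply: integral_ge0 => a _; rewrite lee_fin.
have J0 : (0 <= J)%E by apply: integral_ge0 => a _; rewrite lee_fin.
have K0 : (0 <= \int[leb]_a (W a)%:E)%E by apply: integral_ge0 => a _; rewrite lee_fin.
(* Zero integrals are set apart: the product of the limits would not be continuous at 0 times
   +oo. *)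
have [->|IN0] := eqVneq I 0%E; first by rewrite mul0e mule0 mule_ge0.
have [->|JN0] := eqVneq J 0%E; first by rewrite !mule0 mule_ge0.
pose tr (X : measurableTypeR R -> R) (m : nat) (a : measurableTypeR R) := Num.min (X a) m%:R.
have trcvg (X : measurableTypeR R -> R) : measurable_fun setT X -> (forall a, 0 <= X a) ->
    (\int[leb]_a (tr X m a)%:E @[m --> \oo] --> \int[leb]_a (X a)%:E)%E.
  move=> mX X0.
  have mtr m : measurable_fun setT (tr X m).
    by apply: measurable_minr => //; exact: measurable_cst.
  rewrite (eq_integral (fun a => limn (fun m => (tr X m a)%:E))); last first.
    move=> a _; apply/esym/cvg_lim => //; apply: cvg_near_cst.
    exists (Num.truncn (X a)).+1 => // m /= Xm; congr (_%:E).
    apply/min_idPl; rewrite (le_trans (ltW (truncnS_gt _)))//.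
    by rewrite ler_nat.
  apply: cvg_monotone_convergence => //.
  - by move=> m; exact/measurable_EFinP.
  - by move=> m a _; rewrite lee_fin le_min X0 ler0n.
  - move=> a _ m m' mm'; rewrite lee_fin le_min !ge_min lexx /=.
    by rewrite ler_nat mm' orbT.
have tr_min (X : measurableTypeR R -> R) m : (forall a, 0 <= X a) -> forall a, 0 <= tr X m a <= m%:R.
  by move=> X0 a; rewrite le_min X0 ler0n ge_min lexx orbT.
have cI := trcvg U mU U0; have cJ := trcvg V mV V0.
have IJ : (I *? J)%E.
  by apply: neq0_mule_def; rewrite mule_neq0.
have c4 : (4%:E * (\int[leb]_a (tr U m a)%:E * \int[leb]_a (tr V m a)%:E)
    @[m --> \oo] --> 4%:E * (I * J))%E.
  by apply: cvgeZl => //; exact: cvgeM.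
apply: (cvge_le _ c4); apply: nearW => m.
apply: (@prekopa_leindler_bounded _ _ _ m%:R) => //.
- by apply: measurable_minr => //; exact: measurable_cst.
- by apply: measurable_minr => //; exact: measurable_cst.
- exact: tr_min.
- exact: tr_min.
move=> a b; rewrite (le_trans _ (UVW a b))// ler_pM//.
- by have /andP[] := tr_min U m U0 a.
- by have /andP[] := tr_min V m V0 b.
- by rewrite ge_min lexx.
- by rewrite ge_min lexx.
Qed.

End prekopa_leindler_line.

(** * The measure dG on lower sets *)

Section stieltjes.
Context {R : realType}.
Variable n : nat.
Local Notation dG := (lebesgue_stieltjes_measure (@Gext R n)).
Implicit Types (a b r rho : R) (T : set R).

Lemma stieltjes_itvoc a b : a <= b -> dG `]a, b] = (Gext n b - Gext n a)%:E.
Proof.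
move=> ab; rewrite /lebesgue_stieltjes_measure /measure_extension measurable_mu_extE/=.
  by rewrite wlength_itv_bnd.
exact: is_ocitv.
Qed.

Lemma Gext_N1 r : r <= -1 -> Gext n r = 0 :> R.
Proof.
move=> r1; rewrite /Gext /G.
have -> : clamp (-1) 1 r = -1 by rewrite /clamp; apply/max_idPl; rewrite ge_min r1 orbT.
by rewrite acosN1 subrr mul0r Sigma0.
Qed.

Lemma Gext_ge0 r : 0 <= Gext n r :> R.
Proof.
rewrite -(Gext_N1 (lexx (-1))); have [r1|/ltW r1] := leP (-1) r.
  exact: Gext_nondecreasing.
by rewrite (Gext_N1 r1) (Gext_N1 (lexx _)).
Qed.

(** [T] is an interval starting at -1 whose right end may or may not belong to it; continuity of
    [Gext] makes this irrelevant. For empty [T] the end is -1, where [Gext] vanishes. *)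
Lemma stieltjes_lower_set T : measurable T -> T `<=` `](-1), 1] ->
  (forall r s, T s -> -1 < r -> r <= s -> T r) ->
  exists rho, [/\ -1 <= rho <= 1, forall r, T r -> r <= rho &
    ((Gext n rho)%:E <= dG T)%E].
Proof.
move=> mT TI Tdown.
have [T0|/set0P[r0 Tr0]] := eqVneq T set0.
  exists (-1); split.
  - by rewrite lexx/= (le_trans (@lerN10 R)).
  - by move=> r; rewrite T0.
  - by rewrite Gext_N1// measure_ge0.
have T1 r : T r -> -1 < r <= 1 by move=> /TI; rewrite /= in_itv.
have hs : has_sup T by split; [exists r0|exists 1 => r /T1 /andP[]].
have Tle r : T r -> r <= sup T by move=> Tr; apply: sup_ubound => //; case: hs.
have rho1 : sup T <= 1 by apply: ge_sup; [exists r0|move=> r /T1 /andP[]].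
have rho0 : -1 <= sup T.
  by have /andP[h _] := T1 _ Tr0; rewrite (le_trans (ltW h))// Tle.
exists (sup T); split => //; first by rewrite rho0.
have below r : -1 <= r -> r < sup T -> ((Gext n r)%:E <= dG T)%E.
  move=> r1 rs.
  have [s Ts rs'] : exists2 s, T s & r < s.
    have e0 : 0 < sup T - r by rewrite subr_gt0.
    by have [s Ts] := sup_adherent e0 hs; rewrite subKr; exists s.
  rewrite -[X in (X%:E <= _)%E]subr0 -{1}(Gext_N1 (lexx (-1))) -stieltjes_itvoc//.
  apply: le_measure; rewrite ?inE//.
  move=> u /=; rewrite in_itv/= => /andP[u1 ur].
  by apply: (Tdown _ s) => //; rewrite (le_trans ur)// ltW.
have [rho_eq|rho_gt] := eqVneq (sup T) (-1).
  by rewrite rho_eq Gext_N1// measure_ge0.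
have {}rho_gt : -1 < sup T by rewrite lt_def rho_gt.
have cG : (Gext n r)%:E @[r --> (sup T)^'-] --> (Gext n (sup T))%:E.
  apply: cvg_EFin; first by apply: nearW.
  by apply: cvg_at_left_filter; exact: Gext_continuous.
apply: (cvge_le _ cG); near=> r; apply: below.
  by near: r; exact: nbhs_left_ge.
by near: r; exact: nbhs_left_lt.
Unshelve. all: by end_near. Qed.

End stieltjes.

(** * Level sets on the sphere and the functional inequality *)

Section level_sets.
Context {R : realType} {n : nat}.
Variables (n_gt0 : (0 < n)%N) (sigma : probability (borelRV R n.+1) R).
Hypothesis haar : is_haar_sphere sigma.
Local Notation rV := 'rV[R]_n.+1.
Local Notation S := (sphere R n).
Implicit Types (A B : set (borelRV R n.+1)).

Lemma separated_sets_G A B (rho : R) : measurable A -> measurable B ->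
  A `<=` S -> B `<=` S -> -1 <= rho -> rho < 1 ->
  (forall x y : rV, A x -> B y -> inner x y <= rho) ->
  fine (sigma A) * fine (sigma B) <= Gext n rho ^+ 2.
Proof.
move=> mA mB AS BS rho0 rho1 AB.
have rhoI : rho \in `[(-1), 1] by rewrite in_itv/= rho0 ltW.
rewrite Gext_id// /G.
have rhoI' : -1 <= rho <= 1 by rewrite rho0 ltW.
apply: (separated_sets n_gt0 haar mA mB AS BS).
- by rewrite acos_gt0// rho0.
- exact: acos_lepi.
- move=> x y Ax By; apply: le_acos => //; last exact: AB.
  by apply: inner_itv; [exact: AS|exact: BS].
Qed.

(** G(1) is [Sigma] at pi / 2, which bounds the measure of each of two closed hemispheres covering
    the sphere. *)
Lemma Gext1_ge : 1 / 2 <= Gext n 1 :> R.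
Proof.
have I1 : (1 : R) \in `[(-1), 1] by rewrite in_itv/= lexx andbT (le_trans (@lerN10 R)).
rewrite Gext_id// /G acos1 subr0.
have p0 : 0 <= pi / 2 :> R by rewrite divr_ge0 ?pi_ge0.
have p1 : pi / 2 <= pi :> R by rewrite ler_pdivrMr// ler_peMr ?pi_ge0// ler1n.
have h1 := polar_cap_le n_gt0 haar p0 p1.
have h2 := lower_cap_le n_gt0 haar p0 p1.
rewrite (_ : pi - pi / 2 = pi / 2) in h2; last by field.
suff : 1 <= fine (sigma (polar_cap (pi / 2))) +
    fine (sigma [set x | S x /\ (x : rV) 0 0 <= cos (pi / 2)]) by lra.
have m1 := @measurable_polar_cap R n (pi / 2).
have m2 := @measurable_lower_cap R n (pi / 2).
rewrite -lee_fin EFinD !fineK ?fin_num_measure//.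
rewrite -(haar_carried haar); apply: le_trans (measureU2 _ m1 m2).
apply: le_measure; rewrite ?inE; [exact: measurable_sphere|exact: measurableU|].
by move=> x Sx; case: (leP ((x : rV) 0 0) (cos (pi / 2))) => [?|/ltW ?]; [right|left].
Qed.

End level_sets.

Section functional_inequality.
Context {R : realType} {n : nat}.
Variables (n_gt0 : (0 < n)%N) (sigma : probability (borelRV R n.+1) R).
Hypothesis haar : is_haar_sphere sigma.
Local Notation rV := 'rV[R]_n.+1.
Local Notation S := (sphere R n).
Local Notation I := (`](-1), 1]%classic : set R).
Local Notation leb := (@lebesgue_measure R).
Local Notation dG := (lebesgue_stieltjes_measure (@Gext R n)).

Lemma stieltjes_fin_num (T : set R) : measurable T -> T `<=` I -> dG T \is a fin_num.
Proof.
move=> mT TI; rewrite ge0_fin_numE ?measure_ge0//.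
apply: (@le_lt_trans _ _ (dG I)); first by apply: le_measure; rewrite ?inE.
by rewrite stieltjes_itvoc ?ltry// (le_trans (@lerN10 R)).
Qed.

(** The default value 0 off [D] never exceeds a nonnegative level. *)
Lemma restrict_ltP (T : Type) (D : set T) (h : T -> R) (e : R) x : 0 <= e ->
  e < (h \_ D) x <-> D x /\ e < h x.
Proof.
move=> e0; rewrite patchE; case: ifPn => [/set_mem Dx|/negP DNx].
  by split=> [|[]].
split; first by rewrite ltNge e0.
by case=> Dx; case: DNx; exact: mem_set.
Qed.

Variables (f g : borelRV R n.+1 -> R) (Omega : R -> R).
Hypotheses (mf : measurable_fun S f) (mg : measurable_fun S g).
Hypotheses (f_ge0 : forall x, S x -> 0 <= f x) (g_ge0 : forall x, S x -> 0 <= g x).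
Hypothesis mOmega : measurable_fun I Omega.
Hypothesis Omega_gt0 : forall r, I r -> 0 < Omega r.
Hypothesis Omega_nincr : {in `](-1), 1] &, forall r s, r <= s -> Omega s <= Omega r}.
Hypothesis fg_le : forall x y : rV, S x -> S y -> x <> - y ->
  f x * g y <= Omega (inner x y) ^+ 2.

(** The constant of the final inequality, left as a parameter so that both claims share one
    proof. *)
Variable c : R.
Hypothesis c_cases : c = 2 \/
  c = 1 /\ (forall x y : rV, S x -> S y -> 0 < inner x y -> f x * g y = 0).

Let c_gt0 : 0 < c.
Proof. by case: c_cases => [->|[-> _]]. Qed.

Let mfS : measurable_fun setT (f \_ S).
Proof. exact: (measurable_restrictT f (@measurable_sphere R n)).1. Qed.

Let mgS : measurable_fun setT (g \_ S).
Proof. exact: (measurable_restrictT g (@measurable_sphere R n)).1. Qed.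

Let mOI : measurable_fun setT (Omega \_ I).
Proof. exact: (measurable_restrictT Omega (measurable_itv _)).1. Qed.

Let measurable_level (d : measure_display) (T : measurableType d) (h : T -> R) e :
  measurable_fun setT h -> measurable [set x | e < h x].
Proof.
move=> mh; rewrite -[X in measurable X]setTI.
exact: (measurable_fun_ltr (measurable_cst e) mh).
Qed.

Lemma level_sets_le (a b : R) :
  fine (sigma [set x | expR a < (f \_ S) x]) *
  fine (sigma [set x | expR b < (g \_ S) x]) <=
  (c * fine (dG [set r | expR (2^-1 * (a + b)) < (Omega \_ I) r])) ^+ 2.
Proof.
set A := [set x | expR a < _]; set B := [set x | expR b < _].
set T := [set r | _ < (Omega \_ I) r].
have AE x : A x <-> S x /\ expR a < f x by apply: restrict_ltP; exact: expR_ge0.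
have BE x : B x <-> S x /\ expR b < g x by apply: restrict_ltP; exact: expR_ge0.
have TE r : T r <-> I r /\ expR (2^-1 * (a + b)) < Omega r.
  by apply: restrict_ltP; exact: expR_ge0.
have mA : measurable A by exact: measurable_level.
have mB : measurable B by exact: measurable_level.
have mT : measurable T by exact: measurable_level.
have AS : A `<=` S by move=> x /AE[].
have BS : B `<=` S by move=> x /BE[].
have TI : T `<=` I by move=> x /TE[].
have Tdown r s : T s -> -1 < r -> r <= s -> T r.
  move=> /TE[Is lts] r1 rs; apply/TE; have /andP[s0 s1] : -1 < s <= 1.
    by move: Is; rewrite /= in_itv.
  have Ir : I r by rewrite /= in_itv/= r1 (le_trans rs).
  by split => //; apply: (lt_le_trans lts); exact: Omega_nincr.
have [rho [/andP[rho0 rho1] Trho rhoT]] := stieltjes_lower_set n mT TI Tdown.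
have finT := stieltjes_fin_num mT TI.
have {}rhoT : Gext n rho <= fine (dG T) by rewrite -lee_fin fineK.
have fg_gt x y : A x -> B y -> expR (2^-1 * (a + b)) ^+ 2 < f x * g y.
  move=> /AE[_ ax] /BE[_ By]; rewrite -expRM_natl mulrA divff ?pnatr_eq0// mul1r expRD.
  by apply: ltr_pM => //; exact: expR_ge0.
have ABrho x y : A x -> B y -> inner (x : rV) (y : rV) <= rho.
  move=> Ax By; have Sx := AS _ Ax; have Sy := BS _ By.
  (* Antipodal pairs escape the hypothesis on [f] and [g], but there the inner product is -1, at
     most [rho] anyway. *)
  have [->//|xyN] := eqVneq (inner (x : rV) (y : rV)) (-1).
  have xy : (x : rV) <> - (y : rV).
    move=> xy; move/eqP: xyN; apply; rewrite xy innerNl; congr -%R; exact: Sy.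
  have := lt_le_trans (fg_gt _ _ Ax By) (fg_le Sx Sy xy).
  have Ixy : I (inner (x : rV) (y : rV)).
    have := inner_itv Sx Sy; rewrite /= !in_itv/= => /andP[h0 ->].
    by rewrite andbT lt_def xyN.
  rewrite ltr_pXn2r// ?nnegrE ?expR_ge0//; last exact/ltW/Omega_gt0.
  by move=> h; apply: Trho; apply/TE.
have G0 := Gext_ge0 n rho.
have key r : -1 <= r -> r < 1 -> (forall x y : rV, A x -> B y -> inner x y <= r) ->
    r <= rho -> 1 <= c -> fine (sigma A) * fine (sigma B) <= (c * fine (dG T)) ^+ 2.
  move=> r0 r1 ABr rrho c1.
  apply: (le_trans (separated_sets_G n_gt0 haar mA mB AS BS r0 r1 ABr)).
  rewrite ler_pXn2r// ?nnegrE ?Gext_ge0 ?mulr_ge0 ?fine_ge0 ?measure_ge0 ?(ltW c_gt0)//.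
  apply: (le_trans (Gext_nondecreasing n rrho)); apply: (le_trans rhoT).
  by rewrite ler_peMl// fine_ge0 ?measure_ge0.
case: c_cases => [c2|[c1 fg0]].
- have [rhoE|rhoN] := eqVneq rho 1; last first.
    by apply: (key rho) => //; [rewrite lt_def eq_sym rhoN|rewrite c2 ler1n].
  have p1 D : measurable D -> 0 <= fine (sigma D) <= 1.
    by move=> mD; rewrite fine_ge0//= -lee_fin fineK ?fin_num_measure// probability_le1.
  have /andP[? ?] := p1 _ mA; have /andP[? ?] := p1 _ mB.
  have h := Gext1_ge n_gt0 haar; rewrite rhoE in rhoT.
  apply: (@le_trans _ _ 1); first by rewrite mulr_ile1.
  by rewrite exprn_ege1// c2; lra.
(* Here f x g y > 0 on A x B forces nonpositive inner products, so the bound can be lowered below 1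
   and the exceptional case [rho = 1] does not arise. *)
- apply: (key (Num.min rho 0)).
  + by rewrite le_min rho0 lerN10.
  + by rewrite gt_min ltr01 orbT.
  + move=> x y Ax By; rewrite le_min ABrho//= leNgt; apply/negP => xy0.
    have := fg_gt _ _ Ax By; rewrite (fg0 _ _ (AS _ Ax) (BS _ By) xy0).
    by rewrite ltNge exprn_ge0// expR_ge0.
  + by rewrite ge_min lexx.
  + by rewrite c1.
Qed.

Lemma functional_inequality :
  ((\int[sigma]_(x in S) (f x)%:E) `^ 2^-1 *
   (\int[sigma]_(x in S) (g x)%:E) `^ 2^-1 <=
   c%:E * \int[dG]_(r in I) (Omega r)%:E)%E.
Proof.
have f0 x : 0 <= (f \_ S) x by rewrite patchE; case: ifPn => // /set_mem /f_ge0.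
have g0 x : 0 <= (g \_ S) x by rewrite patchE; case: ifPn => // /set_mem /g_ge0.
have O0 x : 0 <= (Omega \_ I) x.
  by rewrite patchE; case: ifPn => // /set_mem /Omega_gt0/ltW.
have intE (d : measure_display) (T : measurableType d) (m : {measure set T -> \bar R})
    (D : set T) (h : T -> R) :
    (\int[m]_(x in D) (h x)%:E = \int[m]_x ((h \_ D) x)%:E)%E.
  rewrite integral_mkcond; apply: eq_integral => x _.
  by rewrite !patchE; case: ifP.
have [mU iU] := layer_cake_expR sigma (@ltr01 R) mfS f0.
have [mV iV] := layer_cake_expR sigma (@ltr01 R) mgS g0.
have half0 : 0 < 2^-1 :> R by rewrite invr_gt0.
have [mW iW] := layer_cake_expR dG half0 mOI O0.
pose U a := fine (sigma [set x | expR (1 * a) < (f \_ S) x]) * expR (1 * a).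
pose V a := fine (sigma [set x | expR (1 * a) < (g \_ S) x]) * expR (1 * a).
(* With a / 2 in the exponent, e^a e^b is the square of e^((a+b)/2), and the integral of [W] is 2 c
   times that of [Omega]. *)
pose W a := c * (fine (dG [set r | expR (2^-1 * a) < (Omega \_ I) r]) * expR (2^-1 * a)).
have finO a : dG [set r | expR (2^-1 * a) < (Omega \_ I) r] \is a fin_num.
  apply: stieltjes_fin_num; first exact: measurable_level.
  by move=> r /restrict_ltP[] //; exact: expR_ge0.
have UE a : (U a)%:E = (sigma [set x | expR (1 * a) < (f \_ S) x]%R * (expR (1 * a))%:E)%E.
  by rewrite EFinM fineK// fin_num_measure//; exact: measurable_level.
have VE a : (V a)%:E = (sigma [set x | expR (1 * a) < (g \_ S) x]%R * (expR (1 * a))%:E)%E.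
  by rewrite EFinM fineK// fin_num_measure//; exact: measurable_level.
have WE a : (W a)%:E =
    (c%:E * (dG [set r | expR (2^-1 * a) < (Omega \_ I) r]%R * (expR (2^-1 * a))%:E))%E.
  by rewrite EFinM EFinM fineK.
have mU' : measurable_fun setT (U : measurableTypeR R -> R).
  apply/measurable_EFinP; apply: eq_measurable_fun mU => a _; exact/esym/UE.
have mV' : measurable_fun setT (V : measurableTypeR R -> R).
  apply/measurable_EFinP; apply: eq_measurable_fun mV => a _; exact/esym/VE.
have mW' : measurable_fun setT (W : measurableTypeR R -> R).
  apply/measurable_EFinP.
  apply: (eq_measurable_fun _ _ (measurable_funeM c%:E mW)) => a _; exact/esym/WE.
have U0 a : 0 <= U a by rewrite mulr_ge0 ?expR_ge0 ?fine_ge0.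
have V0 a : 0 <= V a by rewrite mulr_ge0 ?expR_ge0 ?fine_ge0.
have W0 a : 0 <= W a by rewrite !mulr_ge0 ?expR_ge0 ?fine_ge0 ?(ltW c_gt0).
have UVW a b : U a * V b <= W (a + b) ^+ 2.
  have -> : W (a + b) ^+ 2 =
      (c * fine (dG [set r | expR (2^-1 * (a + b)) < (Omega \_ I) r])) ^+ 2 *
      (expR a * expR b).
    rewrite /W mulrA exprMn; congr (_ * _).
    by rewrite -expRM_natl mulrA divff ?pnatr_eq0// mul1r expRD.
  have := level_sets_le a b; rewrite /U /V !mul1r => h.
  by rewrite mulrACA ler_wpM2r// mulr_ge0 ?expR_ge0.
have := prekopa_leindler_line mU' mV' mW' U0 V0 W0 UVW.
under [X in (_ * (X * _) <= _)%E]eq_integral do rewrite UE.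
under [X in (_ * (_ * X) <= _)%E]eq_integral do rewrite VE.
under [X in (_ <= X * _)%E]eq_integral do rewrite WE.
under [X in (_ <= _ * X)%E]eq_integral do rewrite WE.
rewrite iU iV !invr1 !mul1e -!intE.

rewrite ge0_integralZl//; last 2 first.
- by move=> a _; rewrite mule_ge0 ?lee_fin ?expR_ge0.
- by rewrite lee_fin ltW.
rewrite iW invrK -intE.
set If := (\int[sigma]_(x in S) _)%E; set Ig := (\int[sigma]_(x in S) _)%E.
set K := (\int[dG]_(r in I) _)%E => le4.
have If0 : (0 <= If)%E by apply: integral_ge0 => x /f_ge0; rewrite lee_fin.
have Ig0 : (0 <= Ig)%E by apply: integral_ge0 => x /g_ge0; rewrite lee_fin.
have K0 : (0 <= K)%E by apply: integral_ge0 => x /Omega_gt0/ltW; rewrite lee_fin.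
have cK0 : (0 <= c%:E * K)%E by rewrite mule_ge0// lee_fin ltW.
(* The two factors 2 coming from [W] cancel the 4 of Prekopa-Leindler. *)
have : (If * Ig <= (c%:E * K) * (c%:E * K))%E.
  rewrite -(@lee_pmul2l _ 4%:E) ?lte_fin//; apply: (le_trans le4).
  rewrite [(c%:E * (_ * _))%E]muleCA muleACA -EFinM.
  by rewrite (_ : 2 * 2 = 4 :> R)//; ring.
rewrite -poweRM// => /(gt0_ler_poweR (ltW half0)) h.
apply: (le_trans (h _ _)); rewrite ?in_itv/= ?leey ?mule_ge0 ?lee_fin ?(ltW c_gt0)//.
rewrite poweRM// -poweRD; last by rewrite poweRD_defE gt_eqF// addr_gt0.
by rewrite (_ : 2^-1 + 2^-1 = 1) ?poweRe1//; field.
Qed.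

End functional_inequality.

Theorem corollary1p6 (R : realType) (n : nat) (n_gt0 : (0 < n)%N)
    (sigma : probability (borelRV R n.+1) R) (haar : is_haar_sphere sigma)
    (f g : borelRV R n.+1 -> R) (Omega : R -> R)
    (mf : measurable_fun (sphere R n) f)
    (mg : measurable_fun (sphere R n) g)
    (f_ge0 : forall x, sphere R n x -> 0 <= f x)
    (g_ge0 : forall x, sphere R n x -> 0 <= g x)
    (mOmega : measurable_fun (`](-1), 1]%classic : set R) Omega)
    (Omega_gt0 : forall r, `](-1), 1]%classic r -> 0 < Omega r)
    (Omega_nincr : {in `](-1), 1] &, forall r s, r <= s -> Omega s <= Omega r})
    (fg_le : forall x y : 'rV[R]_n.+1, sphere R n x -> sphere R n y ->
      x <> - y -> f x * g y <= Omega (inner x y) ^+ 2) :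
  ((\int[sigma]_(x in sphere R n) (f x)%:E) `^ 2^-1 *
   (\int[sigma]_(x in sphere R n) (g x)%:E) `^ 2^-1 <=
   2%:E * \int[lebesgue_stieltjes_measure (Gext n)]_(r in `](-1)%R, 1%R])
            (Omega r)%:E)%E
  /\
  ((forall x y : 'rV[R]_n.+1, sphere R n x -> sphere R n y ->
      0 < inner x y -> f x * g y = 0) ->
   ((\int[sigma]_(x in sphere R n) (f x)%:E) `^ 2^-1 *
    (\int[sigma]_(x in sphere R n) (g x)%:E) `^ 2^-1 <=
    \int[lebesgue_stieltjes_measure (Gext n)]_(r in `](-1)%R, 1%R])
       (Omega r)%:E)%E).
Proof.
have ineq := functional_inequality n_gt0 haar mf mg f_ge0 g_ge0 mOmega Omega_gt0
  Omega_nincr fg_le.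
split=> [|fg0]; first by apply: ineq; left.
by rewrite -[leRHS]mul1e; apply: ineq; right.
Qed.
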